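(* Let $f(z)$ be a transcendental entire function and let $n,k$ be positive integers. Suppose that $f(z)^n f^{(k)}(z)$ is a periodic function with period $c$, and that one of the following holds: (i) $f(z)$ has the value $0$ as a Picard exceptional value, and $\rho_2(f)<\infty$; (ii) $f(z)$ has a non-zero (finite) Picard exceptional value. Then $f(z)$ is a periodic function of period $c$ or $(n+1)c$.
   Context: The hyper-order of an entire function $f$ is $\rho_2(f)=\limsup_{r\to\infty}\frac{\log\log T(r,f)}{\log r}$, where $T(r,f)$ is the Nevanlinna characteristic function. A finite Picard exceptional value of $f$ is a $d\in\mathbb{C}$ that $f$ omits, i.e. $f(z)\ne d$ for all $z\in\mathbb{C}$ (equivalently, $f=e^{h}+d$ with $h$ entire). A meromorphic function $F$ is periodic of period $c$ ($c\in\mathbb{C}\setminus\{0\}$) if $F(z+c)=F(z)$ identically; $c$ need not be a minimal period. *)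

(* Defs.v *)
From HB Require Import structures.
From mathcomp Require Import all_boot all_order all_algebra.
From mathcomp Require Import complex.
From mathcomp Require Import all_classical all_reals all_analysis.

Set Implicit Arguments.
Unset Strict Implicit.
Unset Printing Implicit Defensive.

Import Order.TTheory GRing.Theory Num.Theory.
Import numFieldNormedType.Exports.

Local Open Scope classical_set_scope.
Local Open Scope ring_scope.
Local Open Scope complex_scope.

(* R[i] itself is canonically an lmodType over R. Through this alias it is
   instead a normed module over itself, so that [derivable] and [derive1] on
   functions [Cplx R -> Cplx R] are complex differentiability and the complex
   derivative. *)
Definition Cplx (R : realType) : numClosedFieldType := R[i].

Definition entire (R : realType) (f : Cplx R -> Cplx R) : Prop :=
  forall z : Cplx R, derivable f z 1.

Definition transcendental_entire (R : realType) (f : Cplx R -> Cplx R)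
    : Prop :=
  entire f /\ ~ (exists p : {poly Cplx R}, forall z : Cplx R, f z = p.[z]).

(* [ln 0 = 0], so [log_plus 0 = 0] as usual. *)
Definition log_plus (R : realType) (x : R) : R := Num.max 0 (ln x).

(* m(r, f) = (1 / 2 pi) * \int_0^{2 pi} log^+ |f (r e^{i t})| dt *)
Definition proximity (R : realType) (r : R) (f : Cplx R -> Cplx R) : R :=
  (pi *+ 2)^-1 *
  \int[lebesgue_measure]_(t in `[0, pi *+ 2])
     log_plus (Normc.normc (f ((r * cos t) +i* (r * sin t)))).

(* T(r, f) = m(r, f) + N(r, f); it is used for entire f only, which have no
   poles, so that the integrated pole-counting function N(r, f) is 0. *)
Definition nevanlinna_T (R : realType) (r : R) (f : Cplx R -> Cplx R) : R :=
  proximity r f.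

(* Only large r matter; T(r, f) tends to infinity for a nonconstant entire f,
   so the convention [ln x = 0] for x <= 0 plays no role. *)
Definition hyper_order (R : realType) (f : Cplx R -> Cplx R) : \bar R :=
  limf_esup (fun r : R => (ln (ln (nevanlinna_T r f)) / ln r)%:E) +oo.

Definition Picard_exceptional (R : realType) (f : Cplx R -> Cplx R)
    (d : Cplx R) : Prop :=
  forall z : Cplx R, f z <> d.

(* c need not be a minimal period. *)
Definition periodic_of_period (R : realType) (F : Cplx R -> Cplx R)
    (c : Cplx R) : Prop :=
  c != 0 /\ periodic F c.

(* Main.v *)
(* Write f = e^h + d, and f^(k) = e^h B, where B = B(h') is a differential
   polynomial in h'.

   Case d = 0.  Periodicity means e^((n+1) g(z)) B(z+c) = B(z), where
   g(z) = h(z+c) - h(z).  By Poisson's formula, finite hyper-order bounds log |h|,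
   hence log |B|, polynomially; dividing B(z+c) by its Blaschke product and applying
   Borel-Caratheodory bounds Re g polynomially, so g is a polynomial by Liouville.
   Then m |-> B(z+mc) is a polynomial in m with modulus exp (polynomial in m), so it
   is constant.  Hence e^((n+1) g) = 1, g is constant and f(z+(n+1)c) = f(z).

   Case d <> 0.  Put h1 = h and h2(z) = h(z+c), so that
   (e^h1 + d)^n e^h1 B1 = (e^h2 + d)^n e^h2 B2.  Differential polynomials S in h1 and
   h2 are too small to vanish at all the zeros of e^h1 + d and of e^h2 + d unless
   S = 0: otherwise e^h1 + d divides S h1', and dividing out Blaschke products bounds h1
   and h2 on a disc by a constant times the logarithm of their bound on a larger disc,
   which forces them to be constant.  Comparing both sides of the relation at their
   common zeros gives h1'^n B1 = h2'^n B2 to the leading order and then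
   (n+2) (h1' - h2') h1' h2' = n (h1'' h2' - h1' h2'') to the next one.  The latter
   integrates to e^(-a h1) = C e^(-a h2) + D with a = (n+2)/n; D = 0 because S = 1
   does not vanish, so h1' = h2' and B1 = B2.  Finally e^h2 = w e^h1 with w constant,
   and (X + d)^n = w (w X + d)^n forces w = 1. *)

Require Import Defs.
From HB Require Import structures.
From mathcomp Require Import all_boot all_order all_algebra.
From mathcomp Require Import complex ring lra.
From mathcomp Require Import all_classical all_reals all_analysis.

Import Order.TTheory GRing.Theory Num.Theory.
Import numFieldNormedType.Exports.

Local Open Scope classical_set_scope.
Local Open Scope ring_scope.

Set Implicit Arguments.
Unset Strict Implicit.
Unset Printing Implicit Defensive.

(** * Complex numbers *)

(** With d <> 0 nothing is known about the growth of f, so smallness cannot be measured by orders of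
    growth. The yardstick is a bound Q of h1 and h2 on a larger disc: there a differential
    polynomial in h1 and h2 is bounded by a power of Q, while e^h may be as large as e^Q. If e^h + d
    divides S h', its zeros cost at most a factor Q^6 at the centre, so e^h + d is almost an
    exponential e^q; two exponentials that nearly differ by a nonzero constant cannot vary much, and
    differentiating the relation between them replaces Q by its logarithm. This is a substitute for
    the second main theorem of Nevanlinna theory. The relation at the leading order serves to
    eliminate B1 and B2, so that the next order involves only h1', h2', h1'', h2'', whatever k is.

    With d = 0 there is no such rigidity. Finite hyper-order makes g a polynomial, and along z + m c
    both B and g then become polynomials in m, which can be compared with an exponential. The
    conclusion e^((n+1) g) = 1 makes e^g only a root of unity, which is where the multiple (n + 1) c
    comes from. *)

Definition rc (R : realType) (x : R) : Cplx R := (x +i* 0)%C.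
(** The norm of the field [Cplx R] has complex values; [nm] is the same modulus as an element of
    [R], where the order is total. *)
Definition nm (R : realType) (z : Cplx R) : R := Normc.normc z.
Definition ReC (R : realType) (z : Cplx R) : R := complex.Re z.
Definition ImC (R : realType) (z : Cplx R) : R := complex.Im z.
Definition iC (R : realType) : Cplx R := (0 +i* 1)%C.

(** Clearing the denominator of the difference quotient gives a condition that is also meaningful at
    [h = 0]; later derivative estimates have this form, over [R] as well as over [Cplx R]. *)
Lemma is_derive_epsP (K : numFieldType) (f : K -> K) (x l : K) :
  is_derive x 1 f l <-> forall e : K, 0 < e -> exists2 d : K, 0 < d &
    forall h, `|h| < d -> `|f (x + h) - f x - l * h| <= e * `|h|.
Proof.
split=> [[/cvg_ex[l' L]]|H].
  rewrite /derive => E; have E' : l' = l by rewrite -E; apply/esym/cvg_lim.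
  move: L; rewrite E' => /cvgrPdist_le H e e0.
  have /nbhs_ballP[d /= d0 Hd] := H e e0; exists d => // h hd.
  have [->|h0] := eqVneq h 0; first by rewrite addr0 mulr0 subrr subr0 normr0 mulr0.
  have := Hd h; rewrite /ball /= sub0r normrN => /(_ hd h0).
  rewrite /GRing.scale /= mulr1 [h + x]addrC => le.
  have -> : f (x + h) - f x - l * h = - ((l - h^-1 * (f (x + h) - f x)) * h) by field.
  by rewrite normrN normrM; apply: ler_wpM2r le; exact: normr_ge0.
have L : (fun h : K => h^-1 *: ((f \o shift x) (h *: 1) - f x)) @ 0^' --> l.
  apply/cvgrPdist_le => e e0; have [d d0 Hd] := H e e0.
  apply/nbhs_ballP; exists d => //= h; rewrite /ball /= sub0r normrN => hd h0.
  rewrite /GRing.scale /= mulr1 [h + x]addrC.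
  rewrite -(ler_pM2r (_ : 0 < `|h|)) ?normr_gt0 // -normrM.
  have E : f (x + h) - f x - l * h = - ((l - h^-1 * (f (x + h) - f x)) * h) by field.
  by have := Hd _ hd; rewrite E normrN.
apply: DeriveDef; first by apply/cvg_ex; exists l; exact: L.
exact: cvg_lim L.
Qed.

Section Basics.
Variable R : realType.
Local Notation C := (Cplx R).
Implicit Types (x y : R) (z w : C).

Lemma rcD x y : rc (x + y) = rc x + rc y.
Proof. exact: (rmorphD (real_complex R)). Qed.
Lemma rcM x y : rc (x * y) = rc x * rc y.
Proof. exact: (rmorphM (real_complex R)). Qed.
Lemma rcN x : rc (- x) = - rc x.
Proof. exact: (rmorphN (real_complex R)). Qed.
Lemma rcB x y : rc (x - y) = rc x - rc y.
Proof. by rewrite rcD rcN. Qed.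
Lemma rc0 : rc (0 : R) = 0. Proof. by []. Qed.
Lemma rc1 : rc (1 : R) = 1. Proof. by []. Qed.
Lemma rcV x : rc (x^-1) = (rc x)^-1.
Proof. exact: (fmorphV (real_complex R)). Qed.
Lemma rc_nat n : rc (n%:R : R) = n%:R.
Proof. exact: (rmorph_nat (real_complex R)). Qed.

Lemma normE z : `|z| = rc (nm z). Proof. by []. Qed.
Lemma ler_rc x y : (rc x <= rc y) = (x <= y).
Proof. by rewrite /rc lecE /= eqxx. Qed.
Lemma ltr_rc x y : (rc x < rc y) = (x < y).
Proof. by rewrite /rc ltcE /= eqxx. Qed.
Lemma rc_inj : injective (@rc R).
Proof. by move=> x y []. Qed.
Lemma rc_eq0 x : (rc x == 0) = (x == 0).
Proof. by rewrite -rc0 (inj_eq rc_inj). Qed.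

Lemma nm_ge0 z : 0 <= nm z.
Proof. by rewrite -ler_rc -normE normr_ge0. Qed.
Lemma nm0 : nm (0 : C) = 0. Proof. exact: Normc.normc0. Qed.
Lemma nm1 : nm (1 : C) = 1. Proof. exact: Normc.normc1. Qed.
Lemma nmM z w : nm (z * w) = nm z * nm w. Proof. exact: Normc.normcM. Qed.
Lemma nmV z : nm (z^-1) = (nm z)^-1. Proof. exact: Normc.normcV. Qed.
Lemma nmN z : nm (- z) = nm z.
Proof. by apply: rc_inj; rewrite -!normE normrN. Qed.
Lemma nmD z w : nm (z + w) <= nm z + nm w.
Proof. by rewrite -ler_rc rcD -!normE ler_normD. Qed.
Lemma nmB z w : nm (z - w) <= nm z + nm w.
Proof. by rewrite -(nmN w) nmD. Qed.
Lemma nm_sym z w : nm (z - w) = nm (w - z).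
Proof. by rewrite -nmN opprB. Qed.
Lemma nmX z n : nm (z ^+ n) = nm z ^+ n.
Proof. by elim: n => [|n IH]; rewrite ?expr0 ?nm1 // !exprS nmM IH. Qed.
Lemma nm_eq0 z : (nm z == 0) = (z == 0).
Proof. by rewrite -(inj_eq rc_inj) -normE rc0 normr_eq0. Qed.
Lemma nm_gt0 z : (0 < nm z) = (z != 0).
Proof. by rewrite lt_def nm_eq0 nm_ge0 andbT. Qed.
Lemma nm_le0 z : nm z <= 0 -> z = 0.
Proof. by move=> h; apply/eqP; rewrite -nm_eq0 eq_le h nm_ge0. Qed.
Lemma nm_rc x : nm (rc x) = `|x|.
Proof. by rewrite /nm /rc /= expr0n /= addr0 sqrtr_sqr. Qed.
Lemma nm_nat n : nm (n%:R : C) = n%:R.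
Proof. by rewrite -rc_nat nm_rc ger0_norm. Qed.
Lemma nm_tri z w u : nm (z - w) <= nm (z - u) + nm (u - w).
Proof. rewrite (_ : z - w = (z - u) + (u - w)); last by ring.
exact: nmD. Qed.
Lemma nm_rtri z w : nm z - nm w <= nm (z - w).
Proof. by rewrite lerBlDr -{1}(subrK w z) nmD. Qed.
Lemma nm_div z w : nm (z / w) = nm z / nm w.
Proof. by rewrite nmM nmV. Qed.
Lemma eqC z w : ReC z = ReC w -> ImC z = ImC w -> z = w.
Proof. by case: z => a b; case: w => c d; rewrite /ReC /ImC /= => -> ->. Qed.
Lemma ReD z w : ReC (z + w) = ReC z + ReC w.
Proof. by case: z; case: w. Qed.
Lemma ImD z w : ImC (z + w) = ImC z + ImC w.
Proof. by case: z; case: w. Qed.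
Lemma ReN z : ReC (- z) = - ReC z. Proof. by case: z. Qed.
Lemma ImN z : ImC (- z) = - ImC z. Proof. by case: z. Qed.
Lemma ReB z w : ReC (z - w) = ReC z - ReC w. Proof. by rewrite ReD ReN. Qed.
Lemma ImB z w : ImC (z - w) = ImC z - ImC w. Proof. by rewrite ImD ImN. Qed.
Lemma ReM z w : ReC (z * w) = ReC z * ReC w - ImC z * ImC w.
Proof. by case: z; case: w. Qed.
Lemma ImM z w : ImC (z * w) = ReC z * ImC w + ImC z * ReC w.
Proof. by case: z; case: w. Qed.
Lemma Re_rc x : ReC (rc x) = x. Proof. by []. Qed.
Lemma Im_rc x : ImC (rc x) = 0. Proof. by []. Qed.
Lemma CE z : z = rc (ReC z) + iC R * rc (ImC z).
Proof.
by apply: eqC; rewrite ?ReD ?ImD ?ReM ?ImM /ReC /ImC /=; ring.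
Qed.
Lemma Re_le_nm z : `|ReC z| <= nm z.
Proof.
rewrite /ReC /nm; case: z => a b /=; rewrite -sqrtr_sqr ler_sqrt.
  by rewrite lerDl sqr_ge0.
by rewrite addr_ge0 ?sqr_ge0.
Qed.
Lemma Im_le_nm z : `|ImC z| <= nm z.
Proof.
rewrite /ImC /nm; case: z => a b /=; rewrite -sqrtr_sqr ler_sqrt.
  by rewrite lerDr sqr_ge0.
by rewrite addr_ge0 ?sqr_ge0.
Qed.
Lemma nm_iC : nm (iC R) = 1.
Proof. by rewrite /nm /= expr0n /= expr1n add0r sqrtr1. Qed.
Lemma nm_le_ReIm z : nm z <= `|ReC z| + `|ImC z|.
Proof.
by rewrite {1}(CE z); apply: le_trans (nmD _ _) _; rewrite nmM nm_iC mul1r !nm_rc.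
Qed.
Lemma nm_sqr z : nm z ^+ 2 = ReC z ^+ 2 + ImC z ^+ 2.
Proof.
by case: z => a b; rewrite /nm /ReC /ImC /= sqr_sqrtr // addr_ge0 ?sqr_ge0.
Qed.

Definition cj z : C := conjc z.
Lemma nm_cj z : nm (cj z) = nm z.
Proof. by case: z => a b; rewrite /nm /cj /= sqrrN. Qed.
Lemma Re_cj z : ReC (cj z) = ReC z. Proof. by case: z. Qed.
Lemma Im_cj z : ImC (cj z) = - ImC z. Proof. by case: z. Qed.
Lemma mul_cj z : z * cj z = rc (nm z ^+ 2).
Proof.
by apply: eqC; rewrite ?ReM ?ImM ?Re_cj ?Im_cj ?Re_rc ?Im_rc ?nm_sqr; ring.
Qed.
Lemma cjB z w : cj (z - w) = cj z - cj w.
Proof. by apply: eqC; rewrite ?(ReB, ImB, Re_cj, Im_cj); ring. Qed.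
(** A rotation turns a modulus into a real part; this carries bounds for real integrals and the real
    mean value theorem over to complex values. *)
Lemma nm_attain z : exists2 u : C, nm u = 1 & ReC (u * z) = nm z.
Proof.
have [->|z0] := eqVneq z 0; first by exists 1; rewrite ?nm1 ?mulr0 ?nm0.
have n0 : nm z != 0 by rewrite nm_eq0.
exists (cj z / rc (nm z)).
  by rewrite nm_div nm_cj nm_rc ger0_norm ?nm_ge0 // divff.
by rewrite mulrAC (mulrC _ z) mul_cj -rcV -rcM Re_rc expr2 mulfK.
Qed.

(** * Complex derivatives *)

Definition cder (f : C -> C) z (l : C) := forall e : R, 0 < e ->
  exists2 d : R, 0 < d & forall w, nm w < d ->
    nm (f (z + w) - f z - l * w) <= e * nm w.

Lemma pos_rc (e : C) : 0 < e -> exists2 x : R, 0 < x & e = rc x.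
Proof.
case: e => a b; rewrite ltcE /= => /andP[/eqP -> a0]; by exists a.
Qed.

Lemma cderP f z l : cder f z l <-> is_derive z 1 f l.
Proof.
rewrite is_derive_epsP; split=> H e.
  case/pos_rc=> x x0 ->; have [d d0 hd] := H x x0.
  exists (rc d) => [|h]; first by rewrite ltr_rc.
  by rewrite !normE -rcM ltr_rc ler_rc; exact: hd.
move=> e0; have [d /pos_rc[x x0 ->] hd] := H (rc e) (etrans (ltr_rc 0 e) e0).
by exists x => // h hx; have := hd h; rewrite !normE -rcM ltr_rc ler_rc => /(_ hx).
Qed.

Lemma cder_derive1 f z l : cder f z l -> derive1 f z = l.
Proof. by move=> /cderP[_ <-]; rewrite derive1E. Qed.

Lemma derivable_cder f z : derivable f z 1 -> cder f z (derive1 f z).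
Proof. by move=> h; apply/cderP; rewrite derive1E; exact: derivableP. Qed.

Lemma cder_derivable f z l : cder f z l -> derivable f z 1.
Proof. by move/cderP => []. Qed.

End Basics.

Section Calculus.
Variable R : realType.
Local Notation C := (Cplx R).
Implicit Types (x y : R) (z w : C) (f g : C -> C).

Lemma cder_cst (a : C) z : cder (fun=> a) z 0.
Proof. by apply/cderP; exact: is_derive_cst. Qed.
Lemma cder_id z : cder id z 1.
Proof. by apply/cderP; exact: is_derive_id. Qed.
Lemma cderD f g z a b : cder f z a -> cder g z b ->
  cder (fun w => f w + g w) z (a + b).
Proof. by move=> /cderP ? /cderP ?; apply/cderP; exact: is_deriveD. Qed.
Lemma cderN f z a : cder f z a -> cder (fun w => - f w) z (- a).
Proof. by move=> /cderP ?; apply/cderP; exact: is_deriveN. Qed.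
Lemma cderB f g z a b : cder f z a -> cder g z b ->
  cder (fun w => f w - g w) z (a - b).
Proof. by move=> /cderP ? /cderP ?; apply/cderP; exact: is_deriveB. Qed.
Lemma cderM f g z a b : cder f z a -> cder g z b ->
  cder (fun w => f w * g w) z (a * g z + f z * b).
Proof.
move=> /cderP hf /cderP hg; apply/cderP.
have -> : a * g z + f z * b = f z *: b + g z *: a.
  by rewrite /GRing.scale /=; ring.
exact: is_deriveM.
Qed.
Lemma cder_eq f z a b : cder f z a -> a = b -> cder f z b.
Proof. by move=> h <-. Qed.
Lemma cder_ext f g z a : (forall w, f w = g w) -> cder f z a -> cder g z a.
Proof. by move=> /funext ->. Qed.
Lemma cderZ f z (k a : C) : cder f z a -> cder (fun w => k * f w) z (k * a).
Proof.
by move=> h; apply: cder_eq (cderM (cder_cst k z) h) _; rewrite mul0r add0r.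
Qed.
Lemma cderV f z a : f z != 0 -> cder f z a ->
  cder (fun w => (f w)^-1) z (- a / f z ^+ 2).
Proof.
move=> fz /cderP h; apply/cderP; have [dh Eh] := h.
apply: DeriveDef; first exact: derivableV.
rewrite deriveV // Eh.
by rewrite /GRing.scale /= !mulNr mulrC.
Qed.
Lemma cderX f z a n : cder f z a ->
  cder (fun w => f w ^+ n) z (n%:R * f z ^+ n.-1 * a).
Proof.
move=> h; elim: n => [|n IH].
  by rewrite mul0r mul0r; apply: cder_ext (cder_cst 1 z) => w; rewrite expr0.
apply: (@cder_ext (fun w => f w * f w ^+ n)) => [w|]; first by rewrite exprS.
apply: cder_eq (cderM h IH) _.
case: n {IH} => [|n] /=; first by rewrite !expr0; ring.
by rewrite -[n.+2]addn2 -[n.+1]addn1 !natrD exprD; ring.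
Qed.

(** The map [j] embeds the increments into [C]: the identity gives the chain rule for complex
    functions, [rc] the one along a real curve. *)
Lemma chain_rule (T : zmodType) (j f : T -> C) g (t : T) (a b : C) :
  (forall e : R, 0 < e -> exists2 d : R, 0 < d & forall s, nm (j s) < d ->
     nm (f (t + s) - f t - a * j s) <= e * nm (j s)) -> cder g (f t) b ->
  forall e : R, 0 < e -> exists2 d : R, 0 < d & forall s, nm (j s) < d ->
    nm (g (f (t + s)) - g (f t) - b * a * j s) <= e * nm (j s).
Proof.
move=> hf hg e e0.
pose e1 : R := e / (2 * (1 + nm a + nm b)).
have B0 : 0 < 2 * (1 + nm a + nm b).
  by have := nm_ge0 a; have := nm_ge0 b; lra.
have e10 : 0 < e1 by rewrite divr_gt0.
have [d1 d10 H1] := hg _ e10.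
have m0 : 0 < Num.min 1 e1 by rewrite lt_min ltr01.
have [d2 d20 H2] := hf _ m0.
exists (Num.min d2 (d1 / (1 + nm a))).
  by rewrite lt_min d20 divr_gt0 //; have := nm_ge0 a; lra.
move=> s; rewrite lt_min => /andP[w2 w1].
have := H2 _ w2; set k := f (t + s) - f t => hk.
have hk1 : nm (k - a * j s) <= nm (j s).
  apply: le_trans hk _; rewrite -[leRHS]mul1r ler_wpM2r ?nm_ge0 //.
  by rewrite ge_min lexx.
have hk2 : nm (k - a * j s) <= e1 * nm (j s).
  apply: le_trans hk _; rewrite ler_wpM2r ?nm_ge0 //.
  by rewrite ge_min lexx orbT.
have kb : nm k <= (1 + nm a) * nm (j s).
  have := nmD (k - a * j s) (a * j s); rewrite subrK nmM; lra.
have a1 : 0 < 1 + nm a by have := nm_ge0 a; lra.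
have kd : nm k < d1.
  by apply: le_lt_trans kb _; rewrite mulrC -ltr_pdivlMr.
have := H1 _ kd; rewrite (_ : f t + k = f (t + s)); last by rewrite /k; ring.
move=> h1; have -> : g (f (t + s)) - g (f t) - b * a * j s
   = (g (f (t + s)) - g (f t) - b * k) + b * (k - a * j s) by ring.
apply: le_trans (nmD _ _) _; rewrite nmM.
have h3 : e1 * nm k <= e1 * ((1 + nm a) * nm (j s)) by rewrite ler_pM2l.
have h4 : nm b * nm (k - a * j s) <= nm b * (e1 * nm (j s)).
  by rewrite ler_wpM2l ?nm_ge0.
have E : e = e1 * (2 * (1 + nm a + nm b)) by rewrite /e1 divfK // gt_eqF.
clearbody e1; have : 0 <= e1 * nm (j s) * (1 + nm a + nm b).
  apply: mulr_ge0; last lra.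
  by rewrite mulr_ge0 ?nm_ge0 ?normr_ge0 // ltW.
rewrite E; nra.
Qed.

Lemma cder_comp f g z a b : cder f z a -> cder g (f z) b ->
  cder (fun w => g (f w)) z (b * a).
Proof. exact: (@chain_rule _ id). Qed.

Lemma cder_cont f z a : cder f z a -> forall e : R, 0 < e ->
  exists2 d : R, 0 < d & forall w, nm w < d -> nm (f (z + w) - f z) < e.
Proof.
move=> h e e0; have [d d0 H] := h 1 ltr01.
have a1 : 0 < 1 + nm a by have := nm_ge0 a; lra.
exists (Num.min d (e / (1 + nm a))); first by rewrite lt_min d0 divr_gt0.
move=> w; rewrite lt_min => /andP[w1 w2].
have := H _ w1; have := nmD (f (z + w) - f z - a * w) (a * w).
rewrite subrK nmM; move: w2; rewrite ltr_pdivlMr //; nra.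
Qed.

(** * Derivatives with respect to a real parameter *)

Definition rder (u : R -> R) t l := forall e : R, 0 < e ->
  exists2 d : R, 0 < d & forall s, `|s| < d ->
    `|u (t + s) - u t - l * s| <= e * `|s|.

Lemma rderP u t l : rder u t l <-> is_derive t (1 : R) u l.
Proof. exact: iff_sym (is_derive_epsP u t l). Qed.

Definition pder (p : R -> C) t (l : C) := forall e : R, 0 < e ->
  exists2 d : R, 0 < d & forall s, `|s| < d ->
    nm (p (t + s) - p t - l * rc s) <= e * `|s|.

Lemma pder_Re p t l : pder p t l -> rder (fun s => ReC (p s)) t (ReC l).
Proof.
move=> H e e0; have [d d0 Hd] := H e e0; exists d => // s sd.
apply: le_trans (Hd s sd).
have -> : ReC (p (t + s)) - ReC (p t) - ReC l * s
  = ReC (p (t + s) - p t - l * rc s).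
  by rewrite !ReB ReM Re_rc Im_rc; ring.
exact: Re_le_nm.
Qed.

Lemma pder_Im p t l : pder p t l -> rder (fun s => ImC (p s)) t (ImC l).
Proof.
move=> H e e0; have [d d0 Hd] := H e e0; exists d => // s sd.
apply: le_trans (Hd s sd).
have -> : ImC (p (t + s)) - ImC (p t) - ImC l * s
  = ImC (p (t + s) - p t - l * rc s).
  by rewrite !ImB ImM Re_rc Im_rc; ring.
exact: Im_le_nm.
Qed.

Lemma pder_ReIm p t l : rder (fun s => ReC (p s)) t (ReC l) ->
  rder (fun s => ImC (p s)) t (ImC l) -> pder p t l.
Proof.
move=> H1 H2 e e0.
have e2 : 0 < e / 2 by lra.
have [d1 d10 h1] := H1 _ e2; have [d2 d20 h2] := H2 _ e2.
exists (Num.min d1 d2); first by rewrite lt_min d10.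
move=> s; rewrite lt_min => /andP[/h1 {}h1 /h2 {}h2].
apply: le_trans (nm_le_ReIm _) _.
rewrite !ReB !ImB ReM ImM Re_rc Im_rc !mulr0 subr0 add0r; lra.
Qed.

Lemma pder_comp (p : R -> C) f t a b : pder p t a -> cder f (p t) b ->
  pder (fun s => f (p s)) t (b * a).
Proof.
move=> hf hg e e0; have [|d d0 hd] := @chain_rule _ (@rc R) p f t a b _ hg e e0.
  by move=> e1 /hf[d d0 hd]; exists d => // s; rewrite nm_rc; exact: hd.
by exists d => // s sd; have := hd s; rewrite nm_rc => /(_ sd).
Qed.

Lemma pder_line (a b : C) t : pder (fun s => a + rc s * b) t b.
Proof.
move=> e e0; exists 1 => // s _.
rewrite rcD (_ : _ - _ = 0) ?nm0 ?mulr_ge0 ?normr_ge0 // ?ltW //; ring.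
Qed.

(** * The complex exponential *)

Definition cis t : C := (cos t +i* sin t)%C.
Definition cexp z : C := rc (expR (ReC z)) * cis (ImC z).

Lemma nm_cis t : nm (cis t) = 1.
Proof. by rewrite /nm /= cos2Dsin2 sqrtr1. Qed.
Lemma nm_cexp z : nm (cexp z) = expR (ReC z).
Proof. by rewrite nmM nm_cis mulr1 nm_rc ger0_norm ?expR_ge0. Qed.
Lemma cexp_neq0 z : cexp z != 0.
Proof. by rewrite -nm_gt0 nm_cexp expR_gt0. Qed.
Lemma cisD s t : cis (s + t) = cis s * cis t.
Proof.
by apply: eqC; rewrite /cis ?ReM ?ImM /ReC /ImC /= ?cosD ?sinD; ring.
Qed.
Lemma cexpD z w : cexp (z + w) = cexp z * cexp w.
Proof. by rewrite /cexp ReD ImD expRD rcM cisD; ring. Qed.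
Lemma cis0 : cis 0 = 1. Proof. by rewrite /cis cos0 sin0. Qed.
Lemma cexp0 : cexp 0 = 1.
Proof. by rewrite /cexp /ReC /ImC /= expR0 cis0 mulr1. Qed.
Lemma cexpN z : cexp (- z) = (cexp z)^-1.
Proof.
apply: (mulfI (cexp_neq0 z)); rewrite -cexpD subrr cexp0 divff //.
exact: cexp_neq0.
Qed.
Lemma cexpB z w : cexp (z - w) = cexp z / cexp w.
Proof. by rewrite cexpD cexpN. Qed.
Lemma cexp_nat n z : cexp (n%:R * z) = cexp z ^+ n.
Proof.
elim: n => [|n IH]; first by rewrite mul0r cexp0 expr0.
by rewrite -natr1 mulrDl mul1r cexpD IH exprSr.
Qed.

Lemma cis_2pi : cis (pi *+ 2) = 1.
Proof. by rewrite /cis cos2pi sin2pi. Qed.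

Lemma pder_cis t : pder cis t (iC R * cis t).
Proof.
apply: pder_ReIm.
  have -> : ReC (iC R * cis t) = - sin t by rewrite ReM /ReC /ImC /=; ring.
  by apply/rderP; exact: is_derive_cos.
have -> : ImC (iC R * cis t) = cos t by rewrite ImM /ReC /ImC /=; ring.
by apply/rderP; exact: is_derive_sin.
Qed.

Lemma cder_cexp z : cder cexp z (cexp z).
Proof.
move=> e e0.
(* With w = x + i y, e^w - 1 - w splits below into the remainders of [cis] and [expR] at 0 and a
   product of two small terms; they contribute 3, 1 and 2 times [e1 * nm w], hence the 6. *)
pose e1 := Num.min 1 (e / (nm (cexp z) * 6)).
have N0 : 0 < nm (cexp z) by rewrite nm_cexp expR_gt0.
have e10 : 0 < e1 by rewrite lt_min ltr01 divr_gt0 // mulr_gt0.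
have e11 : e1 <= 1 by rewrite ge_min lexx.
have [d1 d10 h1] := (rderP _ _ _).2 (is_derive_expR 0) _ e10.
have [d2 d20 h2] := pder_cis 0 e10.
exists (Num.min (Num.min d1 d2) e1); first by rewrite 2!lt_min d10 d20 e10.
move=> w; rewrite 2!lt_min => /andP[/andP[w1 w2] w3].
have x1 := Re_le_nm w; have y1 := Im_le_nm w.
have := h1 (ReC w) (le_lt_trans x1 w1).
rewrite add0r expR0 mul1r => {}h1.
have := h2 (ImC w) (le_lt_trans y1 w2).
rewrite add0r cis0 mulr1 => {}h2.
set x := ReC w in x1 h1 *; set y := ImC w in y1 h2 *.
have -> : cexp (z + w) - cexp z - cexp z * w = cexp z * (cexp w - 1 - w).
  by rewrite cexpD; ring.
rewrite nmM.
have -> : cexp w - 1 - w = rc (expR x) * (cis y - 1 - iC R * rc y)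
     + rc (expR x - 1 - x) + iC R * rc y * rc (expR x - 1).
  by rewrite {2}(CE w) /cexp -/x -/y !rcB rc1; ring.
have E1 : `|expR x - 1| <= 2 * nm w.
  have := ler_normD (expR x - 1 - x) x; rewrite subrK.
  have : e1 * `|x| <= 1 * `|x| by rewrite ler_wpM2r.
  by lra.
have E2 : `|expR x| <= 3.
  have := ler_normD (expR x - 1) 1; rewrite subrK normr1; lra.
have T1 : nm (rc (expR x) * (cis y - 1 - iC R * rc y)) <= 3 * (e1 * nm w).
  rewrite nmM nm_rc ler_pM ?nm_ge0 //.
  by apply: le_trans h2 _; rewrite ler_pM2l.
have T2 : nm (rc (expR x - 1 - x)) <= e1 * nm w.
  by rewrite nm_rc; apply: le_trans h1 _; rewrite ler_pM2l.
have T3 : nm (iC R * rc y * rc (expR x - 1)) <= e1 * (2 * nm w).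
  rewrite !nmM nm_iC mul1r !nm_rc.
  apply: ler_pM => //; apply: le_trans y1 _; exact: ltW.
have S : nm (rc (expR x) * (cis y - 1 - iC R * rc y)
     + rc (expR x - 1 - x) + iC R * rc y * rc (expR x - 1)) <= 6 * (e1 * nm w).
  apply: le_trans (nmD _ _) _.
  by apply: le_trans (lerD (nmD _ _) (lexx _)) _; lra.
have E : e1 * (nm (cexp z) * 6) <= e.
  by rewrite -ler_pdivlMr ?mulr_gt0 // ge_min lexx orbT.
apply: le_trans (ler_wpM2l (ltW N0) S) _.
have -> : nm (cexp z) * (6 * (e1 * nm w)) = e1 * (nm (cexp z) * 6) * nm w by ring.
by rewrite ler_wpM2r ?nm_ge0.
Qed.

End Calculus.

(** * Goursat's theorem *)

Section Segments.
Variable R : realType.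
Local Notation C := (Cplx R).
Implicit Types (x y : R) (z w : C) (f g : C -> C).

Lemma le_eps x y : (forall e : R, 0 < e -> x <= y + e) -> x <= y.
Proof.
by move=> h; rewrite leNgt; apply/negP => xy; have := h ((x - y) / 2); lra.
Qed.

(** The limit is the lower limit, the supremum of the set [A] of eventual lower bounds. *)
Lemma cauchyR (u : nat -> R) :
  (forall e, 0 < e -> exists K, forall k, `|u (K + k)%N - u K| <= e) ->
  exists L, forall e, 0 < e -> exists K, forall k, (K <= k)%N -> `|u k - L| <= e.
Proof.
move=> H.
pose A := [set x | exists K, forall k, (K <= k)%N -> x <= u k].
have hA : forall e K, (forall k, `|u (K + k)%N - u K| <= e) ->
    A (u K - e) /\ ubound A (u K + e).
  move=> e K h; split.
    by exists K => k /subnKC <-; have := h (k - K)%N; rewrite ler_norml; lra.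
  move=> x [K' h']; have := h' (K + K')%N (leq_addl _ _).
  by have := h K'; rewrite ler_norml; lra.
exists (sup A) => e e0.
have e2 : 0 < e / 2 by lra.
have [K hK] := H _ e2; exists K => k Kk.
have [a b] := hA _ _ hK.
have s : has_sup A by split; [exists (u K - e / 2)|exists (u K + e / 2)].
have := ub_le_sup s.2 a; have := ge_sup s.1 b.
have := hK (k - K)%N; rewrite subnKC // !ler_norml; lra.
Qed.

Definition tends (u : nat -> C) L := forall e : R, 0 < e ->
  exists K, forall k, (K <= k)%N -> nm (u k - L) <= e.

Lemma cauchyC (u : nat -> C) :
  (forall e : R, 0 < e -> exists K, forall k, nm (u (K + k)%N - u K) <= e) ->
  exists L, tends u L.
Proof.
move=> H.
have [a ha] : exists L, forall e, 0 < e -> exists K, forall k, (K <= k)%N ->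
    `|ReC (u k) - L| <= e.
  apply: cauchyR => e /H[K h]; exists K => k; apply: le_trans (h k).
  by rewrite -ReB; exact: Re_le_nm.
have [b hb] : exists L, forall e, 0 < e -> exists K, forall k, (K <= k)%N ->
    `|ImC (u k) - L| <= e.
  apply: cauchyR => e /H[K h]; exists K => k; apply: le_trans (h k).
  by rewrite -ImB; exact: Im_le_nm.
exists (a +i* b)%C => e e0.
have e2 : 0 < e / 2 by lra.
have [K1 h1] := ha _ e2; have [K2 h2] := hb _ e2.
exists (K1 + K2)%N => k hk.
have := h1 k (leq_trans (leq_addr _ _) hk).
have := h2 k (leq_trans (leq_addl _ _) hk).
move=> h4 h3; apply: le_trans (nm_le_ReIm _) _.
by rewrite ReB ImB; move: h3 h4; lra.
Qed.

Lemma tends_uniq u L L' : tends u L -> tends u L' -> L = L'.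
Proof.
move=> h h'; apply/eqP; rewrite -subr_eq0; apply/eqP/nm_le0/le_eps => e e0.
have e2 : 0 < e / 2 by lra.
have [K hK] := h _ e2; have [K' hK'] := h' _ e2.
have := hK _ (leq_addr K' K); have := hK' _ (leq_addl K K').
have := nm_tri L L' (u (K + K')%N); rewrite (nm_sym L (u _)); lra.
Qed.

Lemma tends_bound u L w B K : tends u L ->
  (forall k, (K <= k)%N -> nm (u k - w) <= B) -> nm (L - w) <= B.
Proof.
move=> h h'; apply: le_eps => e e0; have [K' hK] := h _ e0.
have := hK _ (leq_addl K K'); have := h' _ (leq_addr K' K).
have := nm_tri L w (u (K + K')%N); rewrite (nm_sym L (u _)); lra.
Qed.

Lemma tendsD u v L M : tends u L -> tends v M -> tends (fun k => u k + v k) (L + M).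
Proof.
move=> h h' e e0; have e2 : 0 < e / 2 by lra.
have [K hK] := h _ e2; have [K' hK'] := h' _ e2.
exists (K + K')%N => k hk.
have := hK k (leq_trans (leq_addr _ _) hk).
have := hK' k (leq_trans (leq_addl _ _) hk).
have := nmD (u k - L) (v k - M).
by rewrite (_ : u k - L + (v k - M) = u k + v k - (L + M)); [lra|ring].
Qed.

Lemma tendsN u L : tends u L -> tends (fun k => - u k) (- L).
Proof.
move=> h e /h[K hK]; exists K => k /hK.
by rewrite -nmN (_ : - (u k - L) = - u k - - L) //; ring.
Qed.

Section Bisect.
Variables (T : Type) (child : T -> T -> Prop) (ctr : T -> C) (size : T -> R).
Hypothesis child_ctr : forall D D', child D D' -> nm (ctr D' - ctr D) <= size D.
Hypothesis child_size : forall D D', child D D' -> size D' <= size D / 2.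
Hypothesis size_ge0 : forall D, 0 <= size D.

(* A property inherited by a cell from its pieces holds for a cell as soon as
   it holds for all small cells around each point. *)
Lemma bisection (Q I : T -> Prop) (D0 : T) :
  (forall D D', I D -> child D D' -> I D') ->
  (forall D, I D -> (forall D', child D D' -> Q D') -> Q D) ->
  (forall (D : nat -> T) p, (forall n, I (D n)) ->
    (forall n, nm (ctr (D n) - p) <= 2 * size (D n)) ->
    (forall e : R, 0 < e -> exists n, size (D n) < e) -> exists n, Q (D n)) ->
  I D0 -> Q D0.
Proof.
move=> HI Hadd Hloc I0.
have [//|nQ0] := pselect (Q D0).
(* A failing cell always has a failing piece; the nested pieces chosen in this way shrink to a
   point, where the local hypothesis is contradicted. *)
have ex : forall D, exists D', I D -> ~ Q D -> child D D' /\ ~ Q D'.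
  move=> D; have [[iD nq]|h] := pselect (I D /\ ~ Q D); last first.
    by exists D => a b; case: h.
  have /existsNP[D' /not_implyP[c q]] : ~ (forall D', child D D' -> Q D').
    by move=> h; apply: nq; exact: Hadd.
  by exists D'.
have [next hnext] := choice ex.
pose D n := iter n next D0.
have inv n : I (D n) /\ ~ Q (D n).
  elim: n => [//|n [i q]]; have [c nq] := hnext _ i q.
  by split=> //=; apply: HI c.
have ch n : child (D n) (D n.+1) by have [i q] := inv n; case: (hnext _ i q).
have sz n k : size (D (n + k)%N) <= size (D n) / 2 ^+ k.
  elim: k => [|k IH]; first by rewrite addn0 expr0 divr1.
  rewrite addnS; apply: le_trans (child_size (ch _)) _.
  by rewrite exprS invfM; move: IH; lra.
have p2 k : 0 < (2 : R) ^+ k by rewrite exprn_gt0.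
have dist n k : nm (ctr (D (n + k)%N) - ctr (D n)) <= 2 * size (D n) * (1 - (2 ^+ k)^-1).
  elim: k => [|k IH]; first by rewrite addn0 subrr nm0 expr0 invr1 subrr mulr0.
  apply: le_trans (nm_tri _ _ (ctr (D (n + k)%N))) _.
  have := child_ctr (ch (n + k)%N); rewrite -addnS.
  have := sz n k; rewrite exprS invfM => q1 q2; move: IH q1 q2; lra.
have dist2 n k : nm (ctr (D (n + k)%N) - ctr (D n)) <= 2 * size (D n).
  apply: le_trans (dist n k) _.
  have q : 0 < ((2 : R) ^+ k)^-1 by rewrite invr_gt0.
  have := mulr_ge0 (size_ge0 (D n)) (ltW q); lra.
have small e : 0 < e -> exists n, size (D n) < e.
  move=> e0; exists (Num.bound (size (D 0%N) / e)).
  set n := Num.bound _.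
  have h1 : size (D 0%N) / e < 2 ^+ n.
    apply: lt_trans (archi_boundP _) _; first by rewrite divr_ge0 // ltW.
    by rewrite -natrX ltr_nat ltn_expl.
  apply: le_lt_trans (sz 0%N n) _.
  by rewrite ltr_pdivrMr // mulrC -ltr_pdivrMr.
have [p hp] : exists p, tends (fun n => ctr (D n)) p.
  apply: cauchyC => e e0; have e2 : 0 < e / 2 by lra.
  have [n hn] := small _ e2; exists n => k.
  by apply: le_trans (dist2 n k) _; lra.
have [n Qn] : exists n, Q (D n).
  apply: (Hloc D p) => // [n|n]; first by case: (inv n).
  rewrite nm_sym; apply: (tends_bound (K := n) hp) => k /subnKC <-.
  exact: dist2.
by case: (inv n).
Qed.
End Bisect.

Definition mid z w : C := (z + w) / 2.

Lemma midB z w p : mid z w - p = (z - p) / 2 + (w - p) / 2.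
Proof. by rewrite /mid; field. Qed.
Lemma nm_half z : nm (z / 2) = nm z / 2.
Proof. by rewrite nm_div nm_nat. Qed.
Lemma nm_mid z w p (r : R) : nm (z - p) <= r -> nm (w - p) <= r ->
  nm (mid z w - p) <= r.
Proof.
rewrite midB => a b; apply: le_trans (nmD _ _) _.
by rewrite !nm_half; lra.
Qed.
Lemma nm_midl z w : nm (mid z w - z) = nm (w - z) / 2.
Proof. by rewrite -nm_half; congr nm; rewrite /mid; field. Qed.
Lemma nm_midr z w : nm (w - mid z w) = nm (w - z) / 2.
Proof. by rewrite -nm_half; congr nm; rewrite /mid; field. Qed.

(* Dyadic trapezoid sums for the integral of [f] along the segment [z, w]. *)
Fixpoint seg k f z w : C :=
  if k is k'.+1 then seg k' f z (mid z w) + seg k' f (mid z w) w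
  else (w - z) * ((f z + f w) / 2).

Lemma midC z w : mid z w = mid w z.
Proof. by rewrite /mid addrC. Qed.

Lemma seg_anti k f z w : seg k f w z = - seg k f z w.
Proof.
elim: k z w => [|k IH] z w /=; first by ring.
by rewrite (midC w z) IH (IH z) opprD addrC.
Qed.

(** Trapezoid sums are exact for affine functions at every level, so that only the remainder of a
    Taylor approximation has to be estimated. *)
Lemma seg_affine k (a b p : C) z w : seg k (fun t => a + b * (t - p)) z w
  = (w - z) * (a + b * (mid z w - p)).
Proof.
elim: k z w => [|k IH] z w /=; first by rewrite /mid; field.
by rewrite !IH /mid; field.
Qed.

Lemma segB k f g z w : seg k (fun t => f t - g t) z w = seg k f z w - seg k g z w.
Proof.
elim: k z w => [|k IH] z w /=; first by field.
by rewrite !IH; ring.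
Qed.

Lemma seg_bound k f z w p (r B : R) :
  (forall t, nm (t - p) <= r -> nm (f t) <= B) ->
  nm (z - p) <= r -> nm (w - p) <= r -> nm (seg k f z w) <= B * nm (w - z).
Proof.
move=> hf; elim: k z w => [|k IH] z w hz hw /=.
  rewrite nmM nm_half mulrC; apply: ler_wpM2r; first exact: nm_ge0.
  have := nmD (f z) (f w); have := hf z hz; have := hf w hw; lra.
have hm := nm_mid hz hw.
apply: le_trans (nmD _ _) _.
have := IH _ _ hz hm; have := IH _ _ hm hw; rewrite nm_midl nm_midr; lra.
Qed.

Definition contD (r : R) f := forall z, nm z < r -> forall e : R, 0 < e ->
  exists2 d : R, 0 < d & forall w, nm (w - z) < d -> nm (f w - f z) < e.

Definition hol (r : R) f := forall z, nm z < r -> cder f z (derive1 f z).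

Lemma hol_contD r f : hol r f -> contD r f.
Proof.
move=> h z /h/cder_cont H e /H[d d0 hd]; exists d => // w /hd.
by rewrite (_ : z + (w - z) = w) //; ring.
Qed.

(** A defect bounded by a constant times the length is additive under halving, so bisection leaves
    only short segments near a point, on which continuity makes [f] nearly constant. *)
Lemma seg_tends r f z w : contD r f -> nm z < r -> nm w < r ->
  exists L, tends (fun k => seg k f z w) L.
Proof.
move=> cf hz hw; apply: cauchyC => e e0.
pose N := nm (w - z) + 1.
have N0 : 0 < N by rewrite /N; have := nm_ge0 (w - z); lra.
suff [K hK] : exists K, forall k, (K <= k)%N -> forall l,
    nm (seg (k + l) f z w - seg k f z w) <= e / N * nm (w - z).
  exists K => k; apply: le_trans (hK K (leqnn _) k) _.
  by rewrite mulrAC ler_pdivrMr // ler_pM2l // /N; lra.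
have : 0 < e / N by rewrite divr_gt0.
move: (e / N) => d d0 {e e0 N N0}.
(* The pieces stay in the closed disc of radius [rho < r], hence so does the point to which they
   shrink. *)
pose rho := Num.max (nm z) (nm w).
pose T := (C * C)%type.
pose child (D D' : T) := D' = (D.1, mid D.1 D.2) \/ D' = (mid D.1 D.2, D.2).
pose size (D : T) := nm (D.2 - D.1).
pose Q (D : T) := exists K, forall k, (K <= k)%N -> forall l,
    nm (seg (k + l) f D.1 D.2 - seg k f D.1 D.2) <= d * size D.
pose I (D : T) := nm D.1 <= rho /\ nm D.2 <= rho.
apply: (@bisection T child fst size _ _ _ Q I (z, w)).
- move=> D D' [] ->; rewrite /size /=; last by rewrite nm_midl; have := nm_ge0 (D.2 - D.1); lra.
  by rewrite subrr nm0 nm_ge0.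
- by move=> D D' [] ->; rewrite /size /= ?nm_midl ?nm_midr.
- by move=> D; exact: nm_ge0.
- move=> D D' [i1 i2]; have m : nm (mid D.1 D.2) <= rho.
    by rewrite -[mid _ _]subr0 nm_mid // subr0.
  by case=> ->.
- move=> D _ h.
  have [K1 h1] := h _ (or_introl erefl).
  have [K2 h2] := h _ (or_intror erefl).
  exists (maxn K1 K2).+1; case=> // k; rewrite ltnS geq_max => /andP[k1 k2] l /=.
  have := h1 k k1 l; have := h2 k k2 l; rewrite /size /= nm_midl nm_midr => a b.
  rewrite (_ : _ - _ = (seg (k + l) f D.1 (mid D.1 D.2) - seg k f D.1 (mid D.1 D.2)) +
    (seg (k + l) f (mid D.1 D.2) D.2 - seg k f (mid D.1 D.2) D.2)); last by ring.
  by apply: le_trans (nmD _ _) _; lra.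
- move=> D p hI hc hs.
  have pr : nm p < r.
    apply: (@le_lt_trans _ _ rho); last by rewrite /rho gt_max hz hw.
    apply: le_eps => e e0; have [n hn] := hs (e / 2) ltac:(lra).
    have := hc n; have [+ _] := hI n; have := nm_rtri p (D n).1.
    by rewrite nm_sym; lra.
  have [e e0 he] := cf p pr (d / 2) ltac:(lra).
  have [n hn] := hs (e / 4) ltac:(lra).
  exists n, 0%N => k _ l.
  have B q : nm (seg q f (D n).1 (D n).2 - ((D n).2 - (D n).1) * f p) <= d / 2 * size (D n).
    have -> : ((D n).2 - (D n).1) * f p = seg q (fun t => f p + 0 * (t - p)) (D n).1 (D n).2.
      by rewrite seg_affine mul0r addr0.
    rewrite -segB; apply: (@seg_bound _ _ _ _ p (3 * size (D n))).
    + by move=> t ht; rewrite mul0r addr0; apply/ltW/he; lra.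
    + by have := hc n; have := nm_ge0 ((D n).2 - (D n).1); rewrite /size; lra.
    + have := nm_tri (D n).2 p (D n).1; have := hc n; rewrite /size; lra.
  have := B (k + l)%N; have := B k; rewrite (nm_sym (seg k _ _ _)).
  have := nm_tri (seg (k + l) f (D n).1 (D n).2) (seg k f (D n).1 (D n).2) (((D n).2 - (D n).1) * f p).
  lra.
- by split; rewrite /rho /= le_max lexx ?orbT.
Qed.

Definition tri k f (a b c : C) := seg k f a b + seg k f b c + seg k f c a.

Lemma triS k f a b c : tri k.+1 f a b c =
  tri k f a (mid a b) (mid c a) + tri k f (mid a b) b (mid b c)
  + tri k f (mid c a) (mid b c) c + tri k f (mid a b) (mid b c) (mid c a).
Proof.
rewrite /tri /= (seg_anti k f (mid c a) (mid a b)).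
rewrite (seg_anti k f (mid a b) (mid b c)) (seg_anti k f (mid b c) (mid c a)).
ring.
Qed.

(** A bound by [d] times the squared perimeter is inherited from the four half-size triangles, as 4
    (s/2)^2 = s^2. It holds near each point because [f] is affine there up to a small relative
    error, and the sums of an affine function around a triangle cancel. *)
Lemma goursat r f a b c : hol r f -> nm a < r -> nm b < r -> nm c < r ->
  tends (fun k => tri k f a b c) 0.
Proof.
move=> hf ha hb hc e e0.
pose size0 (D : C * C * C) := nm (D.1.2 - D.1.1) + nm (D.2 - D.1.2) + nm (D.1.1 - D.2).
pose N := size0 (a, b, c) ^+ 2 + 1.
have N0 : 0 < N by rewrite /N; have := sqr_ge0 (size0 (a, b, c)); lra.
suff [K hK] : exists K, forall k, (K <= k)%N ->
    nm (tri k f a b c) <= e / N * size0 (a, b, c) ^+ 2.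
  exists K => k /hK h; rewrite subr0; apply: le_trans h _.
  by rewrite mulrAC ler_pdivrMr // ler_pM2l // /N; lra.
have : 0 < e / N by rewrite divr_gt0.
move: (e / N) => d d0 {e e0 N N0}.
pose rho := Num.max (nm a) (Num.max (nm b) (nm c)).
pose T := (C * C * C)%type.
pose child (D D' : T) := let: (a, b, c) := D in
  [\/ D' = (a, mid a b, mid c a), D' = (mid a b, b, mid b c),
      D' = (mid c a, mid b c, c) | D' = (mid a b, mid b c, mid c a)].
pose Q (D : T) := exists K, forall k, (K <= k)%N ->
    nm (tri k f D.1.1 D.1.2 D.2) <= d * size0 D ^+ 2.
pose I (D : T) := [/\ nm D.1.1 <= rho, nm D.1.2 <= rho & nm D.2 <= rho].
have szc D D' : child D D' -> size0 D' = size0 D / 2.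
  have E (u v : C) : u = v / 2 -> nm u = nm v / 2 by move=> ->; rewrite nm_half.
  case: D => [[x y] z]; rewrite /child /size0 => -[] -> /=.
  - by rewrite !mulrDl; congr (_ + _ + _); apply: E; rewrite /mid; field.
  - by rewrite !mulrDl; congr (_ + _ + _); apply: E; rewrite /mid; field.
  - by rewrite !mulrDl; congr (_ + _ + _); apply: E; rewrite /mid; field.
  transitivity ((nm (z - x) + nm (x - y) + nm (y - z)) / 2).
    by rewrite !mulrDl; congr (_ + _ + _); apply: E; rewrite /mid; field.
  by rewrite (nm_sym z x) (nm_sym x y) (nm_sym y z); ring.
have szc0 D : 0 <= size0 D by rewrite /size0 !addr_ge0 ?nm_ge0.
apply: (@bisection T child (fun D => D.1.1) size0 _ _ _ Q I (a, b, c)).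
- case=> [[x y] z] D' /=; rewrite /size0 /= => h.
  have [[n1 n2] n3] := (nm_ge0 (y - x), nm_ge0 (z - y), nm_ge0 (x - z)).
  by case: h => -> /=; rewrite ?subrr ?nm0 ?(midC z x) ?nm_midl ?(nm_sym z x); lra.
- by move=> D D' /szc ->.
- exact: szc0.
- case=> [[x y] z] D' [/= i1 i2 i3].
  have m u v : nm u <= rho -> nm v <= rho -> nm (mid u v) <= rho.
    by move=> ? ?; rewrite -[mid _ _]subr0 nm_mid // subr0.
  by case=> ->; split => //=; apply: m.
- case=> [[x y] z] _ h.
  have c1 : child (x, y, z) (x, mid x y, mid z x) by constructor 1.
  have c2 : child (x, y, z) (mid x y, y, mid y z) by constructor 2.
  have c3 : child (x, y, z) (mid z x, mid y z, z) by constructor 3.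
  have c4 : child (x, y, z) (mid x y, mid y z, mid z x) by constructor 4.
  have [K1 h1] := h _ c1; have [K2 h2] := h _ c2.
  have [K3 h3] := h _ c3; have [K4 h4] := h _ c4.
  exists (maxn (maxn K1 K2) (maxn K3 K4)).+1; case=> // k.
  rewrite ltnS !geq_max => /andP[/andP[k1 k2] /andP[k3 k4]].
  move: {h1 h2 h3 h4} (h1 k k1) (h2 k k2) (h3 k k3) (h4 k k4).
  rewrite (szc _ _ c1) (szc _ _ c2) (szc _ _ c3) (szc _ _ c4) triS expr_div_n /=.
  move: (size0 (x, y, z)) => s b1 b2 b3 b4.
  apply: le_trans (nmD _ _) _; apply: le_trans (lerD (nmD _ _) (lexx _)) _.
  apply: le_trans (lerD (lerD (nmD _ _) (lexx _)) (lexx _)) _; lra.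
- move=> D p hI hc' hs.
  have pr : nm p < r.
    apply: (@le_lt_trans _ _ rho); last by rewrite /rho !gt_max ha hb hc.
    apply: le_eps => e e0; have [n hn] := hs (e / 2) ltac:(lra).
    have := hc' n; have [+ _ _] := hI n; have := nm_rtri p (D n).1.1.
    by rewrite nm_sym; lra.
  have [e e0 he] := hf p pr (d / 3) ltac:(lra).
  have [n hn] := hs (e / 4) ltac:(lra).
  exists n, 0%N => k _.
  case: (D n) (hI n) (hc' n) hn => [[x y] z] /= _ hx hn; set s := size0 _ in hx hn *.
  have S : s = nm (y - x) + nm (z - y) + nm (x - z) by [].
  have [[n1 n2] n3] := (nm_ge0 (y - x), nm_ge0 (z - y), nm_ge0 (x - z)).
  pose l := derive1 f p.
  have B u v : nm (u - p) <= 3 * s -> nm (v - p) <= 3 * s ->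
    nm (seg k f u v - (v - u) * (f p + l * (mid u v - p))) <= d * s * nm (v - u).
    move=> hu hv; rewrite -(seg_affine k) -segB.
    apply: (@seg_bound _ _ _ _ p (3 * s)) => // t ht.
    have := he (t - p); rewrite (_ : p + (t - p) = t); last by ring.
    move=> h.
    have -> : f t - (f p + l * (t - p)) = f t - f p - derive1 f p * (t - p).
      by rewrite /l; ring.
    apply: le_trans (h _) _; first by lra.
    have : d * nm (t - p) <= d * (3 * s) by rewrite ler_pM2l.
    lra.
  have X : nm (x - p) <= 3 * s by lra.
  have Y : nm (y - p) <= 3 * s by have := nm_tri y p x; lra.
  have Z : nm (z - p) <= 3 * s by have := nm_tri z p x; rewrite (nm_sym z x); lra.
  have := B _ _ X Y; have := B _ _ Y Z; have := B _ _ Z X.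
  set E1 := seg _ _ _ _ - _; set E2 := seg _ _ _ _ - _; set E3 := seg _ _ _ _ - _.
  move=> b1 b2 b3.
  have -> : tri k f x y z = E3 + E2 + E1.
    by rewrite /tri /E1 /E2 /E3 /mid; field.
  apply: le_trans (nmD _ _) _; apply: le_trans (lerD (nmD _ _) (lexx _)) _.
  rewrite expr2 {2}S; lra.
- by split; rewrite /rho /= !le_max lexx ?orbT.
Qed.

End Segments.

(** * Means over circles *)

Section CircleMeans.
Variable R : realType.
Local Notation C := (Cplx R).
Local Notation mu := (@lebesgue_measure R).
Implicit Types (x y r : R) (z w : C) (f g : C -> C) (u v : R -> R).

Definition circ r t : C := rc r * cis t.

Lemma circE r t : circ r t = ((r * cos t) +i* (r * sin t))%C.
Proof. by apply: eqC; rewrite ?ReM ?ImM /ReC /ImC /=; ring. Qed.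
Lemma nm_circ r t : 0 <= r -> nm (circ r t) = r.
Proof. by move=> r0; rewrite nmM nm_cis mulr1 nm_rc ger0_norm. Qed.
Lemma circ_2pi r : circ r (pi *+ 2) = circ r 0.
Proof. by rewrite /circ cis_2pi cis0. Qed.

Lemma pder_circ r t : pder (circ r) t (iC R * circ r t).
Proof.
have H : pder (fun s => (fun w : C => rc r * w) (cis s)) t (rc r * (iC R * cis t)).
  have := pder_comp (pder_cis t) (cderZ (rc r) (cder_id (cis t))).
  by rewrite mulr1.
by have -> : iC R * circ r t = rc r * (iC R * cis t) by rewrite /circ; ring.
Qed.

Lemma rder_continuous u t l : rder u t l -> {for t, continuous u}.
Proof.
move=> /rderP[h _].
by apply: differentiable_continuous; apply/derivable1_diffP.
Qed.

Definition avg u : R := (pi *+ 2)^-1 * \int[mu]_(t in `[0, pi *+ 2]) u t.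

Lemma pi2_gt0 : 0 < (pi *+ 2 : R).
Proof. by rewrite pmulrn_rgt0 // pi_gt0. Qed.

Lemma cont_integrable u : continuous u ->
  mu.-integrable `[0, pi *+ 2] (EFin \o u).
Proof.
move=> cu; apply: continuous_compact_integrable; first exact: segment_compact.
exact: continuous_subspaceT.
Qed.

Lemma avgD u v : continuous u -> continuous v ->
  avg (fun t => u t + v t) = avg u + avg v.
Proof.
move=> cu cv; rewrite /avg RintegralD; first by rewrite mulrDr.
- by [].
- exact: cont_integrable.
- exact: cont_integrable.
Qed.
Lemma avgZ a u : continuous u -> avg (fun t => a * u t) = a * avg u.
Proof.
move=> cu; rewrite /avg RintegralZl; first by rewrite mulrCA.
- by [].
- exact: cont_integrable.
Qed.
Lemma avg_le u v : continuous u -> continuous v -> (forall t, u t <= v t) ->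
  avg u <= avg v.
Proof.
move=> cu cv h; rewrite /avg ler_pM2l ?invr_gt0 ?pi2_gt0 //.
by apply: le_Rintegral => //; exact: cont_integrable.
Qed.
Lemma avg_cst a : avg (fun=> a) = a.
Proof.
rewrite /avg Rintegral_cst //= lebesgue_measure_itv /= lte_fin pi2_gt0.
by rewrite oppr0 addr0 mulrC mulfK // gt_eqF // pi2_gt0.
Qed.

Lemma avg_deriv U u : (forall t, rder U t (u t)) -> continuous u ->
  U (pi *+ 2) = U 0 -> avg u = 0.
Proof.
move=> dU cu E; rewrite /avg /Rintegral (@continuous_FTC2 _ u U) //.
- by rewrite E -EFinB subrr /= mulr0.
- exact: pi2_gt0.
- exact: continuous_subspaceT.
- split.
  + by move=> t _; case/rderP: (dU t).
  + by apply: cvg_at_right_filter; exact: rder_continuous (dU _).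
  + by apply: cvg_at_left_filter; exact: rder_continuous (dU _).
- by move=> t _; rewrite derive1E; case/rderP: (dU t).
Qed.

(** Complex differentiability at the points of the circle stands for the continuity that integration
    needs. *)
Definition onC r f := forall z, nm z = r -> exists l, cder f z l.

Definition cmean r f : C :=
  (avg (fun t => ReC (f (circ r t))) +i* avg (fun t => ImC (f (circ r t))))%C.

Lemma onC_pder r f t : 0 <= r -> onC r f -> exists l, pder (fun s => f (circ r s)) t l.
Proof.
move=> r0 /(_ (circ r t) (nm_circ t r0))[l hl].
by exists (l * (iC R * circ r t)); apply: pder_comp hl; exact: pder_circ.
Qed.
Lemma onC_contRe r f : 0 <= r -> onC r f -> continuous (fun t => ReC (f (circ r t))).
Proof.
by move=> r0 h t; have [l hl] := onC_pder t r0 h; exact: rder_continuous (pder_Re hl).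
Qed.
Lemma onC_contIm r f : 0 <= r -> onC r f -> continuous (fun t => ImC (f (circ r t))).
Proof.
by move=> r0 h t; have [l hl] := onC_pder t r0 h; exact: rder_continuous (pder_Im hl).
Qed.

Lemma onCM r f g : onC r f -> onC r g -> onC r (fun z => f z * g z).
Proof.
by move=> h1 h2 z hz; have [? a] := h1 z hz; have [? b] := h2 z hz;
  eexists; exact: cderM a b.
Qed.
Lemma onCD r f g : onC r f -> onC r g -> onC r (fun z => f z + g z).
Proof.
by move=> h1 h2 z hz; have [? a] := h1 z hz; have [? b] := h2 z hz;
  eexists; exact: cderD a b.
Qed.
Lemma onC_cst r (a : C) : onC r (fun=> a).
Proof. by move=> z _; eexists; exact: cder_cst. Qed.
Lemma onC_id r : onC r id.
Proof. by move=> z _; eexists; exact: cder_id. Qed.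
Lemma onCV r f : (forall z, nm z = r -> f z != 0) -> onC r f -> onC r (fun z => (f z)^-1).
Proof.
move=> h0 h z hz; have [? a] := h z hz; eexists; exact: cderV (h0 z hz) a.
Qed.

Lemma cmean_ext r f g : 0 <= r -> (forall z, nm z = r -> f z = g z) ->
  cmean r f = cmean r g.
Proof.
move=> r0 h; have E : (fun t => f (circ r t)) = (fun t => g (circ r t)).
  by apply/funext => t; apply: h; exact: nm_circ.
rewrite /cmean (_ : (fun t => ReC (f (circ r t))) = (fun t => ReC (g (circ r t)))).
  by rewrite (_ : (fun t => ImC (f (circ r t))) = (fun t => ImC (g (circ r t)))) //;
    apply/funext => t; rewrite -[f _]/((fun t => f (circ r t)) t) E.
by apply/funext => t; rewrite -[f _]/((fun t => f (circ r t)) t) E.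
Qed.

Lemma cmeanD r f g : 0 <= r -> onC r f -> onC r g ->
  cmean r (fun z => f z + g z) = cmean r f + cmean r g.
Proof.
move=> r0 hf hg; apply: eqC; rewrite ?ReD ?ImD /cmean /ReC /ImC /=.
  rewrite -avgD; try exact: onC_contRe.
  by congr avg; apply/funext => t; rewrite -/(ReC _) ReD.
rewrite -avgD; try exact: onC_contIm.
by congr avg; apply/funext => t; rewrite -/(ImC _) ImD.
Qed.

Lemma avg_lin (a b : R) u v : continuous u -> continuous v ->
  avg (fun t => a * u t + b * v t) = a * avg u + b * avg v.
Proof.
move=> cu cv; rewrite avgD ?avgZ //.
  by move=> t; apply: cvgM; [exact: cvg_cst|exact: cu].
by move=> t; apply: cvgM; [exact: cvg_cst|exact: cv].
Qed.

Lemma cmeanZ r (a : C) f : 0 <= r -> onC r f ->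
  cmean r (fun z => a * f z) = a * cmean r f.
Proof.
move=> r0 hf; have [cR cI] := (onC_contRe r0 hf, onC_contIm r0 hf).
apply: eqC; rewrite ?ReM ?ImM.
  rewrite -mulNr /cmean /ReC /ImC /= -avg_lin //; congr avg.
  by apply/funext => t; rewrite -/(ReC _) ReM mulNr.
rewrite /cmean /ReC /ImC /= -avg_lin //; congr avg.
by apply/funext => t; rewrite -/(ImC _) ImM.
Qed.

Lemma cmean_cst r (a : C) : cmean r (fun=> a) = a.
Proof. by rewrite /cmean !avg_cst; case: a. Qed.

Lemma cmean_le r f v : 0 <= r -> onC r f -> continuous v ->
  (forall t, nm (f (circ r t)) <= v t) -> nm (cmean r f) <= avg v.
Proof.
move=> r0 hf cv h; have [w w1 hw] := nm_attain (cmean r f).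
rewrite -hw -cmeanZ // /cmean /ReC /=.
have hwf : onC r (fun z => w * f z) by apply: onCM => //; exact: onC_cst.
apply: avg_le => //; first exact: (onC_contRe r0 hwf).
move=> t; apply: le_trans (h t).
rewrite -/(ReC _); apply: le_trans (ler_norm _) _; apply: le_trans (Re_le_nm _) _.
by rewrite nmM w1 mul1r.
Qed.

Lemma cmean_bound r f B : 0 <= r -> onC r f ->
  (forall z, nm z = r -> nm (f z) <= B) -> nm (cmean r f) <= B.
Proof.
move=> r0 hf h; rewrite -[B]avg_cst; apply: cmean_le => //.
  by move=> t; exact: cvg_cst.
by move=> t; apply: h; exact: nm_circ.
Qed.

(** On the circle, i z g(z) is the derivative of f(r e^(it)) in t, and the derivative of a periodic
    function has mean 0. The factor z comes from dz = i z dt. *)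
Lemma cmean_deriv r f g : 0 <= r -> onC r (fun z => z * g z) ->
  (forall z, nm z = r -> cder f z (g z)) -> cmean r (fun z => z * g z) = 0.
Proof.
move=> r0 hz h.
have D t : pder (fun s => f (circ r s)) t (g (circ r t) * (iC R * circ r t)).
  by apply: pder_comp (pder_circ r t) (h _ _); exact: nm_circ.
have E1 t : ReC (g (circ r t) * (iC R * circ r t)) = - ImC (circ r t * g (circ r t)).
  by rewrite !(ReM, ImM) /iC /ReC /ImC /=; ring.
have E2 t : ImC (g (circ r t) * (iC R * circ r t)) = ReC (circ r t * g (circ r t)).
  by rewrite !(ReM, ImM) /iC /ReC /ImC /=; ring.
have [cR cI] := (onC_contRe r0 hz, onC_contIm r0 hz).
rewrite /cmean.
have -> : avg (fun t => ReC (circ r t * g (circ r t))) = 0.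
  apply: (@avg_deriv (fun t => ImC (f (circ r t)))) => //; last by rewrite circ_2pi.
  by move=> t; rewrite -E2; exact: pder_Im.
have -> : avg (fun t => ImC (circ r t * g (circ r t))) = 0.
  apply: (@avg_deriv (fun t => - ReC (f (circ r t)))) => //; last by rewrite circ_2pi.
  move=> t; have := pder_Re (D t); rewrite E1 => H e e0.
  have [d d0 hd] := H e e0; exists d => // s /hd.
  by rewrite -normrN; congr (`| _ | <= _); ring.
by [].
Qed.

End CircleMeans.

(** * Cauchy's formula *)

Section Cauchy.
Variable R : realType.
Local Notation C := (Cplx R).
Implicit Types (x y r s : R) (z w a b : C) (f g : C -> C).

Lemma cder_local f g z l d : 0 < d ->
  (forall w, nm (w - z) < d -> f w = g w) -> cder f z l -> cder g z l.
Proof.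
move=> d0 E h e /h[d' d'0 hd]; exists (Num.min d d'); first by rewrite lt_min d0.
move=> w; rewrite lt_min => /andP[w1 /hd].
by rewrite !E // ?subrr ?nm0 // (_ : z + w - z = w) //; ring.
Qed.

Lemma holI r f : (forall z, nm z < r -> exists l, cder f z l) -> hol r f.
Proof. by move=> h z /h[l hl]; rewrite (cder_derive1 hl). Qed.

Lemma holW r s f : s <= r -> hol r f -> hol s f.
Proof. by move=> sr h z zs; apply: h; exact: lt_le_trans sr. Qed.

Lemma disc_open r z w : nm (w - z) < r - nm z -> nm w < r.
Proof. by have := nm_rtri w z; lra. Qed.

Lemma hol_cst r a : hol r (fun=> a).
Proof. by apply: holI => z _; eexists; exact: cder_cst. Qed.
Lemma holD r f g : hol r f -> hol r g -> hol r (fun z => f z + g z).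
Proof. by move=> h k; apply: holI => z zr; eexists; exact: cderD (h z zr) (k z zr). Qed.
Lemma holB r f g : hol r f -> hol r g -> hol r (fun z => f z - g z).
Proof. by move=> h k; apply: holI => z zr; eexists; exact: cderB (h z zr) (k z zr). Qed.
Lemma holM r f g : hol r f -> hol r g -> hol r (fun z => f z * g z).
Proof. by move=> h k; apply: holI => z zr; eexists; exact: cderM (h z zr) (k z zr). Qed.
Lemma holN r f : hol r f -> hol r (fun z => - f z).
Proof. by move=> h; apply: holI => z zr; eexists; exact: cderN (h z zr). Qed.
Lemma holX r f n : hol r f -> hol r (fun z => f z ^+ n).
Proof. by move=> h; apply: holI => z zr; eexists; exact: cderX n (h z zr). Qed.
Lemma holV r f : (forall z, nm z < r -> f z != 0) -> hol r f -> hol r (fun z => (f z)^-1).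
Proof. by move=> h0 h; apply: holI => z zr; eexists; exact: cderV (h0 z zr) (h z zr). Qed.
Lemma hol_cexp r f : hol r f -> hol r (fun z => cexp (f z)).
Proof. by move=> h; apply: holI => z zr; eexists; exact: cder_comp (h z zr) (cder_cexp _). Qed.

Lemma hol_onC r s f : hol r f -> s < r -> onC s f.
Proof. by move=> h sr z zs; exists (derive1 f z); apply: h; rewrite zs. Qed.

(** The integral of [f] along the segment from 0. It does not mention the disc, so that the
    primitives on different discs are the same function. *)
Definition prim f z : C := xget 0 [set L | tends (fun k => seg k f 0 z) L].

Lemma prim_tends r f z : hol r f -> nm z < r -> tends (fun k => seg k f 0 z) (prim f z).
Proof.
move=> hf zr; have r0 := le_lt_trans (nm_ge0 z) zr.
have [L hL] := seg_tends (hol_contD hf) (etrans (congr1 (fun x => x < r) (nm0 R)) r0) zr.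
exact: (xgetI (P := [set L | tends (fun k => seg k f 0 z) L]) 0 hL).
Qed.

Lemma prim_diff r f z w : hol r f -> nm z < r -> nm w < r ->
  tends (fun k => seg k f z w) (prim f w - prim f z).
Proof.
move=> hf zr wr; have r0 : nm (0 : C) < r by rewrite nm0 (le_lt_trans (nm_ge0 z)).
have := tendsD (goursat hf r0 zr wr) (tendsD (prim_tends hf wr) (tendsN (prim_tends hf zr))).
rewrite add0r; set u := (fun k => _).
suff -> : u = fun k => seg k f z w by [].
by apply/funext => k; rewrite /u /tri (seg_anti k f 0 w); ring.
Qed.

Lemma cder_prim r f z : hol r f -> nm z < r -> cder (prim f) z (f z).
Proof.
move=> hf zr e e0; have [d d0 hd] := hol_contD hf zr e0.
exists (Num.min d (r - nm z)); first by rewrite lt_min d0; lra.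
move=> w; rewrite lt_min => /andP[w1 w2].
have wr : nm (z + w) < r by apply: (@disc_open _ z); rewrite (_ : _ - z = w) //; ring.
apply: (tends_bound (K := 0%N) (prim_diff hf zr wr)) => k _.
have E : f z * w = seg k (fun t => f z + 0 * (t - z)) z (z + w).
  by rewrite seg_affine; ring.
have Ew : z + w - z = w by ring.
rewrite E -segB -{2}Ew.
apply: (@seg_bound _ _ _ _ _ z (nm w)); last by rewrite Ew.
  by move=> t ht; rewrite mul0r addr0; apply/ltW/hd; lra.
by rewrite subrr nm0 nm_ge0.
Qed.

Lemma hol_prim r f : hol r f -> hol r (prim f).
Proof. by move=> h; apply: holI => z zr; exists (f z); exact: cder_prim h zr. Qed.

(** This second-order expansion makes the difference quotient [dq a f] differentiable at [a]. Unlike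
    a second derivative, it is available for a primitive before derivatives are known to be
    holomorphic. *)
Definition second f a l m := forall e : R, 0 < e -> exists2 d : R, 0 < d &
  forall w, nm w < d -> nm (f (a + w) - f a - l * w - m * w ^+ 2) <= e * nm w ^+ 2.

Lemma prim_second r f a : hol r f -> nm a < r ->
  second (prim f) a (f a) (derive1 f a / 2).
Proof.
move=> hf ar e e0; have [d d0 hd] := hf a ar e e0.
exists (Num.min d (r - nm a)); first by rewrite lt_min d0; lra.
move=> w; rewrite lt_min => /andP[w1 w2].
have Ew : a + w - a = w by ring.
have wr : nm (a + w) < r by apply: (@disc_open _ a); rewrite Ew.
rewrite -addrA -opprD.
apply: (tends_bound (K := 0%N) (prim_diff hf ar wr)) => k _.
have -> : f a * w + derive1 f a / 2 * w ^+ 2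
   = seg k (fun t => f a + derive1 f a * (t - a)) a (a + w).
  by rewrite seg_affine /mid; field.
rewrite -segB expr2 mulrA -{3}Ew.
apply: (@seg_bound _ _ _ _ _ a (nm w)); last by rewrite Ew.
  move=> t ht; have := hd (t - a); rewrite (_ : a + (t - a) = t); last by ring.
  move=> h; rewrite opprD addrA; apply: le_trans (h _) _; first by lra.
  by rewrite ler_pM2l.
by rewrite subrr nm0 nm_ge0.
Qed.

Definition dq a f z : C := if z == a then derive1 f a else (f z - f a) / (z - a).

Lemma dqE a f z : f z = f a + (z - a) * dq a f z.
Proof.
rewrite /dq; case: eqVneq => [->|za]; first by ring.
by field; rewrite subr_eq0.
Qed.

Lemma dq_off a f z l : z != a -> cder f z l -> exists l', cder (dq a f) z l'.
Proof.
move=> za h; have h1 := cderB h (cder_cst (f a) z).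
have h2 : cder (fun w => w - a) z (1 - 0) := cderB (cder_id z) (cder_cst a z).
have za0 : z - a != 0 by rewrite subr_eq0.
have K := cderM h1 (cderV (f := fun w => w - a) za0 h2).
eexists; apply: (@cder_local _ _ _ _ (nm (z - a)) _ _ K).
  by rewrite nm_gt0.
move=> w hw; rewrite /dq; case: eqVneq => // wa.
by move: hw; rewrite wa nm_sym ltxx.
Qed.

Lemma dq_at a f l m : derive1 f a = l -> second f a l m -> cder (dq a f) a m.
Proof.
move=> hl h e /h[d d0 hd]; exists d => // w /hd {}hd.
have [->|w0] := eqVneq w 0.
  by rewrite addr0 subrr sub0r nmN mulr0 nm0 mulr0.
rewrite /dq eqxx hl; case: eqVneq => [E|_].
  by move: w0; rewrite -[w](addKr a) E addNr eqxx.
rewrite (_ : a + w - a = w); last by ring.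
rewrite -(ler_pM2r (_ : 0 < nm w)) ?nm_gt0 // -nmM -mulrA -expr2.
by apply: le_trans hd; rewrite (_ : (_ - _) * w = f (a + w) - f a - l * w - m * w ^+ 2) //; field.
Qed.

Lemma dq_hol_of_second r a f m : hol r f -> second f a (derive1 f a) m ->
  nm a < r -> hol r (dq a f).
Proof.
move=> hf h ar; apply: holI => z zr; have [->|za] := eqVneq z a.
  by exists m; exact: dq_at h.
exact: dq_off (hf z zr).
Qed.

Lemma expr_small (q B : R) : 0 <= q -> q < 1 -> forall e, 0 < e ->
  exists N, forall n, (N <= n)%N -> q ^+ n * B <= e.
Proof.
move=> q0 q1 e e0.
have := @cvg_expr R q; rewrite ger0_norm // => /(_ q1) h.
pose B1 := `|B| + 1; have B10 : 0 < B1 by rewrite /B1 ltr_wpDl.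
have /cvgrPdist_le /(_ (e / B1)) := h.
rewrite divr_gt0 // => /(_ isT) [N _ hN]; exists N => n Nn.
have := hN n Nn; rewrite sub0r normrN ger0_norm ?exprn_ge0 // ler_pdivlMr // => h2.
apply: le_trans h2; apply: ler_wpM2l; first by rewrite exprn_ge0.
by apply: le_trans (ler_norm B) _; rewrite /B1 lerDl.
Qed.

Lemma circ_neq r a z : nm a < r -> nm z = r -> z - a != 0.
Proof. by move=> ar zr; rewrite subr_eq0; apply/eqP => E; move: ar; rewrite -E zr ltxx. Qed.

Lemma circ_dist r a z : nm z = r -> r - nm a <= nm (z - a).
Proof. by move=> <-; exact: nm_rtri. Qed.

Lemma onC_sub r a : onC r (fun z => z - a).
Proof. by move=> z _; eexists; exact: cderB (cder_id z) (cder_cst a z). Qed.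

Lemma onCX r f n : onC r f -> onC r (fun z => f z ^+ n).
Proof. by move=> h z hz; have [? k] := h z hz; eexists; exact: cderX n k. Qed.

(** Expanding z / (z - a) in powers of a / z, the positive powers have mean 0, being z times a
    derivative, and the remainder [E N] tends to 0 as |a| < r. *)
Lemma cmean_kernel r a : nm a < r -> cmean r (fun z => z / (z - a)) = 1.
Proof.
move=> ar; have r0 := le_lt_trans (nm_ge0 a) ar; have r0' := ltW r0.
have z0 z : nm z = r -> z != 0 by move=> zr; rewrite -nm_gt0 zr.
pose E N := cmean r (fun z => (a / z) ^+ N * (z / (z - a))).
have oV : onC r (fun z => z^-1) by apply: onCV => //; exact: onC_id.
have oa : onC r (fun z => a / z) by apply: onCM => //; exact: onC_cst.
have oK : onC r (fun z => z / (z - a)).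
  apply: onCM; first exact: onC_id.
  by apply: onCV; [move=> z; exact: circ_neq|exact: onC_sub].
have oE N : onC r (fun z => (a / z) ^+ N * (z / (z - a))).
  by apply: onCM => //; exact: onCX.
have S N : E N = cmean r (fun z => (a / z) ^+ N) + E N.+1.
  rewrite /E -cmeanD //; last exact: onCX.
  apply: cmean_ext => // z zr; rewrite exprS.
  have := circ_neq ar zr; have := z0 z zr => h1 h2; field.
  by rewrite h1 h2.
have Z N : cmean r (fun z => (a / z) ^+ N.+1) = 0.
  pose g z := a ^+ N.+1 * (z^-1) ^+ N.+2.
  rewrite (@cmean_ext _ _ _ (fun z => z * g z)) //; last first.
    by move=> z /z0 h; rewrite /g exprMn [z^-1 ^+ N.+2]exprS; field.
  have N1 : (N.+1)%:R != 0 :> C by rewrite pnatr_eq0.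
  apply: (@cmean_deriv _ _ (fun z => - (a ^+ N.+1 / N.+1%:R) * (z^-1) ^+ N.+1)) => //.
    apply: onCM; first exact: onC_id.
    by apply: onCM; [exact: onC_cst|exact: onCX].
  move=> z /z0 h.
  have := cderZ (- (a ^+ N.+1 / N.+1%:R)) (cderX N.+1 (cderV h (cder_id z))).
  move=> k; apply: cder_eq k _ => /=.
  rewrite /g !exprS !expr0; move: N1; move: (N.+1%:R : C) => q N1; field.
  by rewrite N1 h.
have K N : E 0%N = 1 + E N.+1.
  elim: N => [|N IH]; last by rewrite IH (S N.+1) Z add0r.
  by rewrite (S 0%N) (@cmean_ext _ _ _ (fun=> 1)) ?cmean_cst // => z _; rewrite expr0.
have -> : cmean r (fun z => z / (z - a)) = E 0%N.
  by apply: cmean_ext => // z _; rewrite expr0 mul1r.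
apply/eqP; rewrite -subr_eq0; apply/eqP/nm_le0/le_eps => e e0; rewrite add0r.
have q1 : nm a / r < 1 by rewrite ltr_pdivrMr // mul1r.
have q0 : 0 <= nm a / r by rewrite divr_ge0 // nm_ge0.
have [N hN] := expr_small (r / (r - nm a)) q0 q1 e0.
rewrite (K N) addrC addrA addNr add0r.
apply: cmean_bound => // z zr.
apply: le_trans (hN N.+1 (leqnSn N)).
rewrite nmM nmX !nm_div zr; apply: ler_wpM2l; first by rewrite exprn_ge0.
apply: ler_wpM2l => //; rewrite lef_pV2 ?posrE; first exact: circ_dist.
  by rewrite nm_gt0 (circ_neq ar).
by lra.
Qed.

Lemma onC_kernel r a : nm a < r -> onC r (fun z => z / (z - a)).
Proof.
move=> ar; apply: onCM; first exact: onC_id.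
by apply: onCV; [move=> z; exact: circ_neq|exact: onC_sub].
Qed.

Lemma cauchy_of_dq r s a f : hol s f -> hol s (dq a f) -> nm a < r -> r < s ->
  f a = cmean r (fun z => z * f z / (z - a)).
Proof.
move=> hf hq ar rs; have r0 := le_lt_trans (nm_ge0 a) ar; have r0' := ltW r0.
have oz : onC r (fun z => z * dq a f z).
  by apply: onCM; [exact: onC_id|exact: hol_onC rs].
have H : cmean r (fun z => z * dq a f z) = 0.
  by apply: (@cmean_deriv _ _ (prim (dq a f))) => // z zr; apply: (cder_prim hq); rewrite zr.
rewrite (@cmean_ext _ _ _ (fun z => z * dq a f z + f a * (z / (z - a)))) //; last first.
  move=> z zr; have h := circ_neq ar zr; rewrite {1}(dqE a f z); field.
  by rewrite h.
rewrite cmeanD //; last by apply: onCM; [exact: onC_cst|exact: onC_kernel].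
by rewrite H cmeanZ ?cmean_kernel // ?add0r ?mulr1 //; exact: onC_kernel.
Qed.

(* The expansion of 1 / (z - (a + k))^m in k, with u = 1 / (z - a) and
   v = 1 / (z - (a + k)). *)
Lemma kernel_alg (m : nat) (B : R) : exists2 c : R, 0 <= c & forall k u v : C,
  nm u <= B -> nm v <= B -> v - u = k * u * v ->
  nm (v ^+ m - u ^+ m - m%:R * k * u ^+ m.+1) <= c * nm k ^+ 2.
Proof.
elim: m => [|m [c c0 IH]].
  by exists 0 => // k u v _ _ _; rewrite !expr0 subrr !mul0r subrr nm0.
exists (`|B| * c + m.+1%:R * `|B| ^+ m.+3).
  by apply: addr_ge0; apply: mulr_ge0 => //; exact: exprn_ge0.
move=> k u v uB vB E.
have -> : v ^+ m.+1 - u ^+ m.+1 - m.+1%:R * k * u ^+ m.+2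
   = v * (v ^+ m - u ^+ m - m%:R * k * u ^+ m.+1)
     + (m.+1)%:R * k * u ^+ m.+1 * (v - u) + u ^+ m * ((v - u) - k * u * v).
  by rewrite -natr1 !exprS; ring.
rewrite E subrr mulr0 addr0; apply: le_trans (nmD _ _) _; rewrite mulrDl.
have B1 : B <= `|B| := ler_norm B.
apply: lerD.
  rewrite nmM -[leRHS]mulrA; apply: ler_pM; rewrite ?nm_ge0 //; last exact: IH.
  exact: le_trans B1.
have -> : m.+1%:R * k * u ^+ m.+1 * (k * u * v) = m.+1%:R * (u ^+ m.+2 * v) * k ^+ 2.
  by rewrite !exprS expr0; ring.
rewrite nmM nmX nmM nm_nat (nmM (u ^+ _)) nmX.
rewrite ler_wpM2r ?exprn_ge0 ?nm_ge0 // ler_wpM2l //.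
rewrite [leRHS]exprSr ler_pM ?exprn_ge0 ?nm_ge0 //; last exact: le_trans B1.
by rewrite lerXn2r ?nnegrE ?nm_ge0 //; exact: le_trans B1.
Qed.

(** A Cauchy integral with kernel of order [m]; the factor z of dz = i z dt is meant to be included
    in [g]. *)
Definition cauchyT r g m a := cmean r (fun z => g z * ((z - a)^-1) ^+ m).

Lemma onC_cauchyT r g m a : onC r g -> nm a < r ->
  onC r (fun z => g z * ((z - a)^-1) ^+ m).
Proof.
move=> hg ar; apply: onCM => //; apply: onCX.
by apply: onCV; [move=> z; exact: circ_neq|exact: onC_sub].
Qed.

Lemma polar z : exists2 t, t \in `[- pi, pi] & z = circ (nm z) t.
Proof.
have [->|z0] := eqVneq z 0.
  exists 0; first by rewrite in_itv /= oppr_le0 pi_ge0.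
  by rewrite nm0 /circ rc0 mul0r.
have n0 : 0 < nm z by rewrite nm_gt0.
pose x := ReC z / nm z; pose y := ImC z / nm z.
have xy : x ^+ 2 + y ^+ 2 = 1.
  by rewrite /x /y !expr_div_n -mulrDl -nm_sqr divff // expf_neq0 // gt_eqF.
have x1 : -1 <= x <= 1.
  rewrite -ler_norml /x normrM normfV (ger0_norm (nm_ge0 z)).
  by rewrite ler_pdivrMr // mul1r Re_le_nm.
have xi : x \in `[-1, 1] by rewrite in_itv.
have pb : 0 <= acos x <= pi by rewrite acos_ge0 ?acos_lepi.
have sa : sin (acos x) = `|y|.
  by rewrite sin_acos // -sqrtr_sqr; congr Num.sqrt; rewrite -xy; ring.
have Ez (t : R) : cos t = x -> sin t = y -> z = circ (nm z) t.
  move=> ct st; rewrite circE ct st /x /y !(mulrC (nm z)) !divfK ?gt_eqF //.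
  by apply: eqC.
have [y0|y0] := leP 0 y.
  exists (acos x); last by apply: Ez; rewrite ?acosK // sa ger0_norm.
  by rewrite in_itv /=; have := pi_ge0 R; lra.
exists (- acos x); last by apply: Ez; rewrite ?cosN ?sinN ?acosK // sa ltr0_norm // opprK.
by rewrite in_itv /=; have := pi_ge0 R; lra.
Qed.

Lemma onC_bound r g : 0 <= r -> onC r g -> exists2 B : R, 0 <= B &
  forall z, nm z = r -> nm (g z) <= B.
Proof.
move=> r0 hg.
have pp : (- pi : R) <= pi by have := pi_ge0 R; lra.
pose u t := `|ReC (g (circ r t))| + `|ImC (g (circ r t))|.
have cu : continuous u.
  move=> t; apply: cvgD; apply: cvg_norm; first exact: (onC_contRe r0 hg).
  exact: (onC_contIm r0 hg).
have [c _ hc] := EVT_max pp (continuous_subspaceT cu).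
exists (u c); first by rewrite addr_ge0.
move=> z zr; have [t ht ->] := polar z; rewrite zr.
exact: le_trans (nm_le_ReIm _) (hc t ht).
Qed.

Lemma cmean_lin3 r (a b : C) f g h : 0 <= r -> onC r f -> onC r g -> onC r h ->
  cmean r (fun z => f z + (a * g z + b * h z))
  = cmean r f + (a * cmean r g + b * cmean r h).
Proof.
move=> r0 hf hg hh.
have og : onC r (fun z => a * g z) by apply: onCM => //; exact: onC_cst.
have oh : onC r (fun z => b * h z) by apply: onCM => //; exact: onC_cst.
by rewrite (cmeanD r0 hf (onCD og oh)) (cmeanD r0 og oh) (cmeanZ a r0 hg) (cmeanZ b r0 hh).
Qed.

(** Differentiation under the mean is justified by [kernel_alg], which bounds the second-order
    remainder of the kernel uniformly on the circle. *)
Lemma cder_cauchyT r g m a : onC r g -> nm a < r ->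
  cder (cauchyT r g m) a (m%:R * cauchyT r g m.+1 a).
Proof.
move=> hg ar e e0; have r0 := le_lt_trans (nm_ge0 a) ar; have r0' := ltW r0.
have [G G0 hG] := onC_bound r0' hg.
pose d := (r - nm a) / 2; have d0 : 0 < d by rewrite /d; lra.
have [c c0 hc] := kernel_alg m d^-1.
exists (Num.min d (e / (G * c + 1))).
  by rewrite lt_min d0 divr_gt0 //; have := mulr_ge0 G0 c0; lra.
move=> k; rewrite lt_min => /andP[k1 k2].
have akr : nm (a + k) < r by have := nmD a k; rewrite /d in k1; lra.
have o0 := onC_cauchyT m hg ar; have o1 := onC_cauchyT m.+1 hg ar.
have o2 := onC_cauchyT m hg akr.
have -> : cauchyT r g m (a + k) - cauchyT r g m a - m%:R * cauchyT r g m.+1 a * k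
  = cmean r (fun z => g z * (((z - (a + k))^-1) ^+ m - ((z - a)^-1) ^+ m -
        m%:R * k * ((z - a)^-1) ^+ m.+1)).
  rewrite (@cmean_ext _ _ _ (fun z => g z * ((z - (a + k))^-1) ^+ m +
      ((-1) * (g z * ((z - a)^-1) ^+ m) + (- (m%:R * k)) * (g z * ((z - a)^-1) ^+ m.+1)))) //; last first.
    by move=> z _; ring.
  rewrite (cmean_lin3 (- 1) (- (m%:R * k)) r0' o2 o0 o1) /cauchyT.
  move: (cmean r _) (cmean r _) (cmean r _) => x y w.
  by ring.
have M0 := mulr_ge0 G0 c0.
apply: (@le_trans _ _ (G * (c * nm k ^+ 2))).
  apply: cmean_bound => //.
    apply: onCM => //; have o q n : nm q < r -> onC r (fun z => ((z - q)^-1) ^+ n).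
      move=> qr; apply: onCX.
      by apply: onCV; [move=> z; exact: circ_neq|exact: onC_sub].
    move=> z zr; have [? x1] := o (a + k) m akr z zr.
    have [? x2] := o a m ar z zr; have [? x3] := o a m.+1 ar z zr.
    by eexists; apply: cderB (cderB x1 x2) (cderZ (m%:R * k) x3).
  move=> z zr; rewrite nmM; apply: ler_pM; rewrite ?nm_ge0 //; first exact: hG.
  have h1 := circ_neq ar zr; have h2 := circ_neq akr zr.
  apply: hc.
  - rewrite nmV lef_pV2 ?posrE ?nm_gt0 //.
    by have := circ_dist a zr; rewrite /d; lra.
  - rewrite nmV lef_pV2 ?posrE ?nm_gt0 //.
    by have := circ_dist (a + k) zr; have := nmD a k; move: k1; rewrite /d; lra.
  - by field; rewrite h1 h2.
rewrite mulrA expr2 mulrA; apply: ler_wpM2r; first exact: nm_ge0.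
move: k2; rewrite ltr_pdivlMr ?ltr_wpDl // mulrDr mulr1 mulrC => k2.
by have := nm_ge0 k; lra.
Qed.

End Cauchy.

(** * Consequences of Cauchy's formula *)

Section HolomorphicFunctions.
Variable R : realType.
Local Notation C := (Cplx R).
Implicit Types (x y r s : R) (z w a b : C) (f g : C -> C).

Lemma between x y : x < y -> exists2 m : R, x < m & m < y.
Proof. by move=> xy; exists ((x + y) / 2); lra. Qed.

(** Cauchy's formula is not yet available for [f], whose difference quotients are not known to be
    holomorphic at the centre. It is available for a primitive [F], through its second-order
    expansion, and the Cauchy integral of [F] can be differentiated three times. *)
Lemma hol_derive s f : hol s f -> hol s (derive1 f).
Proof.
move=> hf; apply: holI => a0 a0s.
have [r ar rs] := between a0s.
have r0 := le_lt_trans (nm_ge0 a0) ar.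
pose F := prim f; pose g z := z * F z.
have dF z : nm z < s -> cder F z (f z) by exact: cder_prim.
have hF : hol s F by exact: hol_prim.
have og : onC r g by apply: onCM; [exact: onC_id|exact: hol_onC rs].
have E1 a : nm a < r -> F a = cauchyT r g 1 a.
  move=> h; have as' := lt_trans h rs.
  have d1 : derive1 F a = f a by apply: cder_derive1; exact: dF.
  have hq : hol s (dq a F).
    apply: (@dq_hol_of_second R s a F (derive1 f a / 2)) => //.
    by rewrite d1; exact: prim_second hf as'.
  rewrite (cauchy_of_dq hF hq h rs) /cauchyT; apply: cmean_ext; first exact: ltW.
  by move=> z _; rewrite expr1.
have L (p q : C -> C) (l : C) a : (forall z, nm z < r -> p z = q z) -> nm a < r ->
    cder q a l -> cder p a l.
  move=> E h; apply: (@cder_local _ _ _ _ _ (r - nm a)); first by lra.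
  by move=> w /disc_open /E ->.
have E2 a : nm a < r -> f a = 1 * cauchyT r g 2 a.
  move=> h; rewrite -(cder_derive1 (dF a (lt_trans h rs))).
  by apply: cder_derive1; apply: (L _ _ _ _ E1 h); exact: cder_cauchyT.
have E3 a : nm a < r -> derive1 f a = 1 * (2%:R * cauchyT r g 3 a).
  move=> h; apply: cder_derive1; apply: (L _ _ _ _ E2 h).
  by apply: cderZ; exact: cder_cauchyT.
exists (1 * (2%:R * (3%:R * cauchyT r g 4 a0))).
apply: (L _ _ _ _ E3 ar); do 2 apply: cderZ.
exact: cder_cauchyT.
Qed.

Lemma const_of_cder0 r f z : (forall w, nm w < r -> cder f w 0) -> nm z < r ->
  f z = f 0.
Proof.
move=> h zr; apply/eqP; rewrite -subr_eq0; apply/eqP/nm_le0.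
have [u u1 hu] := nm_attain (f z - f 0); rewrite -hu.
pose p t := ReC (u * f (rc t * z)).
have inr t : t \in `[0, 1] -> nm (rc t * z) < r.
  rewrite in_itv /= => /andP[t0 t1]; rewrite nmM nm_rc ger0_norm //.
  by apply: le_lt_trans zr; rewrite -[leRHS]mul1r ler_wpM2r ?nm_ge0.
have D t : t \in `[0, 1] -> rder p t 0.
  move=> /inr tr.
  have H := pder_comp (pder_line (0 : C) z t) _.
  have h0 : cder (fun w => u * f (w - 0)) (0 + rc t * z) (u * 0).
    apply: cderZ; rewrite add0r; apply: cder_ext (h _ tr) => w.
    by rewrite subr0.
  have := pder_Re (H _ _ h0); rewrite mulr0 mul0r /p => K e e0.
  have [d d0 hd] := K e e0; exists d => // y /hd.
  by rewrite !add0r !subr0.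
have [|t t1|c _] := @MVT_segment R p (fun=> 0) 0 1 ler01.
- by move=> t ht; apply/rderP; apply: D; apply: subset_itvW ht; rewrite /= ?lexx.
- apply: continuous_in_subspaceT => y; rewrite inE /= => hy.
  exact: rder_continuous (D _ hy).
rewrite mul0r /p rc0 rc1 mul0r mul1r => E.
by rewrite mulrBr ReB E.
Qed.

Lemma hol_dq r a f : hol r f -> nm a < r -> hol r (dq a f).
Proof.
move=> hf ar; have hf' := hol_derive hf.
apply: (@dq_hol_of_second _ _ _ _ (derive1 (derive1 f) a / 2)) => //.
pose F := prim (derive1 f).
have E z : nm z < r -> f z = F z + (f 0 - F 0).
  move=> zr; have := @const_of_cder0 r (fun w => f w - F w) z.
  move=> H; rewrite -H //; first by ring.
  move=> w wr; apply: cder_eq (cderB (hf w wr) (cder_prim hf' wr)) _.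
  by rewrite subrr.
have := prim_second hf' ar; rewrite -/F => S e e0.
have [d d0 hd] := S e e0; exists (Num.min d (r - nm a)).
  by rewrite lt_min d0; lra.
move=> w; rewrite lt_min => /andP[/hd {}hd w2].
have wr : nm (a + w) < r by apply: (@disc_open _ _ a); rewrite (_ : a + w - a = w) //; ring.
by rewrite (E _ wr) (E _ ar) (_ : F (a + w) + _ - _ = F (a + w) - F a) //; ring.
Qed.

Lemma cauchy r s a f : hol s f -> nm a < r -> r < s ->
  f a = cmean r (fun z => z * f z / (z - a)).
Proof.
by move=> hf ar rs; apply: (cauchy_of_dq hf (hol_dq hf (lt_trans ar rs))).
Qed.

Lemma mean_value r s f : hol s f -> 0 < r -> r < s -> f 0 = cmean r f.
Proof.
move=> hf r0 rs; rewrite (@cauchy r s 0 f) ?nm0 //.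
apply: cmean_ext; first exact: ltW.
by move=> z zr; rewrite subr0 mulrC mulrA mulVf ?mul1r // -nm_gt0 zr.
Qed.

Lemma root_limit (x y K : R) : 0 <= x -> 0 <= y -> (forall n, x ^+ n <= K * y ^+ n) -> x <= y.
Proof.
move=> x0 y0 h; rewrite leNgt; apply/negP => yx.
have xp : 0 < x := le_lt_trans y0 yx.
have q1 : y / x < 1 by rewrite ltr_pdivrMr // mul1r.
have h2 : 0 < (1 / 2 : R) by lra.
have [N hN] := expr_small K (divr_ge0 y0 x0) q1 h2.
have p : 0 < x ^+ N by rewrite exprn_gt0.
have := hN N (leqnn _); have := h N.
rewrite expr_div_n mulrAC ler_pdivrMr // mulrC; lra.
Qed.

(* Landau's trick: Cauchy's formula for f^n and n-th roots. *)
Lemma max_principle r s f B a : hol s f -> r < s -> nm a < r ->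
  (forall z, nm z = r -> nm (f z) <= B) -> nm (f a) <= B.
Proof.
move=> hf rs ar hB; have r0 := le_lt_trans (nm_ge0 a) ar; have r0' := ltW r0.
have B0 : 0 <= B.
  by apply: le_trans (nm_ge0 _) (hB (circ r 0) _); exact: nm_circ.
apply: (@root_limit _ _ (r / (r - nm a))) => //; first exact: nm_ge0.
move=> n; rewrite -nmX (cauchy (holX n hf) ar rs).
apply: cmean_bound => //.
  apply: onCM; first by apply: onCM; [exact: onC_id|apply: onCX; exact: hol_onC rs].
  by apply: onCV; [move=> z; exact: circ_neq|exact: onC_sub].
move=> z zr; rewrite nm_div nmM nmX zr mulrAC.
apply: ler_pM.
- by rewrite divr_ge0 ?nm_ge0.
- by rewrite exprn_ge0 ?nm_ge0.
- apply: ler_wpM2l => //; rewrite lef_pV2 ?posrE; first exact: circ_dist.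
    by rewrite nm_gt0 (circ_neq ar).
  by lra.
- by rewrite lerXn2r ?nnegrE ?nm_ge0 //; exact: hB.
Qed.

Lemma max_disc r s f B a : hol s f -> r < s -> nm a <= r ->
  (forall z, nm z = r -> nm (f z) <= B) -> nm (f a) <= B.
Proof.
move=> hf rs; rewrite le_eqVlt => /predU1P[E h|ar]; first exact: h.
exact: max_principle rs ar.
Qed.

Lemma dq_root a f z : f a = 0 -> f z = (z - a) * dq a f z.
Proof. by move=> h; rewrite {1}(dqE a f) h add0r. Qed.

Lemma dq_aa a f : dq a f a = derive1 f a.
Proof. by rewrite /dq eqxx. Qed.

Lemma cauchy_estimate r s f B a : hol s f -> r < s -> nm a < r ->
  (forall z, nm z <= r -> nm (f z) <= B) -> nm (derive1 f a) <= 2 * B / (r - nm a).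
Proof.
move=> hf rs ar hB; rewrite -dq_aa.
have as' := lt_trans ar rs.
apply: (max_principle (hol_dq hf as') rs ar) => z zr.
have h := circ_neq ar zr; have [e|_] := eqVneq z a; first by move: ar; rewrite -e zr ltxx.
rewrite /dq; case: eqVneq => [e|_]; first by move: h; rewrite e subrr eqxx.
rewrite nm_div ler_pM ?nm_ge0 ?invr_ge0 ?nm_ge0 //.
  apply: le_trans (nmB _ _) _.
  by have := hB z; have := hB a; rewrite zr => /(_ (ltW ar)) ? /(_ (lexx _)); lra.
rewrite lef_pV2 ?posrE; first exact: circ_dist.
  by rewrite nm_gt0.
by lra.
Qed.

Lemma schwarz s f z : hol s f -> f 0 = 0 -> nm z < s ->
  (forall w, nm w < s -> nm (f w) <= 1) -> nm (f z) * s <= nm z.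
Proof.
move=> hf f0 zs h1; have s0 := le_lt_trans (nm_ge0 z) zs.
have K r : nm z < r -> r < s -> nm (f z) * r <= nm z.
  move=> zr rs; have r0 := le_lt_trans (nm_ge0 z) zr.
  have hq : hol s (dq 0 f) by apply: hol_dq; rewrite ?nm0.
  have : nm (dq 0 f z) <= r^-1.
    apply: (max_principle hq rs zr) => w wr.
    have w0 : w != 0 by rewrite -nm_gt0 wr.
    have := h1 w; rewrite wr (dq_root w f0) subr0 nmM wr => /(_ rs).
    by rewrite mulrC -ler_pdivlMr // div1r.
  rewrite (dq_root z f0) subr0 nmM => h.
  by rewrite -mulrA -[leRHS]mulr1 ler_wpM2l ?nm_ge0 // -ler_pdivlMr // div1r.
apply: le_eps => e e0.
have f1 := h1 z zs; have fz := nm_ge0 (f z).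
pose d := Num.min e ((s - nm z) / 2).
have d0 : 0 < d by rewrite lt_min e0; lra.
have d1 : d <= e by rewrite ge_min lexx.
have d2 : d <= (s - nm z) / 2 by rewrite ge_min lexx orbT.
have := K (s - d) ltac:(lra) ltac:(lra).
have : nm (f z) * d <= 1 * d by rewrite ler_wpM2r // ltW.
lra.
Qed.

(* Borel-Caratheodory: Schwarz' lemma for q / (2 A - q), with q = p - p 0. *)
Lemma borel_caratheodory s p A z : hol s p -> (forall w, nm w < s -> ReC (p w) <= A) ->
  nm z < s -> nm (p z - p 0) * (s - nm z) <= 2 * (A - ReC (p 0)) * nm z.
Proof.
move=> hp hA zs; have s0 := le_lt_trans (nm_ge0 z) zs.
(* The bound is made strict, so that [A1 > 0] and the denominator 2 A1 - q has positive real
   part. *)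
suff K A1 : A - ReC (p 0) < A1 -> nm (p z - p 0) * (s - nm z) <= 2 * A1 * nm z.
  apply: le_eps => e e0.
  have N0 : 0 < 2 * (nm z + 1) by have := nm_ge0 z; lra.
  have := K (A - ReC (p 0) + e / (2 * (nm z + 1))).
  rewrite ltrDl divr_gt0 // => /(_ isT).
  have E : e / (2 * (nm z + 1)) * (2 * (nm z + 1)) = e by rewrite divfK // gt_eqF.
  have : 0 < e / (2 * (nm z + 1)) by rewrite divr_gt0.
  by have := nm_ge0 z; nra.
move=> hA1; pose q w := p w - p 0.
have A10 : 0 < A1 by have := hA 0; rewrite nm0 => /(_ s0); lra.
have hq : hol s q := holB hp (hol_cst (p 0)).
have Rq w : nm w < s -> ReC (q w) < A1.
  by move=> /hA; rewrite /q ReB; lra.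
pose D w := rc (2 * A1) - q w.
have D0 w : nm w < s -> D w != 0.
  move=> /Rq h; apply/eqP => E.
  have : ReC (D w) = 0 by rewrite E.
  by rewrite /D ReB Re_rc; lra.
have hD : hol s D := holB (hol_cst (rc (2 * A1))) hq.
pose f w := q w / D w.
have hf : hol s f := holM hq (holV D0 hD).
have f0 : f 0 = 0 by rewrite /f /q subrr mul0r.
have f1 w : nm w < s -> nm (f w) <= 1.
  move=> ws; rewrite /f nm_div ler_pdivrMr ?nm_gt0 ?D0 // mul1r.
  rewrite -(@ler_pXn2r _ 2) ?nnegrE ?nm_ge0 // !nm_sqr /D ReB ImB Re_rc Im_rc.
  by have := Rq w ws; nra.
have S := schwarz hf f0 zs f1.
have E : q z = rc (2 * A1) * f z - q z * f z.
  by rewrite -mulrBl -/(D z) /f; field; exact: D0.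
rewrite -/(q z).
have H : nm (q z) <= 2 * A1 * nm (f z) + nm (q z) * nm (f z).
  rewrite {1}E; apply: le_trans (nmB _ _) _.
  by rewrite !nmM nm_rc ger0_norm //; lra.
have := nm_ge0 (q z); have := nm_ge0 (f z).
have : nm (q z) * s <= (2 * A1 * nm (f z) + nm (q z) * nm (f z)) * s by rewrite ler_pM2r.
have : 2 * A1 * (nm (f z) * s) <= 2 * A1 * nm z by rewrite ler_pM2l //; lra.
have : nm (q z) * (nm (f z) * s) <= nm (q z) * nm z by rewrite ler_wpM2l ?nm_ge0.
lra.
Qed.

Lemma cexp_surj z : z != 0 -> exists w, cexp w = z.
Proof.
move=> z0; have [t _ E] := polar z.
exists (ln (nm z) +i* t)%C.
by rewrite /cexp /ReC /ImC /= lnK ?posrE ?nm_gt0 // -E.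
Qed.

(** Here [w] is a chosen logarithm of [g 0]. As the formula does not depend on the disc, it also
    yields logarithms of entire functions. *)
Definition clog g (w : C) z : C := w + prim (fun t => derive1 g t / g t) z.

Lemma prim0 s g : 0 < s -> hol s g -> prim g 0 = 0.
Proof.
move=> s0 hg; have h0 : nm (0 : C) < s by rewrite nm0.
apply: (tends_uniq (prim_tends hg h0)) => e e0; exists 0%N => k _.
suff -> : seg k g 0 0 = 0 by rewrite subrr nm0 ltW.
elim: k => [|k IH] /=; first by rewrite subrr mul0r.
by rewrite (_ : mid (0 : C) 0 = 0) ?IH ?addr0 // /mid addr0 mul0r.
Qed.

Lemma clogP s g w : hol s g -> (forall z, nm z < s -> g z != 0) -> cexp w = g 0 ->
  hol s (clog g w) /\ forall z, nm z < s -> cexp (clog g w z) = g z.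
Proof.
move=> hg g0 ew.
have hl : hol s (fun t => derive1 g t / g t).
  by apply: holM; [exact: hol_derive|exact: holV].
have hc : hol s (clog g w).
  by apply: holD; [exact: hol_cst|exact: hol_prim].
split=> // z zs; have s0 := le_lt_trans (nm_ge0 z) zs.
have E := @const_of_cder0 s (fun t => g t * cexp (- clog g w t)) z _ zs.
have : g z * cexp (- clog g w z) = g 0 * cexp (- clog g w 0).
  apply: E => x xs.
  have d : cder (clog g w) x (0 + derive1 g x / g x).
    by apply: cderD; [exact: cder_cst|exact: cder_prim hl xs].
  apply: cder_eq (cderM (hg x xs) (cder_comp (cderN d) (cder_cexp _))) _.
  by field; exact: g0.
have -> : clog g w 0 = w by rewrite /clog (prim0 s0 hl) addr0.
rewrite !cexpN ew divff; last by rewrite -ew cexp_neq0.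
move=> h; have := congr1 (fun t => t * cexp (clog g w z)) h.
by rewrite mulfVK ?cexp_neq0 // mul1r.
Qed.

Lemma log_exists s g : 0 < s -> hol s g -> (forall z, nm z < s -> g z != 0) ->
  exists2 q, hol s q & forall z, nm z < s -> g z = cexp (q z).
Proof.
move=> s0 hg g0; have [w ew] := cexp_surj (g0 0 ltac:(by rewrite nm0)).
by have [h1 h2] := clogP hg g0 ew; exists (clog g w) => // z /h2.
Qed.

End HolomorphicFunctions.

(** * Entire functions *)

Section Entire.
Variable R : realType.
Local Notation C := (Cplx R).
Implicit Types (r s : R) (z w a b : C) (f g : C -> C).

Lemma entire_cder f : entire f -> forall z, cder f z (derive1 f z).
Proof. by move=> h z; exact: derivable_cder. Qed.
Lemma entireI f : (forall z, exists l, cder f z l) -> entire f.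
Proof. by move=> h z; have [l /cder_derivable] := h z. Qed.
Lemma entire_hol r f : entire f -> hol r f.
Proof. by move=> h z _; exact: entire_cder. Qed.
Lemma hol_entire f : (forall r, hol r f) -> entire f.
Proof.
by move=> h; apply: entireI => z; exists (derive1 f z); apply: (h (nm z + 1)); rewrite ltrDl.
Qed.

Lemma entire_cst a : entire (fun=> a).
Proof. by apply: entireI => z; eexists; exact: cder_cst. Qed.
Lemma entire_id : entire (id : C -> C).
Proof. by apply: entireI => z; eexists; exact: cder_id. Qed.
Lemma entireD f g : entire f -> entire g -> entire (fun z => f z + g z).
Proof.
by move=> h k; apply: entireI => z; eexists; exact: cderD (entire_cder h z) (entire_cder k z).
Qed.
Lemma entireB f g : entire f -> entire g -> entire (fun z => f z - g z).
Proof.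
by move=> h k; apply: entireI => z; eexists; exact: cderB (entire_cder h z) (entire_cder k z).
Qed.
Lemma entireM f g : entire f -> entire g -> entire (fun z => f z * g z).
Proof.
by move=> h k; apply: entireI => z; eexists; exact: cderM (entire_cder h z) (entire_cder k z).
Qed.
Lemma entireN f : entire f -> entire (fun z => - f z).
Proof. by move=> h; apply: entireI => z; eexists; exact: cderN (entire_cder h z). Qed.
Lemma entireZ a f : entire f -> entire (fun z => a * f z).
Proof. by move=> h; apply: entireI => z; eexists; exact: cderZ (entire_cder h z). Qed.
Lemma entireX f n : entire f -> entire (fun z => f z ^+ n).
Proof. by move=> h; apply: entireI => z; eexists; exact: cderX n (entire_cder h z). Qed.
Lemma entire_cexp f : entire f -> entire (fun z => cexp (f z)).
Proof. by move=> h; apply: entireI => z; eexists; exact: cder_comp (entire_cder h z) (cder_cexp _). Qed.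
Lemma entire_derive f : entire f -> entire (derive1 f).
Proof. by move=> h; apply: hol_entire => r; apply: hol_derive; exact: entire_hol. Qed.
Lemma entire_dq a f : entire f -> entire (dq a f).
Proof.
move=> h; apply: hol_entire => r.
by apply: (@holW R (Num.max r (nm a + 1)));
  [rewrite le_max lexx|apply: hol_dq; [exact: entire_hol|rewrite lt_max ltrDl ltr01 orbT]].
Qed.

Lemma cder_shift f a z l : cder f (z + a) l -> cder (fun w => f (w + a)) z l.
Proof.
move=> h; have k : cder (fun w => w + a) z 1.
  by apply: cder_eq (cderD (cder_id z) (cder_cst a z)) _; rewrite addr0.
by apply: cder_eq (cder_comp k h) _; rewrite mulr1.
Qed.
Lemma entire_shift f a : entire f -> entire (fun z => f (z + a)).
Proof. by move=> h; apply: entireI => z; eexists; exact: cder_shift (entire_cder h _). Qed.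
Lemma derive1_shift f a : entire f ->
  derive1 (fun z => f (z + a)) = fun z => derive1 f (z + a).
Proof. by move=> h; apply/funext => z; apply: cder_derive1; apply: cder_shift; exact: entire_cder. Qed.

Lemma entire_const f : entire f -> (forall z, derive1 f z = 0) -> forall z, f z = f 0.
Proof.
move=> h h0 z; apply: (@const_of_cder0 _ (nm z + 1)); last by rewrite ltrDl.
by move=> w _; rewrite -(h0 w); exact: entire_cder.
Qed.

Lemma entire_log f : entire f -> (forall z, f z != 0) ->
  exists2 h, entire h & forall z, f z = cexp (h z).
Proof.
move=> hf f0; have [w ew] := cexp_surj (f0 0).
have H r := clogP (entire_hol (r := r) hf) (fun z _ => f0 z) ew.
exists (clog f w); first by apply: hol_entire => r; case: (H r).
by move=> z; have [_ ->] := H (nm z + 1); rewrite // ltrDl.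
Qed.

Lemma hol_bound r s f : hol s f -> 0 <= r -> r < s -> exists2 B : R, 0 <= B &
  forall z, nm z <= r -> nm (f z) <= B.
Proof.
move=> hf r0 rs; have [B B0 hB] := onC_bound r0 (hol_onC hf rs).
by exists B => // z zr; apply: (max_disc hf rs zr hB).
Qed.

Lemma entire_cont f z : entire f -> forall e : R, 0 < e ->
  exists2 d : R, 0 < d & forall w, nm (w - z) < d -> nm (f w - f z) < e.
Proof.
move=> hf e e0; have zz : nm z < nm z + 1 by rewrite ltrDl.
exact: (hol_contD (entire_hol hf) zz).
Qed.

Lemma entire_near0 f z : entire f -> f z != 0 ->
  exists2 d : R, 0 < d & forall w, nm (w - z) < d -> f w != 0.
Proof.
move=> hf fz; have fz0 : 0 < nm (f z) by rewrite nm_gt0.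
have [d d0 hd] := @entire_cont f z hf _ fz0; exists d => // w /hd; apply: contraTneq => ->.
by rewrite sub0r nmN ltxx.
Qed.

(* If all quotients by powers of z were divisible by z, the maximum principle would
   make f vanish. *)
Lemma order_at0 f z : entire f -> f z != 0 ->
  exists m, exists2 Y, entire Y & (Y 0 != 0) /\ forall w, f w = w ^+ m * Y w.
Proof.
move=> hf fz; pose Y m := iter m (dq 0) f.
have hY m : entire (Y m).
  elim: m => [|m IH]; first by exact: hf.
  exact: entire_dq IH.
have H m : (forall k, (k < m)%N -> Y k 0 = 0) -> forall w, f w = w ^+ m * Y m w.
  elim: m => [|m IH] h w; first by rewrite expr0 mul1r.
  rewrite IH; last by move=> k km; apply: h; exact: ltnW.
  by rewrite (dq_root w (h m (ltnSn m))) subr0 mulrA -exprSr.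
have [ex|nex] := pselect (exists m, Y m 0 != 0).
  have [m Ym min] := ex_minnP ex.
  exists m; exists (Y m); first exact: (hY m).
  split; [exact: Ym|apply: H => k km].
  by apply/eqP; apply/negP => /negP Yk; move: (min k Yk); rewrite leqNgt km.
have Y0 k : Y k 0 = 0 by apply/eqP; apply/negP => /negP h; apply: nex; exists k.
exfalso; move/eqP: fz; apply; apply/nm_le0/le_eps => e e0; rewrite add0r.
pose r := nm z + 1; have zr : nm z < r by rewrite ltrDl.
have r0 : 0 < r := le_lt_trans (nm_ge0 z) zr.
have rr : r < r + 1 by rewrite ltrDl.
have [B B0 hB] := hol_bound (entire_hol (r := r + 1) hf) (ltW r0) rr.
have q1 : nm z / r < 1 by rewrite ltr_pdivrMr // mul1r.
have [N hN] := expr_small B (divr_ge0 (nm_ge0 z) (ltW r0)) q1 e0.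
apply: le_trans (hN N (leqnn N)).
rewrite (H N) // nmM nmX expr_div_n -mulrA; apply: ler_wpM2l.
  by rewrite exprn_ge0 // nm_ge0.
apply: (max_principle (entire_hol (r := r + 1) (hY N)) rr zr) => w wr.
have := hB w; rewrite wr => /(_ (lexx _)).
by rewrite (H N) // nmM nmX wr mulrC -ler_pdivlMr ?exprn_gt0 // mulrC.
Qed.

Lemma order_at f z a : entire f -> f z != 0 ->
  exists m, exists2 Y, entire Y & (Y a != 0) /\ forall w, f w = (w - a) ^+ m * Y w.
Proof.
move=> hf fz.
have [|m [Y hY [Y0 E]]] := @order_at0 (fun w => f (w + a)) (z - a) (entire_shift hf).
  by rewrite subrK.
exists m; exists (fun w => Y (w - a)); first exact: (@entire_shift _ (- a)).
by rewrite subrr; split=> // w; rewrite -E subrK.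
Qed.

(** Near a point z where [f] does not vanish, a nonzero [g] has the form (w - z)^m Y(w) with Y(z)
    nonzero, so the product would be nonzero at nearby points. *)
Lemma entire_idom f g : entire f -> entire g -> (forall z, f z * g z = 0) ->
  (forall z, f z = 0) \/ (forall z, g z = 0).
Proof.
move=> hf hg fg; have [h|/existsNP[z /eqP fz]] := pselect (forall z, f z = 0); first by left.
right=> w; apply/eqP; apply/negP => /negP gw.
have [m [Y hY [Y0 E]]] := @order_at g w z hg gw.
have [d1 d10 h1] := entire_near0 hf fz; have [d2 d20 h2] := entire_near0 hY Y0.
pose d := Num.min d1 d2; have d0 : 0 < d by rewrite lt_min d10.
pose u := z + rc (d / 2).
have du : nm (u - z) = d / 2.
  by rewrite /u addrAC subrr add0r nm_rc ger0_norm //; lra.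
have ud : nm (u - z) < d by rewrite du; lra.
have /eqP := fg u; rewrite E !mulf_eq0 expf_eq0.
have [ud1 ud2] : nm (u - z) < d1 /\ nm (u - z) < d2.
  by split; apply: (lt_le_trans ud); rewrite /d ge_min lexx ?orbT.
rewrite (negbTE (h1 u ud1)) (negbTE (h2 u ud2)) orbF /= => /andP[_ /eqP u0].
by move: du; rewrite u0 nm0; lra.
Qed.

Lemma entire_eq f g h z : entire f -> entire g -> entire h -> h z != 0 ->
  (forall w, h w != 0 -> f w = g w) -> forall w, f w = g w.
Proof.
move=> hf hg hh hz E w.
have [] := @entire_idom (fun w => f w - g w) h (entireB hf hg) hh.
- move=> u; have [->|h0] := eqVneq (h u) 0; first by rewrite mulr0.
  by rewrite (E u h0) subrr mul0r.
- by move=> /(_ w) /eqP; rewrite subr_eq0 => /eqP.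
- by move=> /(_ z) h0; rewrite h0 eqxx in hz.
Qed.

(** The local quotients agree with f / g off the zeros of [g], and near each point only the centre
    can be such a zero; so evaluating each quotient at its own centre glues them. *)
Lemma entire_quotient f g z : entire f -> entire g -> g z != 0 ->
  (forall a, g a = 0 -> exists m, exists Y V, [/\ entire Y, entire V, Y a != 0,
      forall w, g w = (w - a) ^+ m * Y w & forall w, f w = (w - a) ^+ m * V w]) ->
  exists2 W, entire W & forall w, f w = W w * g w.
Proof.
move=> hf hg gz H.
pose P a (q : C -> C) := exists2 d : R, 0 < d &
  (forall w, nm (w - a) < d -> exists l, cder q w l) /\
  (forall w, nm (w - a) < d -> f w = q w * g w /\ (w != a -> g w != 0)).
have HP a : exists q, P a q.
  have [g0|g0] := eqVneq (g a) 0; last first.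
    have [d d0 hd] := entire_near0 hg g0.
    exists (fun w => f w / g w); exists d => //; split=> w /hd gw.
      by eexists; exact: cderM (entire_cder hf w) (cderV gw (entire_cder hg w)).
    by rewrite divfK.
  have [m [Y [V [hY hV Y0 Eg Ef]]]] := H a g0.
  have [d d0 hd] := entire_near0 hY Y0.
  exists (fun w => V w / Y w); exists d => //; split=> w /hd Yw.
    by eexists; exact: cderM (entire_cder hV w) (cderV Yw (entire_cder hY w)).
  split; first by rewrite Ef Eg; field.
  by move=> wa; rewrite Eg mulf_neq0 // expf_neq0 // subr_eq0.
have [q hq] := choice HP.
pose W a := q a a.
have WE a d w : 0 < d -> (forall w, nm (w - a) < d -> f w = q a w * g w /\ (w != a -> g w != 0)) ->
    nm (w - a) < d -> W w = q a w.
  move=> d0 h wa; have [->//|wna] := eqVneq w a.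
  have [E /(_ wna) gw] := h w wa.
  apply: (mulIf gw); rewrite -E.
  have [d' d'0 [_ h']] := hq w; have [|E' _] := h' w; first by rewrite subrr nm0.
  by rewrite E'.
exists W.
  apply: entireI => a; have [d d0 [hd hE]] := hq a.
  have [|l hl] := hd a; first by rewrite subrr nm0.
  exists l; apply: (@cder_local _ _ _ _ _ d _ _ hl) => // w wa.
  by rewrite (WE a d w).
move=> w; have [d d0 [_ h]] := hq w; have [|E _] := h w; first by rewrite subrr nm0.
exact: E.
Qed.

Lemma liouville f K : entire f -> (forall z, nm (f z) <= K) -> forall z, f z = f 0.
Proof.
move=> hf hK z; apply/eqP; rewrite -subr_eq0; apply/eqP/nm_le0/le_eps => e e0.
have K0 : 0 <= K := le_trans (nm_ge0 _) (hK 0).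
have z0 := nm_ge0 z.
pose r := (nm z + 1) * (1 + 2 * K / e).
have Ke : 0 <= 2 * K / e by rewrite divr_ge0 ?mulr_ge0 // ltW.
have zr : nm z < r by rewrite /r; nra.
have r0 : 0 < r := le_lt_trans (nm_ge0 z) zr.
have q : nm (dq 0 f z) <= 2 * K / r.
  apply: (@max_principle _ r (r + 1)) => //; first by apply: entire_hol; exact: entire_dq.
    by rewrite ltrDl.
  move=> w wr; have w0 : w != 0 by rewrite -nm_gt0 wr.
  rewrite /dq (negbTE w0) nm_div subr0 wr ler_wpM2r ?invr_ge0 ?(ltW r0) //.
  by apply: le_trans (nmB _ _) _; have := hK w; have := hK 0; lra.
rewrite (_ : f z - f 0 = z * dq 0 f z); last by rewrite {1}(dqE 0 f z); ring.
rewrite nmM; have : nm z * nm (dq 0 f z) <= nm z * (2 * K / r) by rewrite ler_wpM2l.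
have : nm z * (2 * K / r) <= e.
  rewrite mulrA ler_pdivrMr // /r.
  have E : e * (2 * K / e) = 2 * K by rewrite mulrC divfK // gt_eqF.
  have : e * ((nm z + 1) * (1 + 2 * K / e)) = (nm z + 1) * (e + e * (2 * K / e)) by ring.
  by rewrite E => ->; nra.
lra.
Qed.

(** The quotient (f(z) - f(0)) / z has growth of one degree less away from 0; on the unit disc the
    maximum principle bounds it. *)
Lemma liouville_poly f N K : entire f -> (forall z, nm (f z) <= K * (1 + nm z) ^+ N) ->
  exists p : {poly C}, forall z, f z = p.[z].
Proof.
elim: N f K => [|N IH] f K hf hK.
  exists (f 0)%:P => z; rewrite hornerC; apply: (liouville (K := K)) => // w.
  by have := hK w; rewrite expr0 mulr1.
have K0 : 0 <= K.
  by have := le_trans (nm_ge0 _) (hK 0); rewrite nm0 addr0 expr1n mulr1.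
have hD := @entire_dq 0 f hf.
have K4 : 0 <= 4 * K by lra.
have big z : 1 <= nm z -> nm (dq 0 f z) <= 4 * K * (1 + nm z) ^+ N.
  move=> z1; have z0 : z != 0 by rewrite -nm_gt0; lra.
  have p1 : 1 <= (1 + nm z) ^+ N.+1 by apply: exprn_ege1; lra.
  rewrite /dq (negbTE z0) subr0 nm_div ler_pdivrMr; last lra.
  apply: le_trans (nmB _ _) _.
  have := hK z; have := hK 0; rewrite nm0 addr0 expr1n mulr1 => h0 h1.
  have : K * 1 <= K * (1 + nm z) ^+ N.+1 by rewrite ler_wpM2l.
  have : 0 <= K * (1 + nm z) ^+ N * (nm z - 1).
    by rewrite !mulr_ge0 ?exprn_ge0 //; lra.
  by move: h0 h1; rewrite exprS; nra.
have [p hp] : exists p : {poly C}, forall z, dq 0 f z = p.[z].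
  apply: (IH _ (4 * K * 2 ^+ N)) => // z.
  have p2 : 1 <= (2 : R) ^+ N by apply: exprn_ege1; lra.
  have pz : 1 <= (1 + nm z) ^+ N by apply: exprn_ege1; rewrite lerDl nm_ge0.
  have [z1|z1] := leP 1 (nm z).
    apply: le_trans (big z z1) _; apply: ler_wpM2r; first by lra.
    by rewrite -[leLHS]mulr1 ler_wpM2l.
  apply: (@le_trans _ _ (4 * K * 2 ^+ N)).
    apply: (@max_principle _ 1 2) => //; first exact: entire_hol.
      lra.
    by move=> w w1; have := big w; rewrite w1 (_ : 1 + 1 = 2 :> R); [exact|lra].
  rewrite -[leLHS]mulr1; apply: ler_wpM2l => //.
  by apply: mulr_ge0; last lra.
exists ('X * p + (f 0)%:P) => z.
by rewrite hornerD hornerM hornerX hornerC -hp {1}(dqE 0 f z) subr0 addrC.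
Qed.

(** It shows that the Blaschke factor rho (z - a) / (rho^2 - [cj a] z) is bounded by 1 in the disc
    of radius [rho] and unimodular on its boundary. *)
Lemma blaschke_id (rho : R) a z :
  nm (rc (rho ^+ 2) - cj a * z) ^+ 2 - nm (rc rho * (z - a)) ^+ 2
  = (rho ^+ 2 - nm z ^+ 2) * (rho ^+ 2 - nm a ^+ 2).
Proof.
rewrite !nm_sqr !(ReB, ImB, ReM, ImM, Re_cj, Im_cj, Re_rc, Im_rc).
ring.
Qed.

(* Each zero removed gains a factor at most [r / rho] in the bound for [nm (f 0)], so
   only finitely many can be removed. *)
Lemma blaschke r (rho : R) s f B : 0 < r -> r < rho -> rho < s -> hol s f -> f 0 != 0 ->
  (forall z, nm z = rho -> nm (f z) <= B) ->
  exists (b g : C -> C), [/\ hol rho b, hol s g,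
    forall z, nm z <= rho -> f z = b z * g z /\ nm (b z) <= 1,
    forall z, nm z = rho -> nm (b z) = 1 & forall z, nm z < r -> g z != 0].
Proof.
move=> r0 rrho rhos hf f0 hB; have rho0 : 0 < rho := lt_trans r0 rrho.
have q0 : 0 <= r / rho by rewrite divr_ge0 // ltW.
have q1 : r / rho < 1 by rewrite ltr_pdivrMr // mul1r.
have e0 : 0 < nm (f 0) / 2 by rewrite divr_gt0 // nm_gt0.
(* [N] bounds the number of zeros that can be removed: the inequality below contradicts the maximum
   principle when [N] is 0, and each removal lowers the exponent by one. *)
have [N hN] := expr_small B q0 q1 e0.
have {hN} : (r / rho) ^+ N * B < nm (f 0).
  by apply: le_lt_trans (hN N (leqnn N)) _; lra.
elim: N f hf f0 hB {e0} => [|N IH] f hf f0 hB hN.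
  exfalso; move: hN; rewrite expr0 mul1r ltNge => /negP; apply.
  by apply: (max_principle hf rhos _ hB); rewrite nm0.
have [h|] := pselect (forall z, nm z < r -> f z != 0).
  exists (fun=> 1), f; split=> //; first exact: hol_cst.
    by move=> z _; rewrite mul1r nm1.
  by move=> z _; rewrite nm1.
move=> /existsNP[a /not_implyP[ar /negP/negPn/eqP fa]].
have arho : nm a < rho := lt_trans ar rrho.
have a0 : a != 0 by apply: contraNneq f0 => E; move: fa; rewrite E => ->.
pose D z := rc (rho ^+ 2) - cj a * z.
have D0 z : nm z <= rho -> D z != 0.
  move=> zr; rewrite -nm_gt0 (lt_le_trans _ (nm_rtri _ _)) // nm_rc nmM nm_cj.
  rewrite ger0_norm ?sqr_ge0 // subr_gt0 expr2.
  apply: (@le_lt_trans _ _ (nm a * rho)); first by rewrite ler_wpM2l ?nm_ge0.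
  by rewrite ltr_pM2r.
have eD : entire D.
  by apply: entireB; [exact: entire_cst|apply: entireZ; exact: entire_id].
(* This is [f] divided by the Blaschke factor [ba], written without division by z - a. *)
pose g z := dq a f z * (D z * rc rho^-1).
have hg : hol s g.
  apply: holM; first by apply: hol_dq => //; exact: lt_trans rhos.
  by apply: holM; [exact: entire_hol|exact: hol_cst].
pose ba z := rc rho * (z - a) / D z.
have rrho0 : rc rho != 0 by rewrite rc_eq0 gt_eqF.
have Ef z : nm z <= rho -> f z = ba z * g z.
  move=> /D0 Dz; rewrite (dq_root z fa) /ba /g rcV; field.
  by rewrite Dz rrho0.
have ba1 z : nm z <= rho -> nm (ba z) <= 1.
  move=> zr; rewrite /ba nm_div ler_pdivrMr ?nm_gt0 ?D0 // mul1r.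
  rewrite -(@ler_pXn2r _ 2) ?nnegrE ?nm_ge0 // -subr_ge0 blaschke_id.
  have sq y : 0 <= y -> y <= rho -> 0 <= rho ^+ 2 - y ^+ 2.
    by move=> y0 yr; rewrite subr_ge0 lerXn2r ?nnegrE // ltW.
  by rewrite mulr_ge0 // sq ?nm_ge0 // ltW.
have ba2 z : nm z = rho -> nm (ba z) = 1.
  move=> zr; rewrite /ba nm_div; have Dz : D z != 0 by rewrite D0 ?zr.
  suff -> : nm (rc rho * (z - a)) = nm (D z) by rewrite divff // nm_eq0.
  apply/eqP; rewrite -(@eqrXn2 _ 2) ?nm_ge0 //.
  by rewrite eq_sym -subr_eq0 blaschke_id zr subrr mul0r.
have hba : hol rho ba.
  apply: holM; last by apply: holV => [z /ltW /D0 //|]; exact: entire_hol.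
  by apply: entire_hol; apply: entireZ; apply: entireB; [exact: entire_id|exact: entire_cst].
have g0 : g 0 != 0.
  by apply: contraNneq f0 => g0; rewrite Ef ?nm0 ?ltW // g0 mulr0.
have hBg z : nm z = rho -> nm (g z) <= B.
  move=> zr; apply: le_trans (hB z zr); rewrite (Ef z) ?zr //.
  by rewrite nmM ba2 // mul1r.
have hNg : (r / rho) ^+ N * B < nm (g 0).
  have B0 : 0 <= B by apply: le_trans (nm_ge0 _) (hB (circ rho 0) _); rewrite nm_circ ?ltW.
  have E : nm (f 0) * rho = nm a * nm (g 0).
    rewrite (Ef 0) ?nm0 ?ltW // nmM /ba /D mulr0 subr0 sub0r nm_div nmM nmN !nm_rc.
    rewrite !ger0_norm ?sqr_ge0 ?ltW //; field; exact: lt0r_neq0.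
  have h1 : nm a * nm (g 0) <= r * nm (g 0) by rewrite ler_wpM2r ?nm_ge0 // ltW.
  have h2 : (r / rho) ^+ N.+1 * B * rho < nm (f 0) * rho by rewrite ltr_pM2r.
  have h3 : (r / rho) ^+ N.+1 * B * rho = r * ((r / rho) ^+ N * B).
    by rewrite exprS; field; exact: lt0r_neq0.
  by rewrite -(ltr_pM2l r0) -h3; apply: lt_le_trans h2 _; rewrite E.
have [b [g' [hb hg' h1 h2 h3]]] := IH g hg g0 hBg hNg.
exists (fun z => ba z * b z), g'; split.
- exact: holM.
- exact: hg'.
- move=> z zr; have [E b1] := h1 z zr; split; first by rewrite (Ef z zr) E mulrA.
  by rewrite nmM -[1]mulr1 ler_pM ?nm_ge0 // ba1.
- by move=> z zr; rewrite nmM ba2 // h2 // mulr1.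
- exact: h3.
Qed.

End Entire.

(** * Exponents whose exponential takes a value rarely *)

Section ExponentBound.
Variable R : realType.
Local Notation C := (Cplx R).
Implicit Types (r s : R) (z w a b : C) (f g : C -> C).

Lemma le_of_eq (x y : R) : x = y -> x <= y.
Proof. by move=> ->. Qed.

Lemma Re_cexp_le z (K : R) : nm (cexp z) <= expR K -> ReC z <= K.
Proof. by rewrite nm_cexp ler_expR. Qed.

(** Zeros of [f] prevent dividing the bound for f g by f. Once they are moved into a Blaschke
    product, f = b u with u = e^p, the Borel-Caratheodory inequality bounds |u| from below, and the
    maximum principle bounds u g, as |b| = 1 on the outer circle. *)
Lemma quotient_bound r (rho : R) s f g (V A : R) z : 0 < r -> r < rho -> rho < s ->
  hol s f -> hol s g -> f 0 != 0 -> 0 < V -> 0 <= A ->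
  (forall w, nm w = rho -> nm (f w) <= V) ->
  (forall w, nm w = rho -> nm (f w * g w) <= A) -> nm z < r ->
  nm (g z) <= A / nm (f 0) * expR (2 * (ln V - ln (nm (f 0))) * r / (r - nm z)).
Proof.
move=> r0 rrho rhos hf hg f0 V0 A0 hV hA zr.
have rho0 := lt_trans r0 rrho.
have [b [u [hb hu h1 h2 h3]]] := blaschke r0 rrho rhos hf f0 hV.
have hur : hol r u := holW (ltW (lt_trans rrho rhos)) hu.
have n0 : nm (0 : C) <= rho by rewrite nm0 ltW.
have [p hp Ep] := log_exists r0 hur h3.
have uV w : nm w <= rho -> nm (u w) <= V.
  move=> wr; apply: (max_disc hu rhos wr) => x xr.
  by have [E _] := h1 x (le_of_eq xr); have := hV x xr; rewrite E nmM h2 // mul1r.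
have ugA w : nm w <= rho -> nm (u w * g w) <= A.
  move=> wr; apply: (max_disc (holM hu hg) rhos wr) => x xr.
  by have [E _] := h1 x (le_of_eq xr); have := hA x xr; rewrite E -mulrA nmM h2 // mul1r.
have f0u : nm (f 0) <= nm (u 0).
  have [-> b1] := h1 0 n0; rewrite nmM -[leRHS]mul1r.
  by apply: ler_wpM2r b1; exact: nm_ge0.
have F0 : 0 < nm (f 0) by rewrite nm_gt0.
have Rp w : nm w < r -> ReC (p w) <= ln V.
  move=> wr; apply: Re_cexp_le; rewrite -Ep // lnK ?posrE //.
  by apply: uV; apply: ltW; exact: lt_trans rrho.
have Rp0 : ln (nm (f 0)) <= ReC (p 0).
  rewrite -ler_expR lnK ?posrE // -nm_cexp -Ep ?nm0 //.
have BC := borel_caratheodory hp Rp zr.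
set T := _ * r / _.
have T1 : nm (p z - p 0) <= T.
  rewrite /T ler_pdivlMr ?subr_gt0 //; apply: le_trans BC _.
  have K0 : ReC (p 0) <= ln V by apply: Rp; rewrite nm0.
  apply: ler_pM; rewrite ?nm_ge0 ?mulr_ge0 ?subr_ge0 //; last exact: ltW.
  by rewrite ler_pM2l //; lra.
have uz : nm (f 0) * expR (- T) <= nm (u z).
  rewrite Ep // nm_cexp -[X in X * _]lnK ?posrE // -expRD ler_expR.
  have := Re_le_nm (p z - p 0); rewrite ReB ler_norml => /andP[]; lra.
have zrho : nm z <= rho by apply: ltW; exact: lt_trans rrho.
have := ugA z zrho; rewrite nmM => h.
have {h uz}h : nm (f 0) * expR (- T) * nm (g z) <= A.
  by apply: le_trans h; rewrite ler_wpM2r ?nm_ge0.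
rewrite expRN in h; have e0 := expR_gt0 T.
rewrite -(ler_pM2l (_ : 0 < nm (f 0) * (expR T)^-1)); last first.
  by rewrite mulr_gt0 ?invr_gt0.
rewrite (_ : _ * (A / nm (f 0) * expR T) = A) //; field.
by rewrite !gt_eqF.
Qed.

(* A zero of [e^h + d] of multiplicity [m] is a zero of [h'] of multiplicity
   [m - 1], so that a single zero of [S] is enough for divisibility. *)
Lemma exp_divides (h S : C -> C) (d : C) z0 : entire h -> entire S -> d != 0 ->
  cexp (h z0) + d != 0 -> (forall z, cexp (h z) + d = 0 -> S z = 0) ->
  exists2 W, entire W & forall z, S z * derive1 h z = W z * (cexp (h z) + d).
Proof.
move=> eh eS d0 X0 hS.
have eX : entire (fun z => cexp (h z) + d).
  by apply: entireD; [exact: entire_cexp|exact: entire_cst].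
have eh' := entire_derive eh.
apply: (entire_quotient (entireM eS eh') eX X0) => a Xa.
have [m [Y eY [Ya E]]] := @order_at _ _ _ a eX X0.
case: m E => [|m] E.
  by move: Ya; rewrite -[Y a]mul1r -(expr0 (a - a)) -E Xa eqxx.
exists m.+1, Y, (fun w => dq a S w * (((m.+1)%:R * Y w + (w - a) * derive1 Y w) * cexp (- h w))).
have esub : entire (fun w : C => w - a) by apply: entireB; [exact: entire_id|exact: entire_cst].
split.
- exact: eY.
- apply: entireM; first exact: entire_dq.
  apply: entireM; last by apply: entire_cexp; exact: entireN.
  apply: entireD; first exact: entireZ.
  by apply: entireM; [exact: esub|exact: entire_derive].
- exact: Ya.
- exact: E.
move=> w; rewrite (dq_root w (hS a Xa)).
(* Both sides are the derivative of e^h + d = (w - a)^(m+1) Y. *)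
suff D : derive1 h w * cexp (h w) = (w - a) ^+ m * ((m.+1)%:R * Y w + (w - a) * derive1 Y w).
  have -> : derive1 h w = derive1 h w * cexp (h w) * cexp (- h w).
    by rewrite cexpN mulfK // cexp_neq0.
  by rewrite D exprS; ring.
have c1 : cder (fun w => cexp (h w) + d) w (cexp (h w) * derive1 h w + 0).
  apply: cderD (cder_cst d w).
  by apply: cder_comp (entire_cder eh w) _; exact: cder_cexp.
have csub : cder (fun w : C => w - a) w (1 - 0) := cderB (cder_id w) (cder_cst a w).
have c2 := cder_ext (fun w => esym (E w)) (cderM (cderX m.+1 csub) (entire_cder eY w)).
have := cder_derive1 c1; rewrite (cder_derive1 c2) /= => F.
by rewrite mulrC -[LHS]addr0 -F exprS; ring.
Qed.

Lemma expR1_le4 : expR 1 <= 4 :> R.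
Proof.
have a := expR_ge1Dx (- (1 / 2) : R); have b := expR_gt0 (1 : R).
have : expR 1 * (expR (- (1 / 2)) * expR (- (1 / 2))) = 1 :> R.
  by rewrite -!expRD (_ : 1 + _ = 0) ?expR0 //; lra.
have : 1 / 2 * (1 / 2) <= expR (- (1 / 2)) * expR (- (1 / 2)) :> R.
  by apply: ler_pM; lra.
by nra.
Qed.

(** The threshold 20 exceeds e, whence ln Q >= 1, and later allows numerical factors to be absorbed
    into one more power of [Q]. *)
Lemma ge_expl (Q l : R) : 20 <= Q -> l = ln Q -> [/\ 0 < Q, expR l = Q, 1 <= l & l <= Q].
Proof.
move=> Q20 lE; have Q0 : 0 < Q by lra.
have eQ : expR l = Q by rewrite lE lnK ?posrE.
split=> //; last by rewrite -eQ; have := expR_ge1Dx l; lra.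
by rewrite -ler_expR eQ; apply: le_trans Q20; have := expR1_le4; lra.
Qed.

Lemma inv_le1 (Q x : R) : 0 < x -> x^-1 <= Q -> 1 <= Q * x.
Proof. by move=> x0 xq; rewrite -ler_pdivrMr // div1r. Qed.

(** With the ratio of the radius to the gap [dl] bounded by [psi], each use of the inequality costs
    one factor [psi]. *)
Lemma borel_caratheodory_gap (p : C -> C) (x y dl A P psi : R) : 0 < dl -> 0 < x -> y = x + dl ->
  x <= psi * dl -> hol y p -> (forall w, nm w < y -> ReC (p w) <= A) ->
  A - ReC (p 0) <= P ->
  forall z, nm z <= x -> nm (p z - p 0) <= 2 * P * psi.
Proof.
move=> dl0 x0 yE xpsi hp hA hP z zx.
have zy : nm z < y by lra.
have A0 : ReC (p 0) <= A by apply: hA; rewrite nm0; lra.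
have BC := borel_caratheodory hp hA zy.
rewrite -(ler_pM2r dl0).
have h1 : nm (p z - p 0) * dl <= nm (p z - p 0) * (y - nm z).
  by apply: ler_wpM2l; [exact: nm_ge0|lra].
have h2 : 2 * (A - ReC (p 0)) * nm z <= 2 * P * (psi * dl).
  by apply: ler_pM; rewrite ?nm_ge0 //; lra.
by rewrite -[leRHS]mulrA; lra.
Qed.

(** Here the zeros of e^h + d are shown to be rare. With S h' = W (e^h + d) and e^h + d = b g, the
    product W g is at most 2 Q^3, hence |b(0)| >= Q^-6: the Blaschke product of the zeros is not
    small at 0. This gives the upper bound 7 l = 6 l + l for Re q(0); the lower one comes from
    |b(0)| <= 1. *)
Lemma exp_add_factor (h S : C -> C) (d : C) r6 r7 r8 (Q l : R) :
  entire h -> entire S -> d != 0 ->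
  (forall z, cexp (h z) + d = 0 -> S z = 0) ->
  0 < r6 -> r6 < r7 -> r7 < r8 -> 20 <= Q -> l = ln Q ->
  (forall z, nm z <= r7 -> nm (h z) <= Q) ->
  (forall z, nm z <= r7 -> nm (S z * derive1 h z) <= 2 * Q ^+ 3) ->
  nm d <= Q -> S 0 != 0 -> (nm (S 0))^-1 <= Q ->
  derive1 h 0 != 0 -> (nm (derive1 h 0))^-1 <= Q ->
  nm (cexp (h 0) + d) <= Q -> (nm (cexp (h 0) + d))^-1 <= Q ->
  exists (b q : C -> C), [/\ hol r7 b, hol r6 q,
    forall z, nm z < r6 -> cexp (h z) + d = b z * cexp (q z),
    forall z, nm z <= r7 -> nm (b z) <= 1 &
    (forall z, nm z < r6 -> ReC (q z) <= 2 * Q) /\ - l <= ReC (q 0) <= 7 * l].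
Proof.
move=> eh eS d0 hS r60 r67 r78 Q20 lE hM S1b dQ S0 SVQ H0 HVQ XQ XVQ.
have [Q0 eQ l1 lQ] := ge_expl Q20 lE.
have X0 : cexp (h 0) + d != 0 by apply: contraNneq S0 => /hS ->.
pose X z := cexp (h z) + d.
have eX : entire X by apply: entireD; [exact: entire_cexp|exact: entire_cst].
have [W eW EW] := exp_divides eh eS d0 X0 hS.
have Xb z : nm z = r7 -> nm (X z) <= expR (2 * Q).
  move=> zr; apply: le_trans (nmD _ _) _; rewrite nm_cexp.
  have := hM z (le_of_eq zr); have := Re_le_nm (h z); have := ler_norm (ReC (h z)) => a1 a2 a3.
  have t1 : expR (ReC (h z)) <= expR Q by rewrite ler_expR; lra.
  have t2 := expR_ge1Dx Q; rewrite mulr2n mulrDl mul1r expRD.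
  have t3 : 2 * expR Q <= expR Q * expR Q by apply: ler_wpM2r; lra.
  by move: t1 t2 t3 dQ; clear; lra.
have [b [g [hb hg bg b1 g0]]] := blaschke r60 r67 r78 (entire_hol (r := r8) eX) X0 Xb.
have n06 : nm (0 : C) < r6 by rewrite nm0.
have n07 : nm (0 : C) < r7 := lt_trans n06 r67.
have gb z : nm z <= r7 -> nm (g z) <= expR (2 * Q).
  move=> zr; apply: (max_disc hg r78 zr) => w wr.
  by have [E _] := bg w (le_of_eq wr); have := Xb w wr; rewrite E nmM b1 // mul1r.
have Wgb : nm (W 0 * g 0) <= 2 * Q ^+ 3.
  apply: (max_principle (holM (entire_hol (r := r8) eW) hg) r78 n07).
  move=> w wr; have [E _] := bg w (le_of_eq wr).
  by have := S1b w (le_of_eq wr); rewrite EW -/(X w) E !nmM b1 // mul1r.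
have [E0 b01] := bg 0 (ltW n07).
have b0 : 1 <= nm (b 0) * Q ^+ 6.
  have E : nm (S 0) * nm (derive1 h 0) = nm (b 0) * nm (W 0 * g 0).
    by rewrite -nmM EW -/(X 0) E0 !nmM; ring.
  have s1 := inv_le1 (etrans (nm_gt0 _) S0) SVQ.
  have s2 := inv_le1 (etrans (nm_gt0 _) H0) HVQ.
  have : 1 * 1 <= (Q * nm (S 0)) * (Q * nm (derive1 h 0)) by apply: ler_pM.
  rewrite mul1r (_ : _ * _ = Q ^+ 2 * (nm (S 0) * nm (derive1 h 0))); last by ring.
  rewrite E => s3; apply: le_trans s3 _.
  rewrite (_ : Q ^+ 2 * _ = nm (b 0) * (Q ^+ 2 * nm (W 0 * g 0))); last by ring.
  apply: ler_wpM2l; first exact: nm_ge0.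
  apply: (@le_trans _ _ (Q ^+ 2 * (2 * Q ^+ 3))); first by rewrite ler_pM2l // exprn_gt0.
  rewrite (_ : Q ^+ 6 = Q ^+ 5 * Q); last by ring.
  rewrite (_ : Q ^+ 2 * _ = Q ^+ 5 * 2); last by ring.
  by rewrite ler_pM2l ?exprn_gt0 //; move: Q20; clear; lra.
have [q hq Eq] := log_exists r60 (holW (ltW (lt_trans r67 r78)) hg) g0.
exists b, q; split.
- exact: hb.
- exact: hq.
- by move=> z zr; rewrite -Eq //; have [] := bg z (ltW (lt_trans zr r67)).
- by move=> z /bg[].
split=> [w wr|].
  by apply: Re_cexp_le; rewrite -Eq //; apply: gb; apply: ltW; exact: lt_trans r67.
apply/andP; split.
  rewrite -ler_expR -nm_cexp -Eq // expRN eQ.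
  have s1 := inv_le1 (etrans (nm_gt0 _) X0) XVQ.
  rewrite -ler_pdivrMl // mulr1 in s1.
  apply: le_trans s1 _; rewrite -/(X 0) E0 nmM -[leRHS]mul1r.
  by apply: ler_wpM2r => //; exact: nm_ge0.
rewrite -ler_expR -nm_cexp -Eq // (_ : expR (7 * l) = Q ^+ 7); last first.
  by rewrite expRM_natl eQ.
rewrite -[leLHS]mulr1; apply: (@le_trans _ _ (nm (g 0) * (nm (b 0) * Q ^+ 6))).
  by apply: ler_wpM2l => //; exact: nm_ge0.
rewrite (_ : _ * _ = nm (X 0) * Q ^+ 6); last by rewrite E0 nmM; ring.
by rewrite [Q ^+ 7]exprS; apply: ler_wpM2r => //; apply: exprn_ge0; exact: ltW.
Qed.

(** Put E = e^(h - q). Differentiating e^h + d = b e^q gives h' E = b' + b q', which is bounded by a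
    power of [Q]; dividing by h' bounds Re (h - q) by a multiple of psi l, where l = ln Q. Then d
    e^(-q) = b - E gives the same for Re (- q). *)
Lemma exp_add_factor_bound (h b q : C -> C) (d : C) r2 r3 r4 r5 r6 r7 (dl Q psi l : R) :
  entire h -> d != 0 -> 0 < dl -> 0 < r2 -> r3 = r2 + dl -> r4 = r3 + dl -> r5 = r4 + dl ->
  r6 = r5 + dl -> r7 = r6 + dl -> r5 <= psi * dl -> 20 <= Q -> l = ln Q ->
  (forall z, nm z <= r7 -> nm (derive1 h z) <= 2 * Q ^+ 2) ->
  dl^-1 <= Q -> 1 <= psi -> psi <= Q -> (nm d)^-1 <= Q ->
  derive1 h 0 != 0 -> (nm (derive1 h 0))^-1 <= Q ->
  hol r7 b -> hol r6 q ->
  (forall z, nm z < r6 -> cexp (h z) + d = b z * cexp (q z)) ->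
  (forall z, nm z <= r7 -> nm (b z) <= 1) ->
  (forall z, nm z < r6 -> ReC (q z) <= 2 * Q) -> - l <= ReC (q 0) ->
  forall z, nm z <= r2 -> ReC (h z - q z) <= 13 * (psi * l) /\
    ReC (- q z) <= 15 * (psi * l).
Proof.
move=> eh d0 dl0 r20 E3 E4 E5 E6 E7 r5psi Q20 lE h'b dlQ psi1 psiQ dVQ H0 HVQ hb hq Xq bz Rq Rq0l.
have [r3p r34 r45 r56 r67] : [/\ 0 < r3, r3 < r4, r4 < r5, r5 < r6 & r6 < r7].
  by split; lra.
have r3r5 : r3 <= r5 by lra.
have [r46 r57] := (lt_trans r45 r56, lt_trans r56 r67).
have r47 := lt_trans r46 r67; have r5p : 0 < r5 by lra.
have gap2 z : nm z <= r2 -> dl <= r3 - nm z by lra.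
have gap4 z : nm z <= r4 -> dl <= r5 - nm z by lra.
have lt2 z : nm z <= r2 -> nm z < r3 by lra.
move: E3 E4 E5 E6 E7 => _ _ _ E6 _.
have [Q0 eQ l1 lQ] := ge_expl Q20 lE.
have Q1 : 1 <= Q := le_trans l1 lQ.
have psil : l <= psi * l by rewrite -[leLHS]mul1r; apply: ler_wpM2r => //; exact: le_trans l1.
have qb z : nm z <= r5 -> nm (q z - q 0) <= 6 * Q ^+ 2.
  move=> zr; apply: (@le_trans _ _ (2 * (3 * Q) * psi)).
    apply: (borel_caratheodory_gap dl0 r5p E6 r5psi hq Rq _ zr).
    by move: Rq0l lQ; clear; lra.
  rewrite (_ : 6 * Q ^+ 2 = 2 * (3 * Q) * Q); last by ring.
  by apply: ler_wpM2l => //; rewrite !mulr_ge0 // ltW.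
have inv_gap z : nm z <= r4 -> (r5 - nm z)^-1 <= Q.
  move=> zr; apply: le_trans dlQ; rewrite lef_pV2 ?posrE //; first exact: gap4.
  exact: lt_le_trans (gap4 z zr).
have q'b z : nm z <= r4 -> nm (derive1 q z) <= 12 * Q ^+ 3.
  move=> zr; have zr5 := le_lt_trans zr r45.
  have hq0 : hol r6 (fun z => q z - q 0) := holB hq (hol_cst (q 0)).
  have zr6 := lt_trans zr5 r56.
  have <- : derive1 (fun z => q z - q 0) z = derive1 q z.
    by apply: cder_derive1; apply: cder_eq (cderB (hq z zr6) (cder_cst (q 0) z)) _; rewrite subr0.
  apply: le_trans (cauchy_estimate hq0 r56 zr5 qb) _.
  rewrite (_ : 12 * Q ^+ 3 = 2 * (6 * Q ^+ 2) * Q); last by ring.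
  by apply: ler_wpM2l; [rewrite !mulr_ge0 // ltW|exact: inv_gap].
have b'b z : nm z <= r4 -> nm (derive1 b z) <= 2 * Q.
  move=> zr; have zr5 := le_lt_trans zr r45.
  have hb1 w : nm w <= r5 -> nm (b w) <= 1.
    by move=> wr; apply: bz; apply: le_trans wr _; exact: ltW.
  apply: le_trans (cauchy_estimate hb r57 zr5 hb1) _.
  by rewrite mulr1; apply: ler_wpM2l => //; exact: inv_gap.
pose E z := cexp (h z - q z).
have hE : hol r6 E := hol_cexp (holB (entire_hol eh) hq).
have hb6 : hol r6 b := holW (ltW r67) hb.
have Eder z : nm z < r6 -> derive1 h z * E z = derive1 b z + b z * derive1 q z.
  move=> zr; pose X z := cexp (h z) + d.
  have c1 : cder X z (cexp (h z) * derive1 h z + 0).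
    apply: cderD (cder_cst d z).
    by apply: cder_comp (entire_cder eh z) _; exact: cder_cexp.
  have c2 := cderM (hb6 z zr) (cder_comp (hq z zr) (cder_cexp (q z))).
  have c3 : cder X z (derive1 b z * cexp (q z) + b z * (cexp (q z) * derive1 q z)).
    apply: (@cder_local _ _ _ _ _ (r6 - nm z) _ _ c2); first by rewrite subr_gt0.
    by move=> w /disc_open wr; rewrite /X Xq.
  have := cder_derive1 c1; rewrite (cder_derive1 c3) addr0 => F.
  rewrite /E cexpB mulrA [derive1 h z * _]mulrC -F.
  have := cexp_neq0 (q z); move: (cexp (q z)) (derive1 b z) (derive1 q z) (b z) => u v w t u0.
  by field.
have Yb z : nm z = r4 -> nm (derive1 h z * E z) <= Q ^+ 4.
  move=> zr; rewrite Eder ?zr //.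
  apply: le_trans (nmD _ _) _; rewrite nmM.
  have b1z : nm (b z) <= 1 by apply: bz; rewrite zr ltW.
  have zr4 := le_of_eq zr.
  have t1 : nm (b z) * nm (derive1 q z) <= 1 * (12 * Q ^+ 3).
    by apply: ler_pM; rewrite ?nm_ge0 //; exact: q'b.
  have t2 := b'b z zr4.
  have t3 : 20 * Q ^+ 3 <= Q ^+ 4 by rewrite [Q ^+ 4]exprS ler_pM2r // exprn_gt0.
  have t4 : Q * 1 <= Q * Q ^+ 2 by apply: ler_wpM2l; [exact: ltW|exact: exprn_ege1].
  apply: le_trans (lerD t2 t1) _.
  have t5 : 0 <= Q ^+ 3 by rewrite exprn_ge0 // ltW.
  by move: t3 t4 t5; rewrite -[Q * Q ^+ 2]exprS; clear; lra.
have V0 : 0 < 2 * Q ^+ 2 by rewrite mulr_gt0 // exprn_gt0.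
have A0 : 0 <= Q ^+ 4 by rewrite exprn_ge0 // ltW.
have H00 : 0 < nm (derive1 h 0) by rewrite nm_gt0.
have lH : - ln (nm (derive1 h 0)) <= l.
  by rewrite -lnV ?posrE // lE ler_ln ?posrE // invr_gt0.
have lV : ln (2 * Q ^+ 2) <= 3 * l.
  rewrite lE [3 * _]mulr_natl -lnXn // ler_ln ?posrE ?exprn_gt0 //.
  by rewrite [Q ^+ 3]exprS ler_pM2r ?exprn_gt0 //; move: Q20; clear; lra.
have eQn n : expR (n%:R * l) = Q ^+ n by rewrite expRM_natl eQ.
(* 13 = 5 + 2 (3 + 1): Q^5 bounds Q^4 / |h'(0)|, while 3 l and l bound ln (2 Q^2) and - ln
   |h'(0)|. *)
have Eb z : nm z <= r2 -> ReC (h z - q z) <= 13 * (psi * l).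
  move=> zr; apply: Re_cexp_le; rewrite -/(E z).
  have H := @quotient_bound r3 r4 r6 (derive1 h) E _ _ z r3p r34 r46
    (entire_hol (entire_derive eh)) hE H0 V0 A0
    (fun w wr => h'b w (ltW (le_lt_trans (le_of_eq wr) r47))) Yb (lt2 z zr).
  apply: le_trans H _.
  apply: (@le_trans _ _ (expR (5%:R * l) * expR (8 * (psi * l)))); last first.
    by rewrite -expRD ler_expR; move: psil; clear; lra.
  apply: ler_pM; rewrite ?expR_ge0 ?divr_ge0 ?nm_ge0 //.
    by rewrite eQn [Q ^+ 5]exprSr; apply: ler_wpM2l.
  rewrite ler_expR -mulrA.
  have g0 := lt_le_trans dl0 (gap2 z zr).
  have q1 : 0 <= r3 / (r3 - nm z) by apply: divr_ge0; exact: ltW.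
  have q2 : r3 / (r3 - nm z) <= psi.
    rewrite ler_pdivrMr //; apply: le_trans r3r5 _; apply: le_trans r5psi _.
    by apply: ler_wpM2l; [exact: le_trans psi1|exact: gap2].
  rewrite (_ : 8 * (psi * l) = 8 * l * psi); last by ring.
  apply: (@le_trans _ _ (8 * l * (r3 / (r3 - nm z)))).
    by apply: ler_wpM2r => //; move: lH lV; clear; lra.
  by apply: ler_wpM2l => //; move: l1; clear; lra.
move=> z zr; split; first exact: Eb.
have zr6 : nm z < r6 := lt_trans (lt_trans (lt2 z zr) r34) r46.
apply: Re_cexp_le.
have := Eb z zr; rewrite -ler_expR -nm_cexp -/(E z) => EE.
have D : d * cexp (- q z) = b z - E z.
  rewrite cexpN /E cexpB (_ : d = b z * cexp (q z) - cexp (h z)); last by rewrite -(Xq z zr6); ring.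
  by field; exact: cexp_neq0.
have b1z : nm (b z) <= 1 by apply: bz; apply: ltW; exact: lt_trans r67.
have e1 : 1 <= expR (13 * (psi * l)) by apply: le_trans (expR_ge1Dx _); move: psil l1; clear; lra.
have t1 : nm d * nm (cexp (- q z)) <= 2 * expR (13 * (psi * l)).
  by rewrite -nmM D; apply: le_trans (nmB _ _) _; move: b1z e1 EE; clear; lra.
have d1 := inv_le1 (etrans (nm_gt0 _) d0) dVQ.
apply: (@le_trans _ _ (Q * (2 * expR (13 * (psi * l))))).
  apply: (@le_trans _ _ (Q * (nm d * nm (cexp (- q z))))); last by rewrite ler_pM2l.
  by rewrite mulrA -[leLHS]mul1r; apply: ler_wpM2r => //; exact: nm_ge0.
apply: (@le_trans _ _ (expR (2%:R * l) * expR (13 * (psi * l)))).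
  rewrite eQn mulrA; apply: ler_wpM2r; first exact: expR_ge0.
  by rewrite expr2 ler_pM2l //; move: Q20; clear; lra.
by rewrite -expRD ler_expR; move: psil; clear; lra.
Qed.

(* [Q] bounds the data on a larger disc; the conclusion replaces it by its
   logarithm. *)
Lemma exponent_bound (h S : C -> C) (d : C) r (dl Q psi l : R) :
  entire h -> entire S -> d != 0 ->
  (forall z, cexp (h z) + d = 0 -> S z = 0) ->
  0 < r -> 0 < dl -> psi = (r + 8 * dl) / dl -> 20 <= Q -> l = ln Q ->
  (forall z, nm z <= r + 8 * dl -> nm (h z) <= Q) ->
  (forall z, nm z <= r + 8 * dl -> nm (S z) <= Q) ->
  dl^-1 <= Q -> psi <= Q -> nm d <= Q -> (nm d)^-1 <= Q ->
  S 0 != 0 -> (nm (S 0))^-1 <= Q ->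
  derive1 h 0 != 0 -> (nm (derive1 h 0))^-1 <= Q ->
  nm (cexp (h 0) + d) <= Q -> (nm (cexp (h 0) + d))^-1 <= Q ->
  nm (h 0) <= l ->
  forall z, nm z <= r -> nm (h z) <= 131 * psi ^+ 3 * l.
Proof.
move=> eh eS d0 hS r0 dl0 psiE Q20 lE hM hA dlQ psiQ dQ dVQ S0 SVQ H0 HVQ XQ XVQ h0l.
have psiD : psi * dl = r + 8 * dl by rewrite psiE divfK // gt_eqF.
have psi1 : 1 <= psi by rewrite psiE ler_pdivlMr // mul1r; move: r0 dl0; clear; lra.
move: psiE => _.
(* The estimates use up the gaps between these radii one after the other, from [r8], where the data
   are bounded, down to [r]. *)
have [r1 E1] : exists x, x = r + dl by eexists.
have [r2 E2] : exists x, x = r1 + dl by eexists.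
have [r3 E3] : exists x, x = r2 + dl by eexists.
have [r4 E4] : exists x, x = r3 + dl by eexists.
have [r5 E5] : exists x, x = r4 + dl by eexists.
have [r6 E6] : exists x, x = r5 + dl by eexists.
have [r7 E7] : exists x, x = r6 + dl by eexists.
have [r8 E8] : exists x, x = r7 + dl by eexists.
have R8 : r + 8 * dl = r8 by move: E1 E2 E3 E4 E5 E6 E7 E8; clear; lra.
rewrite R8 in hM hA psiD.
have [[r1p r2p r6p] [[r25 r26 r67 r78] [rp r1psi r5psi]]] :
    [/\ 0 < r1, 0 < r2 & 0 < r6] /\ [/\ r2 < r5, r2 < r6, r6 < r7 & r7 < r8]
      /\ [/\ r <= psi * dl, r1 <= psi * dl & r5 <= psi * dl].
  by move: r0 dl0 E1 E2 E3 E4 E5 E6 E7 E8; rewrite psiD; clear; split; [|split]; split; lra.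
have gap7 z : nm z <= r7 -> dl <= r8 - nm z by move: E8; clear; lra.
have [Q0 eQ l1 lQ] := ge_expl Q20 lE.
have psil : l <= psi * l by rewrite -[leLHS]mul1r; apply: ler_wpM2r => //; exact: le_trans l1.
have p0 : 0 <= psi * l by apply: le_trans psil; exact: le_trans l1.
have psi2l : psi * l <= psi ^+ 2 * l.
  by rewrite expr2 -mulrA -[leLHS]mul1r; apply: ler_wpM2r.
have psi3l : psi ^+ 2 * l <= psi ^+ 3 * l.
  rewrite exprS -[leRHS]mulrA -[leLHS]mul1r; apply: ler_wpM2r => //.
  exact: le_trans psi2l.
have h'b z : nm z <= r7 -> nm (derive1 h z) <= 2 * Q ^+ 2.
  move=> zr; apply: (@le_trans _ _ (2 * Q / (r8 - nm z))).
    apply: (@cauchy_estimate R r8 (r8 + 1)) => //; first exact: entire_hol.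
      by rewrite ltrDl.
    exact: le_lt_trans zr r78.
  rewrite expr2 mulrA; apply: ler_wpM2l; first by rewrite mulr_ge0 // ltW.
  apply: le_trans dlQ; rewrite lef_pV2 ?posrE //; first exact: gap7.
  exact: lt_le_trans (gap7 z zr).
have le78 z : nm z <= r7 -> nm z <= r8 by move=> zr; apply: le_trans zr _; exact: ltW.
have S1b z : nm z <= r7 -> nm (S z * derive1 h z) <= 2 * Q ^+ 3.
  move=> zr; rewrite nmM (_ : 2 * Q ^+ 3 = Q * (2 * Q ^+ 2)); last by ring.
  by apply: ler_pM; rewrite ?nm_ge0 //; [apply: hA; exact: le78|exact: h'b].
have [b [q [hb hq Xq bz [Rq /andP[Rq0l Rq0u]]]]] :=
  exp_add_factor eh eS d0 hS r6p r67 r78 Q20 lE (fun z zr => hM z (le78 z zr)) S1b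
    dQ S0 SVQ H0 HVQ XQ XVQ.
have B := exp_add_factor_bound eh d0 dl0 r2p E3 E4 E5 E6 E7 r5psi Q20 lE h'b dlQ psi1 psiQ dVQ
  H0 HVQ hb hq Xq bz Rq Rq0l.
(* Borel-Caratheodory for - q turns its upper bound into one for Re q: 22 = 15 + 7 takes the value
   at 0 into account, and 51 = 2 * 22 + 7. Adding 13 gives 64 for Re h. *)
have qu z : nm z <= r1 -> ReC (q z) <= 51 * (psi ^+ 2 * l).
  move=> zr.
  have hmq : hol r2 (fun z => - q z) by apply: holN; apply: holW hq; exact: ltW.
  have H := @borel_caratheodory_gap (fun z => - q z) r1 r2 dl (15 * (psi * l)) (22 * (psi * l)) psi
    dl0 r1p E2 r1psi hmq (fun w wr => (B w (ltW wr)).2) _ z zr.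
  have {}H := H ltac:(rewrite ReN; move: Rq0u psil; clear; lra).
  have := Re_le_nm (- q z - - q 0); rewrite ReB !ReN ler_norml => /andP[H' _].
  move: H; rewrite (_ : 2 * (22 * (psi * l)) * psi = 44 * (psi ^+ 2 * l)); last by ring.
  by move: H' Rq0u psil psi2l; clear; lra.
have r12 : r1 < r2 by rewrite E2 ltrDl.
have Rh z : nm z < r1 -> ReC (h z) <= 64 * (psi ^+ 2 * l).
  move=> zr; have [] := B z (ltW (lt_trans zr r12)); rewrite ReB.
  by have := qu z (ltW zr); move: psi2l; clear; lra.
move=> z zr.
have Re0 : - l <= ReC (h 0).
  by have := Re_le_nm (h 0); rewrite ler_norml => /andP[]; move: h0l; clear; lra.
(* 131 = 2 (64 + 1) + 1, where both units come from the bound [l] for h(0). *)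
have := borel_caratheodory_gap (P := 65 * (psi ^+ 2 * l)) dl0 r0 E1 rp (entire_hol eh) Rh _ zr.
move=> /(_ ltac:(move: Re0 psil psi2l; clear; lra)).
rewrite (_ : 2 * (65 * (psi ^+ 2 * l)) * psi = 130 * (psi ^+ 3 * l)); last by ring.
have := nmD (h z - h 0) (h 0); rewrite subrK => H2 H3.
by rewrite -mulrA; move: H2 H3 h0l psil psi2l psi3l; clear; lra.
Qed.

End ExponentBound.

(** * Small functions with respect to two exponentials *)

Section Growth.
Variable R : realType.
Local Notation C := (Cplx R).
Implicit Types (r s : R) (z w a b : C) (f g : C -> C).

Lemma ln_le_id (x : R) : 0 < x -> ln x <= x.
Proof. by move=> x0; rewrite -ler_expR lnK ?posrE //; have := expR_ge1Dx x; lra. Qed.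

(* The constants 16 = 2^4 and 32 come from radii r0 (2 - 2^-k), whose gaps halve, in
   the recursion of [no_slow_growth]. *)
Lemma growth_step (K : R) : 1 <= K -> exists2 B0 : R, 1 <= B0 &
  forall k, K * 16 ^+ k * (1 + ln (B0 * 32 ^+ k.+1)) <= B0 * 32 ^+ k.
Proof.
move=> K1; exists ((20 * K) ^+ 2); first by apply: exprn_ege1; lra.
move=> k; have K20 : 0 < 20 * K by lra.
have p16 : 0 < (16 : R) ^+ k by rewrite exprn_gt0.
have p32 : 0 < (32 : R) ^+ k.+1 by rewrite exprn_gt0.
rewrite lnM ?posrE ?exprn_gt0 // !lnXn //.
have l1 : ln (20 * K) <= 20 * K := ln_le_id K20.
have l2 : ln (32 : R) <= 32 by apply: ln_le_id.
have k2 : k.+1%:R <= (2 : R) ^+ k by rewrite -natrX ler_nat ltn_expl.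
have k1 : 1 <= (2 : R) ^+ k by apply: le_trans k2; rewrite ler1n.
have E : (32 : R) ^+ k = 16 ^+ k * 2 ^+ k by rewrite -exprMn; congr (_ ^+ _); ring.
rewrite E mulrCA -mulrA [K * _]mulrC -!mulrA ler_pM2l //.
have l3 : ln (32 : R) *+ k.+1 <= 32 * 2 ^+ k.
  rewrite -[_ *+ k.+1]mulr_natr; apply: ler_pM => //.
  by rewrite ln_ge0 // ler1n.
rewrite [ln (20 * K) *+ 2]mulr2n.
have l4 : 40 * K <= 40 * K * 2 ^+ k by rewrite -[leLHS]mulr1; apply: ler_wpM2l; lra.
have : (1 + (ln (20 * K) + ln (20 * K) + ln (32 : R) *+ k.+1)) * K
    <= (73 * K * 2 ^+ k) * K.
  apply: ler_wpM2r; first lra.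
  have : 2 ^+ k <= K * 2 ^+ k by rewrite -[leLHS]mul1r; apply: ler_wpM2r; lra.
  lra.
move=> h; apply: le_trans h _.
rewrite (_ : 73 * K * 2 ^+ k * K = 73 * (K ^+ 2 * 2 ^+ k)); last by ring.
rewrite [leRHS](_ : _ = 400 * (K ^+ 2 * 2 ^+ k)); last by ring.
by apply: ler_wpM2r; [rewrite mulr_ge0 ?exprn_ge0 //; lra|lra].
Qed.

(* Iterating the hypothesis backwards over radii increasing to [2 * r], a bound
   failing at [r] fails at all of them for bounds growing geometrically. *)
Lemma no_slow_growth (P : R -> R -> Prop) (K : R) : 1 <= K ->
  (forall r dl B, 1 <= r -> 0 < dl -> 1 <= B -> P (r + 9 * dl) B ->
     P r (K * ((r + 9 * dl) / dl) ^+ 4 * (1 + ln B))) ->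
  (forall r r' B B', P r B -> r' <= r -> B <= B' -> P r' B') ->
  (forall r, exists B, P r B) -> exists B, forall r, P r B.
Proof.
(* At the k-th radius the ratio to [dl] is at most 36 * 2^k, whose fourth power is 36^4 * 16^k. *)
move=> K1 H mono bnd; have K'1 : 1 <= K * 36 ^+ 4.
  by rewrite -[1]mulr1; apply: ler_pM => //; apply: exprn_ege1; lra.
have [B0 B01 hB] := growth_step K'1.
exists B0; apply: contrapT => /existsNP[s nP].
pose r0 := Num.max 1 s; have r01 : 1 <= r0 by rewrite le_max lexx.
have sr0 : s <= r0 by rewrite le_max lexx orbT.
pose rk k := r0 * (2 - (2 ^+ k)^-1).
have inv2 k : 0 < ((2 : R) ^+ k)^-1 by rewrite invr_gt0 exprn_gt0.
have inv1 k : ((2 : R) ^+ k)^-1 <= 1 by rewrite invf_le1 ?exprn_gt0 //; apply: exprn_ege1; lra.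
have Bk k : 1 <= B0 * 32 ^+ k.
  by rewrite -[1]mulr1; apply: ler_pM => //; apply: exprn_ege1; lra.
have nPk k : ~ P (rk k) (B0 * 32 ^+ k).
  elim: k => [|k IH].
    rewrite expr0 mulr1 /rk expr0 invr1 => h; apply: nP; apply: mono h _ _ => //.
    by move: sr0; clear; lra.
  move=> h; apply: IH.
  (* A ninth of the gap r0 / 2^(k+1) between consecutive radii. *)
  pose dl := r0 / (2 ^+ k.+1 * 9).
  have dl0 : 0 < dl by apply: divr_gt0; [lra|rewrite mulr_gt0 ?exprn_gt0].
  have E : rk k + 9 * dl = rk k.+1.
    rewrite /rk /dl exprS; field.
    by rewrite expf_neq0.
  have rk1 : 1 <= rk k.
    rewrite /rk -[leLHS]mulr1; apply: ler_pM => //; have := inv1 k; lra.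
  rewrite -E in h.
  have := H (rk k) dl _ rk1 dl0 (Bk k.+1) h.
  move=> h'; apply: mono h' _ _ => //; apply: le_trans (hB k).
  have l0 : 0 <= ln (B0 * 32 ^+ k.+1) by rewrite ln_ge0.
  apply: ler_wpM2r; first lra.
  rewrite -mulrA; apply: ler_wpM2l; first lra.
  have p0 : 0 < (rk k + 9 * dl) / dl by apply: divr_gt0 => //; lra.
  rewrite (_ : 36 ^+ 4 * 16 ^+ k = (36 * 2 ^+ k) ^+ 4); last first.
    by rewrite exprMn -!exprM mulnC exprM; congr (_ * _ ^+ _); ring.
  rewrite lerXn2r ?nnegrE ?(ltW p0) ?mulr_ge0 ?exprn_ge0 //.
  rewrite E ler_pdivrMr // (_ : 36 * 2 ^+ k * dl = 2 * r0); last first.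
    by rewrite /dl exprS; field; rewrite expf_neq0.
  by rewrite /rk; have := inv2 k.+1; nra.
have [B PB] := bnd (2 * r0).
have [k hk] : exists k, B <= B0 * 32 ^+ k.
  exists (Num.bound `|B|); apply: le_trans (ler_norm _) _.
  apply: (@le_trans _ _ (1 * 32 ^+ (Num.bound `|B|))); last first.
    by apply: ler_wpM2r => //; rewrite exprn_ge0.
  rewrite mul1r; apply: ltW; apply: lt_trans (archi_boundP (normr_ge0 B)) _.
  by rewrite -natrX ltr_nat ltn_expl.
apply: (nPk k); apply: mono PB _ hk.
by rewrite /rk; have := inv2 k; nra.
Qed.

Section SmallFunctions.
Variables h1 h2 : C -> C.

(* [S] is small with respect to [e^h1] and [e^h2]: locally, it is bounded by a
   polynomial in a bound for [h1] and [h2]. *)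
Definition small (S : C -> C) := exists (K : R) (N : nat), 0 <= K /\
  forall z (dl B : R), 0 < dl -> 1 <= B ->
    (forall w, nm (w - z) <= dl -> nm (h1 w) <= B /\ nm (h2 w) <= B) ->
    nm (S z) <= K * (B * (1 + dl^-1)) ^+ N.

Lemma small_base (B dl : R) : 0 < dl -> 1 <= B -> 1 <= B * (1 + dl^-1).
Proof.
move=> d0 B1; rewrite -[leLHS]mulr1; apply: ler_pM => //.
by rewrite lerDl invr_ge0 ltW.
Qed.

Lemma small_cst a : small (fun=> a).
Proof.
exists (nm a), 0%N; split; first exact: nm_ge0.
by move=> z dl B _ _ _; rewrite expr0 mulr1.
Qed.

Lemma small_h1 : small h1.
Proof.
exists 1, 1%N; split=> // z dl B d0 B1 h; rewrite mul1r expr1.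
have [|le1 _] := h z; first by rewrite subrr nm0 ltW.
apply: le_trans le1 _; rewrite -[leLHS]mulr1; apply: ler_wpM2l; first lra.
by rewrite lerDl invr_ge0 ltW.
Qed.

Lemma small_h2 : small h2.
Proof.
exists 1, 1%N; split=> // z dl B d0 B1 h; rewrite mul1r expr1.
have [|_ le1] := h z; first by rewrite subrr nm0 ltW.
apply: le_trans le1 _; rewrite -[leLHS]mulr1; apply: ler_wpM2l; first lra.
by rewrite lerDl invr_ge0 ltW.
Qed.

Lemma smallM S T : small S -> small T -> small (fun z => S z * T z).
Proof.
move=> [K [N [K0 hS]]] [K' [N' [K'0 hT]]]; exists (K * K'), (N + N')%N.
split; first exact: mulr_ge0.
move=> z dl B d0 B1 h; rewrite nmM exprD mulrACA.
by apply: ler_pM; rewrite ?nm_ge0 //; [exact: hS h|exact: hT h].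
Qed.

Lemma smallD S T : small S -> small T -> small (fun z => S z + T z).
Proof.
move=> [K [N [K0 hS]]] [K' [N' [K'0 hT]]]; exists (K + K'), (N + N')%N.
split; first exact: addr_ge0.
move=> z dl B d0 B1 h; apply: le_trans (nmD _ _) _; rewrite mulrDl.
have b1 := small_base d0 B1.
apply: lerD.
  apply: le_trans (hS z dl B d0 B1 h) _; apply: ler_wpM2l => //.
  by apply: ler_weXn2l => //; exact: leq_addr.
apply: le_trans (hT z dl B d0 B1 h) _; apply: ler_wpM2l => //.
by apply: ler_weXn2l => //; exact: leq_addl.
Qed.

Lemma smallZ a S : small S -> small (fun z => a * S z).
Proof. by move=> hS; apply: smallM hS; exact: small_cst. Qed.

Lemma smallB S T : small S -> small T -> small (fun z => S z - T z).
Proof.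
move=> hS hT; suff -> : (fun z => S z - T z) = fun z => S z + (- 1) * T z.
  by apply: smallD hS _; exact: smallZ.
by apply/funext => z; rewrite mulN1r.
Qed.

Lemma smallX S n : small S -> small (fun z => S z ^+ n).
Proof.
move=> hS; elim: n => [|n IH].
  by rewrite (_ : (fun z => S z ^+ 0) = fun=> 1); [exact: small_cst|apply/funext => z; rewrite expr0].
by rewrite (_ : (fun z => S z ^+ n.+1) = fun z => S z * S z ^+ n);
  [exact: smallM|apply/funext => z; rewrite exprS].
Qed.

(** Cauchy's estimate on half the disc: halving [dl] costs the factor 2^N, dividing by it one more
    power. *)
Lemma small_derive S : entire S -> small S -> small (derive1 S).
Proof.
move=> eS [K [N [K0 hS]]]; exists (4 * K * 2 ^+ N), N.+1.
split; first by rewrite !mulr_ge0 ?exprn_ge0.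
move=> z dl B d0 B1 h.
have d20 : 0 < dl / 2 by rewrite divr_gt0.
have bS w : nm w <= dl / 2 -> nm (S (w + z)) <= K * (2 * (B * (1 + dl^-1))) ^+ N.
  move=> wd; apply: (@le_trans _ _ (K * (B * (1 + (dl / 2)^-1)) ^+ N)).
    apply: hS => // x xd; apply: h; have := nmD (x - (w + z)) w.
    by rewrite (_ : x - (w + z) + w = x - z); [move: xd wd; clear; lra|ring].
  have i0 : 0 < dl^-1 by rewrite invr_gt0.
  apply: ler_wpM2l => //; rewrite lerXn2r ?nnegrE //.
  - by rewrite mulr_ge0 ?addr_ge0 ?invr_ge0 ?ltW //; lra.
  - by rewrite !mulr_ge0 ?addr_ge0 ?invr_ge0 ?ltW //; lra.
  rewrite mulrCA; apply: ler_wpM2l; first lra.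
  by rewrite invf_div mulrDr mulr1; lra.
have eSz : entire (fun w => S (w + z)) by exact: entire_shift.
have lt2 : dl / 2 < dl by lra.
have n0d : nm (0 : C) < dl / 2 by rewrite nm0.
have := cauchy_estimate (entire_hol (r := dl) eSz) lt2 n0d bS.
rewrite derive1_shift // add0r nm0 subr0 => H; apply: le_trans H _.
rewrite exprMn invf_div.
set Y := (B * (1 + dl^-1)) ^+ N.
rewrite (_ : 2 * _ * _ = 4 * K * 2 ^+ N * (Y * dl^-1)); last by ring.
rewrite exprSr -/Y; apply: ler_wpM2l; first by rewrite !mulr_ge0 ?exprn_ge0.
apply: ler_wpM2l; first by rewrite exprn_ge0 //; have := small_base d0 B1; lra.
have i0 : 0 < dl^-1 by rewrite invr_gt0.
by rewrite -[leLHS]mul1r; apply: ler_pM => //; lra.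
Qed.

End SmallFunctions.

Lemma small_shift h1 h2 S a : small h1 h2 S ->
  small (fun z => h1 (z + a)) (fun z => h2 (z + a)) (fun z => S (z + a)).
Proof.
move=> [K [N [K0 hS]]]; exists K, N; split=> // z dl B d0 B1 h.
apply: hS => // w wd; have := h (w - a).
by rewrite subrK (_ : w - a - z = w - (z + a)); [exact|ring].
Qed.

Lemma seq_bound (x0 : R) (xs : seq R) : exists2 Z : R, x0 <= Z & all (fun x => x <= Z) xs.
Proof.
elim: xs => [|x xs [Z Z0 hZ]]; first by exists x0.
exists (Num.max x Z); first by rewrite le_max Z0 orbT.
rewrite /= le_max lexx /=; apply: sub_all hZ => y yZ.
by rewrite le_max yZ orbT.
Qed.

(** [Q] dominates all the data of [exponent_bound], including a bound of degree [N] for a small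
    function, while its logarithm is still of the order of psi (1 + ln B). The latter turns the
    power psi^3 into psi^4. *)
Lemma scale_bounds (Z r dl B : R) N : 20 <= Z -> 1 <= r -> 0 < dl -> 1 <= B ->
  let psi := (r + 9 * dl) / dl in let psi8 := (r + 8 * dl) / dl in
  let Q := Z * (2 * (B * psi)) ^+ N.+1 in
  [/\ Z <= Q, B <= Q, dl^-1 <= Q & psi8 <= Q] /\
  (Z * (B * (1 + dl^-1)) ^+ N <= Q /\
   131 * psi8 ^+ 3 * ln Q <= 262 * (ln Z + N.+1%:R) * psi ^+ 4 * (1 + ln B)).
Proof.
move=> Z20 r1 dl0 B1 psi psi8 Q.
have psi1 : 1 <= psi by rewrite /psi ler_pdivlMr // mul1r; lra.
have dlpsi : dl^-1 <= psi.
  by rewrite /psi -[leLHS]mul1r; apply: ler_wpM2r; [rewrite invr_ge0 ltW|lra].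
have psi8l : psi8 <= psi by rewrite /psi8 /psi ler_pM2r ?invr_gt0 //; lra.
have psi80 : 0 <= psi8 by rewrite divr_ge0 //; lra.
have di0 : 0 < dl^-1 by rewrite invr_gt0.
move: dlpsi psi8l psi80 di0; move: @psi psi1 @psi8 @Q => psi psi1 psi8 Q.
move: (dl^-1) => di dlpsi psi8l psi80 di0.
pose Y := 2 * (B * psi); have Y2 : 2 <= Y.
  rewrite /Y -[leLHS]mulr1; apply: ler_wpM2l => //.
  by rewrite -[leLHS]mulr1; apply: ler_pM.
have Bpsi : B <= B * psi by rewrite -[leLHS]mulr1; apply: ler_wpM2l; lra.
have psiB : psi <= B * psi by rewrite -[leLHS]mul1r; apply: ler_wpM2r; lra.
have YN : 1 <= Y ^+ N by apply: exprn_ege1; lra.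
have YN1 : Y <= Y ^+ N.+1 by rewrite exprS -[leLHS]mulr1; apply: ler_wpM2l; lra.
have ZQ : Z <= Q by rewrite /Q -[leLHS]mulr1; apply: ler_wpM2l; rewrite -/Y; lra.
have YQ : Y <= Q by rewrite /Q -[leLHS]mul1r; apply: ler_pM; rewrite -/Y; lra.
split; first by move: YQ; rewrite /Y => YQ; split; lra.
split.
  apply: ler_wpM2l; first lra.
  apply: (@le_trans _ _ (Y ^+ N)); last by apply: ler_weXn2l => //; lra.
  rewrite lerXn2r ?nnegrE; [by []|by apply: mulr_ge0; lra|lra|].
  by rewrite /Y mulrCA; apply: ler_wpM2l; lra.
have lZ : 0 <= ln Z by rewrite ln_ge0 //; lra.
have N1 : 1 <= N.+1%:R :> R by rewrite ler1n.
pose kp := ln Z + N.+1%:R; have kp1 : 1 <= kp by rewrite /kp; lra.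
have lQ0 : 0 <= ln Q by rewrite ln_ge0 //; lra.
have lQ : ln Q <= 2 * kp * (psi * (1 + ln B)).
  have Bp : 0 < B * psi by lra.
  rewrite /Q lnM ?posrE ?exprn_gt0 //; [|lra..]; rewrite lnXn; last lra.
  rewrite lnM ?posrE // lnM ?posrE; [|lra..].
  have l2 : ln (2 : R) <= 1.
    by have := @le_ln1Dx R 1; rewrite (_ : 1 + 1 = 2 :> R); [apply; lra|ring].
  have lB : 0 <= ln B := ln_ge0 B1.
  have lp : ln psi <= psi by apply: ln_le_id; lra.
  pose u := 1 + ln B + psi.
  have hT : ln (2 : R) + (ln B + ln psi) <= u by rewrite /u; lra.
  have u1 : 1 <= u by rewrite /u; lra.
  have a1 : psi <= psi * (1 + ln B) by rewrite -[leLHS]mulr1; apply: ler_wpM2l; lra.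
  have a2 : 1 + ln B <= psi * (1 + ln B) by rewrite -[leLHS]mul1r; apply: ler_wpM2r; lra.
  have hu : u <= 2 * (psi * (1 + ln B)) by rewrite /u; lra.
  rewrite -[_ *+ N.+1]mulr_natl.
  have t1 : N.+1%:R * (ln (2 : R) + (ln B + ln psi)) <= N.+1%:R * u by apply: ler_wpM2l => //; lra.
  have t2 : ln Z <= ln Z * u by rewrite -[leLHS]mulr1; apply: ler_wpM2l.
  have t3 : kp * u <= kp * (2 * (psi * (1 + ln B))) by apply: ler_wpM2l => //; lra.
  rewrite (_ : 2 * kp * _ = kp * (2 * (psi * (1 + ln B)))); last by ring.
  by apply: le_trans t3; rewrite /kp mulrDl; apply: lerD.
apply: (@le_trans _ _ (131 * psi ^+ 3 * (2 * kp * (psi * (1 + ln B))))).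
  apply: ler_pM => //; first by rewrite mulr_ge0 ?exprn_ge0.
  by apply: ler_wpM2l => //; rewrite lerXn2r ?nnegrE //; lra.
by apply: le_of_eq; rewrite -/kp; ring.
Qed.

(** The bound for [S] involves [h1] and [h2] together, so an estimate for one exponent alone does
    not close up. Both are improved at the same time, which is why [S] vanishes at the zeros for
    both; boundedness on the plane then contradicts Liouville's theorem, as h1'(0) is nonzero. *)
Lemma small_vanish0 h1 h2 S (d : C) : entire h1 -> entire h2 -> entire S -> d != 0 ->
  derive1 h1 0 != 0 -> derive1 h2 0 != 0 -> S 0 != 0 -> small h1 h2 S ->
  (forall z, cexp (h1 z) + d = 0 -> S z = 0) ->
  (forall z, cexp (h2 z) + d = 0 -> S z = 0) -> False.
Proof.
move=> e1 e2 eS d0 H1 H2 S0 [K [N [K0 hS]]] z1 z2.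
pose P r B := forall z, nm z <= r -> nm (h1 z) <= B /\ nm (h2 z) <= B.
have [Z Z20 /= /andP[ZK /andP[Zd /andP[Zdi /andP[ZS /andP[ZH1 /andP[ZH2
    /andP[ZX1 /andP[ZX1i /andP[ZX2 /andP[ZX2i /andP[Ze1 /andP[Ze2 _]]]]]]]]]]]]] :=
  seq_bound 20 [:: K; nm d; (nm d)^-1; (nm (S 0))^-1; (nm (derive1 h1 0))^-1;
    (nm (derive1 h2 0))^-1; nm (cexp (h1 0) + d); (nm (cexp (h1 0) + d))^-1;
    nm (cexp (h2 0) + d); (nm (cexp (h2 0) + d))^-1; expR (nm (h1 0)); expR (nm (h2 0))].
have fin h r dl B : entire h -> derive1 h 0 != 0 -> (nm (derive1 h 0))^-1 <= Z ->
    nm (cexp (h 0) + d) <= Z -> (nm (cexp (h 0) + d))^-1 <= Z -> expR (nm (h 0)) <= Z ->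
    (forall z, cexp (h z) + d = 0 -> S z = 0) -> 1 <= r -> 0 < dl -> 1 <= B ->
    P (r + 9 * dl) B -> (forall z, nm z <= r + 8 * dl -> nm (h z) <= B) ->
    forall z, nm z <= r ->
    nm (h z) <= 262 * (ln Z + N.+1%:R) * ((r + 9 * dl) / dl) ^+ 4 * (1 + ln B).
  move=> eh H0 c1 c2 c3 c4 hz r1 dl0 B1 hP bh z zr.
  have [[ZQ BQ dQ pQ] [SQ fQ]] := scale_bounds N Z20 r1 dl0 B1.
  apply: le_trans fQ; move: ZQ BQ dQ pQ SQ; set Q := Z * _ => ZQ BQ dQ pQ SQ.
  have Q0 : 0 < Q by apply: lt_le_trans ZQ; apply: lt_le_trans Z20.
  have h0l : nm (h 0) <= ln Q by rewrite -ler_expR lnK ?posrE //; exact: le_trans c4 ZQ.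
  (* The ninth gap is used here: [S] at a point is bounded through [h1] and [h2] within distance
     [dl] of it. *)
  have bS x : nm x <= r + 8 * dl -> nm (S x) <= Q.
    move=> xr; apply: le_trans (hS x dl B dl0 B1 _) _.
      move=> w wz; apply: hP; have := nmD (w - x) x; rewrite subrK.
      by move: xr wz; clear; lra.
    apply: le_trans SQ; apply: ler_wpM2r => //.
    apply: exprn_ge0; apply: le_trans (small_base dl0 B1); exact: ler01.
  exact: (exponent_bound eh eS d0 hz (lt_le_trans ltr01 r1) dl0 erefl (le_trans Z20 ZQ) erefl
    (fun x xr => le_trans (bh x xr) BQ) bS dQ pQ (le_trans Zd ZQ) (le_trans Zdi ZQ) S0
    (le_trans ZS ZQ) H0 (le_trans c1 ZQ) (le_trans c2 ZQ) (le_trans c3 ZQ) h0l zr).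
have gap r dl (x : R) : 0 < dl -> x <= r + 8 * dl -> x <= r + 9 * dl.
  by clear; lra.
have [B hB] : exists B, forall r, P r B.
  apply: (@no_slow_growth P (262 * (ln Z + N.+1%:R))).
  - have N1 : 1 <= N.+1%:R :> R by rewrite ler1n.
    have lZ : 0 <= ln Z by rewrite ln_ge0 // (le_trans _ Z20) // ler1n.
    by move: N1 lZ; clear; lra.
  - move=> r dl B r1 dl0 B1 hP z zr; split.
      apply: (fin h1) => // x xr; exact: (hP x (gap _ _ _ dl0 xr)).1.
    apply: (fin h2) => // x xr; exact: (hP x (gap _ _ _ dl0 xr)).2.
  - move=> r r' B B' hP rr BB z zr; have [a b] := hP z (le_trans zr rr).
    by split; apply: le_trans BB.
  move=> r; pose r' := Num.max 0 r.
  have r'0 : 0 <= r' by rewrite le_max lexx.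
  have rr' : r' < r' + 1 by rewrite ltrDl.
  have [B1 _ hB1] := hol_bound (entire_hol (r := r' + 1) e1) r'0 rr'.
  have [B2 _ hB2] := hol_bound (entire_hol (r := r' + 1) e2) r'0 rr'.
  exists (Num.max B1 B2) => z zr.
  have zr' : nm z <= r' by rewrite le_max zr orbT.
  by split; rewrite le_max ?hB1 ?hB2 ?orbT.
have E := liouville e1 (fun z => (hB (nm z) z (lexx _)).1).
move/eqP: H1; apply.
by apply: cder_derive1; apply: (cder_ext (f := fun=> h1 0)) (cder_cst (h1 0) 0) => w; rewrite E.
Qed.

(** The estimates are centred at 0, where S, h1' and h2' must not vanish; a translation moves such a
    point to 0. *)
Lemma small_vanish h1 h2 S (d : C) z1 z2 : entire h1 -> entire h2 -> entire S -> d != 0 ->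
  derive1 h1 z1 != 0 -> derive1 h2 z2 != 0 -> small h1 h2 S ->
  (forall z, cexp (h1 z) + d = 0 -> S z = 0) ->
  (forall z, cexp (h2 z) + d = 0 -> S z = 0) -> forall z, S z = 0.
Proof.
move=> e1 e2 eS d0 H1 H2 sS hz1 hz2; apply: contrapT => nS.
have e1' := entire_derive e1; have e2' := entire_derive e2.
have [a Ha] : exists a, S a * (derive1 h1 a * derive1 h2 a) != 0.
  apply: contrapT => /forallNP nex.
  have Z z : S z * (derive1 h1 z * derive1 h2 z) = 0.
    by apply/eqP; apply/negP => /negP; exact: nex.
  have [//|E] := entire_idom eS (entireM e1' e2') Z.
  have [E1|E2] := entire_idom e1' e2' E.
    by move: H1; rewrite E1 eqxx.
  by move: H2; rewrite E2 eqxx.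
move: Ha; rewrite !mulf_eq0 !negb_or => /andP[Sa /andP[Ha1 Ha2]].
apply: (@small_vanish0 (fun z => h1 (z + a)) (fun z => h2 (z + a)) (fun z => S (z + a)) d).
- exact: entire_shift.
- exact: entire_shift.
- exact: entire_shift.
- exact: d0.
- rewrite (@derive1_shift R h1 a e1) (add0r a); exact: Ha1.
- rewrite (@derive1_shift R h2 a e2) (add0r a); exact: Ha2.
- rewrite (add0r a); exact: Sa.
- exact: small_shift.
- by move=> z; exact: hz1.
- by move=> z; exact: hz2.
Qed.

End Growth.

(** * Polynomials, Wronskians and leading coefficients at common zeros *)

Section Polynomials.
Variable R : realType.
Local Notation C := (Cplx R).
Implicit Types (z w a : C) (f g : C -> C).

Lemma cder_horner (p : {poly C}) z : cder (horner p) z (p^`()).[z].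
Proof.
elim/poly_ind: p => [|p c IH].
  rewrite deriv0 horner0; apply: cder_ext (cder_cst 0 z) => w.
  by rewrite horner0.
apply: (@cder_ext _ (fun w => p.[w] * w + c)) => [w|].
  by rewrite hornerD hornerM hornerX hornerC.
apply: cder_eq (cderD (cderM IH (cder_id z)) (cder_cst c z)) _.
by rewrite derivD derivM derivX derivC !hornerD !hornerM hornerX !hornerC.
Qed.

Lemma entire_horner (p : {poly C}) : entire (horner p).
Proof. by apply: entireI => z; eexists; exact: cder_horner. Qed.

Lemma poly_primitive (q : {poly C}) : exists p : {poly C}, p^`() = q.
Proof.
exists (\poly_(i < (size q).+1) (q`_i.-1 / i%:R)); apply/polyP => i.
rewrite coef_deriv coef_poly ltnS; case: ltnP => h.
  by rewrite -[LHS]mulr_natr divfK // pnatr_eq0.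
by rewrite mul0rn nth_default.
Qed.

Lemma entire_poly_of_derive f (q : {poly C}) : entire f ->
  (forall z, derive1 f z = q.[z]) -> exists p : {poly C}, forall z, f z = p.[z].
Proof.
move=> ef h; have [p hp] := poly_primitive q.
have eD : entire (fun z => f z - p.[z]) := entireB ef (@entire_horner p).
exists (p + (f 0 - p.[0])%:P) => z; rewrite hornerD hornerC.
rewrite -[LHS](subrK p.[z]) addrC; congr (_ + _).
apply: (entire_const eD) => w.
rewrite (cder_derive1 (cderB (entire_cder ef w) (@cder_horner p w))) h hp.
exact: subrr.
Qed.

Lemma entire_derive1n k f : entire f -> entire (derive1n k f).
Proof. by move=> ef; elim: k => [|k IH]; [exact: ef|exact: entire_derive]. Qed.

Lemma derive1n_poly k f : entire f -> (forall z, derive1n k f z = 0) ->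
  exists p : {poly C}, forall z, f z = p.[z].
Proof.
elim: k f => [|k IH] f ef h; first by exists 0 => z; rewrite horner0; exact: h.
have [q hq] : exists q : {poly C}, forall z, derive1 f z = q.[z].
  apply: IH; first exact: entire_derive.
  by move=> z; rewrite -(h z) /derive1n iterSr.
exact: entire_poly_of_derive hq.
Qed.

(** Differentiating p(g) = 0 gives p'(g) g' = 0, hence p'(g) = 0, a relation of lower degree. *)
Lemma no_poly_relation g (p : {poly C}) z0 : entire g -> derive1 g z0 != 0 ->
  p != 0 -> ~ (forall z, p.[g z] = 0).
Proof.
move=> eg g0; move: {2}(size p) (leqnn (size p)) => n.
elim: n p => [|n IH] p; first by rewrite leqn0 size_poly_eq0 => /eqP ->; rewrite eqxx.
move=> sp p0 h; have [s1|s1] := leqP (size p) 1.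
  move: p0 (h 0); rewrite (size1_polyC s1) hornerC => p0 E.
  by move: p0; rewrite E eqxx.
have dp : p^`() != 0.
  apply/eqP => E; have := coef_deriv p (size p).-2.
  rewrite E coef0 => /esym/eqP; case: (size p) s1 (lead_coefE p) => [//|[//|m]] _ /= <-.
  rewrite -[_ == 0]/(lead_coef p *+ m.+1 == 0) mulrn_eq0 /= lead_coef_eq0.
  by rewrite (negbTE p0).
apply: (IH p^`() _ dp).
  by rewrite -ltnS; apply: leq_trans sp; exact: lt_size_deriv.
have D z : (p^`()).[g z] * derive1 g z = 0.
  have c := cder_comp (entire_cder eg z) (@cder_horner p (g z)).
  have c' := cder_ext h c.
  by rewrite -(cder_derive1 c') (cder_derive1 (cder_cst 0 z)).
have ep : entire (fun z => (p^`()).[g z]).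
  by apply: entireI => z; eexists; exact: cder_comp (entire_cder eg z) (@cder_horner _ _).
have [//|E] := entire_idom ep (entire_derive eg) D.
by move: g0; rewrite E eqxx.
Qed.

(** As [v] may have zeros, u / v is not differentiated. The function D = u - c v vanishes at [z0];
    if it were not identically 0, say D = (z - z0)^(m+1) Y, then the vanishing of D' v - D v' would
    force (m + 1) Y(z0) v(z0) = 0. *)
Lemma wronskian u v (u' v' : C -> C) z0 : entire u -> entire v ->
  (forall z, cder u z (u' z)) -> (forall z, cder v z (v' z)) -> v z0 != 0 ->
  (forall z, u' z * v z = u z * v' z) -> exists c, forall z, u z = c * v z.
Proof.
move=> eu ev du dv v0 E; pose c := u z0 / v z0; exists c.
pose D z := u z - c * v z.
have eD : entire D := entireB eu (@entireZ R c v ev).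
have dD z : cder D z (u' z - c * v' z) := cderB (du z) (cderZ c (dv z)).
have [h z|/existsNP[z1 /eqP D1]] := pselect (forall z, D z = 0).
  by apply/eqP; rewrite -subr_eq0; apply/eqP; exact: h.
exfalso; have [m [Y eY [Y0 EY]]] := @order_at R D z1 z0 eD D1.
have D0 : D z0 = 0 by rewrite /D /c divfK // subrr.
case: m EY => [|m] EY.
  by move: Y0; rewrite -[Y z0]mul1r -(expr0 (z0 - z0)) -EY D0 eqxx.
have csub z : cder (fun w => w - z0) z (1 - 0) := cderB (cder_id z) (cder_cst z0 z).
have esub : entire (fun w => w - z0) by apply: entireB; [exact: entire_id|exact: entire_cst].
have K z : u' z - c * v' z =
    (m.+1)%:R * (z - z0) ^+ m * (1 - 0) * Y z + (z - z0) ^+ m.+1 * derive1 Y z.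
  rewrite -(cder_derive1 (dD z)).
  have := cder_ext (fun w => esym (EY w)) (cderM (cderX m.+1 (csub z)) (entire_cder eY z)).
  exact: cder_derive1.
have Z z : (z - z0) ^+ m * (((m.+1)%:R * Y z + (z - z0) * derive1 Y z) * v z
    - (z - z0) * Y z * v' z) = 0.
  have -> : (z - z0) ^+ m * (((m.+1)%:R * Y z + (z - z0) * derive1 Y z) * v z
    - (z - z0) * Y z * v' z) = (u' z - c * v' z) * v z - D z * v' z.
    rewrite K EY exprS; move: (derive1 Y z) => t; ring.
  rewrite /D; have := E z; move=> Ez.
  have -> : (u' z - c * v' z) * v z - (u z - c * v z) * v' z = u' z * v z - u z * v' z by ring.
  by rewrite Ez subrr.
have ev' : entire v'.
  have -> : v' = derive1 v by apply/funext => z; rewrite (cder_derive1 (dv z)).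
  exact: entire_derive.
have eP : entire (fun z => (z - z0) ^+ m) := @entireX R _ m esub.
have eQ : entire (fun z => ((m.+1)%:R * Y z + (z - z0) * derive1 Y z) * v z
    - (z - z0) * Y z * v' z).
  apply: entireB; apply: entireM; [|exact: ev|exact: entireM|exact: ev'].
  apply: entireD; first exact: entireZ.
  by apply: entireM; [exact: esub|exact: entire_derive].
have [h|h] := entire_idom eP eQ Z.
  have := h (z0 + 1); rewrite addrAC subrr add0r expr1n => /eqP.
  by rewrite oner_eq0.
have := h z0; rewrite subrr !mul0r addr0 subr0 => /eqP.
by rewrite !mulf_eq0 (negbTE v0) (negbTE Y0) pnatr_eq0.
Qed.

Section LeadingCoefficient.
Variables (h1 h2 L1 L2 B1 B2 : C -> C) (d : C) (n : nat).
Hypothesis (e1 : entire h1) (e2 : entire h2) (eB1 : entire B1) (eB2 : entire B2).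
Hypothesis (dh1 : forall z, cder h1 z (L1 z)) (dh2 : forall z, cder h2 z (L2 z)).
Hypothesis (d0 : d != 0) (n0 : (0 < n)%N).

Let X1 z := cexp (h1 z) + d.
Let X2 z := cexp (h2 z) + d.
Hypothesis rel : forall z, X1 z ^+ n * cexp (h1 z) * B1 z = X2 z ^+ n * cexp (h2 z) * B2 z.

Lemma dX (h L : C -> C) : (forall z, cder h z (L z)) ->
  forall z, cder (fun z => cexp (h z) + d) z (cexp (h z) * L z).
Proof.
move=> dh z; apply: cder_eq (cderD (cder_comp (dh z) (cder_cexp (h z))) (cder_cst d z)) _.
exact: addr0.
Qed.

Lemma eX1 : entire X1.
Proof. by apply: entireD; [exact: entire_cexp|exact: entire_cst]. Qed.
Lemma eX2 : entire X2.
Proof. by apply: entireD; [exact: entire_cexp|exact: entire_cst]. Qed.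

Lemma cancel_pow z0 m (f g : C -> C) : entire f -> entire g ->
  (forall z, (z - z0) ^+ m * f z = (z - z0) ^+ m * g z) -> forall z, f z = g z.
Proof.
move=> ef eg E z.
have esub : entire (fun w => (w - z0) ^+ m).
  by apply: entireX; apply: entireB; [exact: entire_id|exact: entire_cst].
have Z w : (w - z0) ^+ m * (f w - g w) = 0 by rewrite mulrBr E subrr.
have [h|h] := entire_idom esub (entireB ef eg) Z.
- have := h (z0 + 1); rewrite addrAC subrr add0r expr1n => /eqP.
  by rewrite oner_eq0.
- by apply/eqP; rewrite -subr_eq0; apply/eqP.
Qed.

Lemma idom_neq0 (f g : C -> C) z : entire f -> entire g -> f z != 0 ->
  (forall w, f w * g w = 0) -> forall w, g w = 0.
Proof.
move=> ef eg fz h; have [E|//] := entire_idom ef eg h.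
by move: fz; rewrite E eqxx.
Qed.

(* Matching the leading coefficients of both sides of [rel] at a common zero. *)
Lemma leading_coef z0 : X1 z0 = 0 -> B2 z0 * (L1 z0 ^+ n * B1 z0 - L2 z0 ^+ n * B2 z0) = 0.
Proof.
(* If [X2] does not vanish at [z0], the relation forces B2(z0) = 0; this is the reason for the
   factor [B2]. *)
move=> X10; have [X20|X20] := eqVneq (X2 z0) 0; last first.
  have := rel z0; rewrite X10 expr0n (gtn_eqF n0) !mul0r => /esym/eqP.
  have P : X2 z0 ^+ n * cexp (h2 z0) != 0 by apply: mulf_neq0; [exact: expf_neq0|exact: cexp_neq0].
  by rewrite mulf_eq0 (negbTE P) => /eqP ->; exact: mul0r.
have G1 : cexp (h1 z0) = - d by apply/eqP; rewrite -addr_eq0; apply/eqP.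
have G2 : cexp (h2 z0) = - d by apply/eqP; rewrite -addr_eq0; apply/eqP.
have H := @cancel_pow z0 n (fun z => dq z0 X1 z ^+ n * cexp (h1 z) * B1 z)
  (fun z => dq z0 X2 z ^+ n * cexp (h2 z) * B2 z).
have eg (X h B : C -> C) : entire X -> entire h -> entire B ->
    entire (fun z => dq z0 X z ^+ n * cexp (h z) * B z).
  move=> eX eh eB; apply: entireM eB; apply: entireM; last exact: entire_cexp.
  by apply: entireX; exact: entire_dq.
have := H (eg _ _ _ eX1 e1 eB1) (eg _ _ _ eX2 e2 eB2) _ z0.
rewrite !dq_aa (cder_derive1 (dX dh1 z0)) (cder_derive1 (dX dh2 z0)) G1 G2 => K.
have {}K := K (fun z => _).
have E : (- d) ^+ n.+1 * (L1 z0 ^+ n * B1 z0 - L2 z0 ^+ n * B2 z0) = 0.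
  apply/eqP; rewrite mulrBr subr_eq0; apply/eqP.
  have {}K : (- d * L1 z0) ^+ n * - d * B1 z0 = (- d * L2 z0) ^+ n * - d * B2 z0.
    apply: K => z; have := rel z.
    by rewrite (dq_root z X10) (dq_root z X20) !exprMn !mulrA.
  move: K; rewrite !exprMn exprSr -!mulrA => K.
  by rewrite [- d * _]mulrCA [- d * (L2 z0 ^+ n * _)]mulrCA.
have dn : (- d) ^+ n.+1 != 0 by rewrite expf_neq0 // oppr_eq0.
by move/eqP: E; rewrite mulf_eq0 (negbTE dn) => /eqP ->; rewrite mulr0.
Qed.

End LeadingCoefficient.
End Polynomials.

(** * The two relations between the exponents *)

Section Relations.
Variable R : realType.
Local Notation C := (Cplx R).
Variables (h1 h2 L1 L2 B1 B2 : C -> C) (d : C) (n : nat).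
Hypothesis (e1 : entire h1) (e2 : entire h2) (eL1 : entire L1) (eL2 : entire L2).
Hypothesis (eB1 : entire B1) (eB2 : entire B2).
Hypothesis (dh1 : forall z, cder h1 z (L1 z)) (dh2 : forall z, cder h2 z (L2 z)).
Hypothesis (sL1 : small h1 h2 L1) (sL2 : small h1 h2 L2).
Hypothesis (sB1 : small h1 h2 B1) (sB2 : small h1 h2 B2).
Variables (z1 z2 y1 y2 : C).
Hypothesis (Lz1 : L1 z1 != 0) (Lz2 : L2 z2 != 0) (By1 : B1 y1 != 0) (By2 : B2 y2 != 0).
Hypothesis (d0 : d != 0) (n0 : (0 < n)%N).
Hypothesis rel : forall z, (cexp (h1 z) + d) ^+ n * cexp (h1 z) * B1 z
  = (cexp (h2 z) + d) ^+ n * cexp (h2 z) * B2 z.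

Lemma small_relation_vanish S : entire S -> small h1 h2 S ->
  (forall z, cexp (h1 z) + d = 0 -> S z = 0) ->
  (forall z, cexp (h2 z) + d = 0 -> S z = 0) -> forall z, S z = 0.
Proof.
move=> eS sS v1 v2; apply: (@small_vanish R h1 h2 S d z1 z2 e1 e2 eS d0 _ _ sS v1 v2).
  by rewrite (cder_derive1 (dh1 z1)).
by rewrite (cder_derive1 (dh2 z2)).
Qed.

(** At a zero of e^h1 + d the leading coefficients agree up to the factor [B2], at a zero of e^h2 +
    d up to [B1]; with both factors the difference [T] vanishes at all these zeros and is still
    small. *)
Lemma first_relation z : L1 z ^+ n * B1 z = L2 z ^+ n * B2 z.
Proof.
pose T z := L1 z ^+ n * B1 z - L2 z ^+ n * B2 z.
have eT : entire T.
  by apply: entireB; (apply: entireM; first exact: entireX); [exact: eB1|exact: eB2].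
have sT : small h1 h2 T.
  by apply: smallB; (apply: smallM; first exact: smallX); [exact: sB1|exact: sB2].
have V := @small_relation_vanish (fun z => B1 z * (B2 z * T z)) (entireM eB1 (entireM eB2 eT))
  (smallM sB1 (smallM sB2 sT)).
have {}V : forall z, B1 z * (B2 z * T z) = 0.
  apply: V => w Xw.
    by rewrite (leading_coef e1 e2 eB1 eB2 dh1 dh2 d0 n0 rel Xw) mulr0.
  have := leading_coef e2 e1 eB2 eB1 dh2 dh1 d0 n0 (fun z => esym (rel z)) Xw.
  move=> E; rewrite mulrCA (_ : B1 w * T w = - (B1 w * (L2 w ^+ n * B2 w - L1 w ^+ n * B1 w))).
    by rewrite E oppr0 mulr0.
  by rewrite /T; ring.
have := idom_neq0 eB2 eT By2 (idom_neq0 eB1 (entireM eB2 eT) By1 V) z.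
by move/eqP; rewrite subr_eq0 => /eqP.
Qed.

(** The first relation eliminates [B1] and [B2], so that the next Taylor coefficients involve only
    the first two derivatives of [h1] and [h2]. *)
Lemma second_relation z :
  ((cexp (h1 z) + d) * L2 z) ^+ n * cexp (h1 z) = ((cexp (h2 z) + d) * L1 z) ^+ n * cexp (h2 z).
Proof.
pose T z := ((cexp (h1 z) + d) * L2 z) ^+ n * cexp (h1 z)
  - ((cexp (h2 z) + d) * L1 z) ^+ n * cexp (h2 z).
have e h L : entire h -> entire L -> entire (fun z => ((cexp (h z) + d) * L z) ^+ n * cexp (h z)).
  move=> eh eL; apply: entireM; last exact: entire_cexp.
  by apply: entireX; apply: entireM eL; exact: eX1.
have eT : entire T := entireB (e _ _ e1 eL2) (e _ _ e2 eL1).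
have eP : entire (fun z => L1 z ^+ n) by exact: entireX.
have Z w : L1 w ^+ n * (B1 w * T w) = 0.
  have F := first_relation w; have := rel w; rewrite /T !exprMn.
  move: (cexp (h1 w)) (cexp (h2 w)) ((cexp (h1 w) + d) ^+ n) ((cexp (h2 w) + d) ^+ n) F.
  move: (L1 w ^+ n) (L2 w ^+ n) (B1 w) (B2 w) => l1 l2 b1 b2 g1 g2 x1 x2 F E.
  have -> : l1 * (b1 * (x1 * l2 * g1 - x2 * l1 * g2)) =
    l1 * l2 * (x1 * g1 * b1) - x2 * l1 * g2 * (l1 * b1) by ring.
  by rewrite E F; ring.
have Lz : L1 z1 ^+ n != 0 by exact: expf_neq0.
have := idom_neq0 eB1 eT By1 (idom_neq0 eP (entireM eB1 eT) Lz Z) z.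
by move/eqP; rewrite subr_eq0 => /eqP.
Qed.

End Relations.

(* Matching the next Taylor coefficients of both sides of [second_relation] at a
   common zero. *)
Lemma second_coef (R : realType) (h1 h2 L1 L2 M1 M2 : Cplx R -> Cplx R) (d : Cplx R) n z0 :
  entire h1 -> entire h2 -> entire L1 -> entire L2 ->
  (forall z, cder h1 z (L1 z)) -> (forall z, cder h2 z (L2 z)) ->
  (forall z, cder L1 z (M1 z)) -> (forall z, cder L2 z (M2 z)) ->
  d != 0 -> (0 < n)%N ->
  (forall z, ((cexp (h1 z) + d) * L2 z) ^+ n * cexp (h1 z)
    = ((cexp (h2 z) + d) * L1 z) ^+ n * cexp (h2 z)) ->
  cexp (h1 z0) + d = 0 -> L1 z0 != 0 -> L2 z0 != 0 ->
  (n.+2)%:R * ((L1 z0 - L2 z0) * (L1 z0 * L2 z0))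
    = n%:R * (M1 z0 * L2 z0 - L1 z0 * M2 z0).
Proof.
move=> e1 e2 eL1 eL2 dh1 dh2 dL1 dL2 d0 n0 rel X1 l1 l2.
have eX h : entire h -> entire (fun z => cexp (h z) + d) by exact: eX1.
have X2 : cexp (h2 z0) + d = 0.
  have := rel z0; rewrite X1 mul0r expr0n (gtn_eqF n0) mul0r => /esym/eqP.
  rewrite mulf_eq0 (negbTE (cexp_neq0 (h2 z0))) orbF expf_eq0 => /andP[_].
  by rewrite mulf_eq0 (negbTE l1) orbF => /eqP.
have G1 : cexp (h1 z0) = - d by apply/eqP; rewrite -addr_eq0; apply/eqP.
have G2 : cexp (h2 z0) = - d by apply/eqP; rewrite -addr_eq0; apply/eqP.
(* Here [x] is (e^h + d) / (z - z0); its value and slope at [z0] are read off from the first two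
   derivatives of e^h + d, with e^h = - d there. *)
have T h L M : entire h -> (forall z, cder h z (L z)) -> (forall z, cder L z (M z)) ->
    cexp (h z0) = - d -> exists x x' : Cplx R -> Cplx R,
    [/\ entire x, forall z, cder x z (x' z), forall z, cexp (h z) + d = (z - z0) * x z,
        x z0 = - d * L z0 & 2%:R * x' z0 = - d * (M z0 + L z0 ^+ 2)].
  move=> eh dh dL G; pose X z := cexp (h z) + d.
  have X0 : X z0 = 0 by rewrite /X G addNr.
  pose x := dq z0 X; have ex : entire x by apply: entire_dq; exact: eX.
  have dX1 z : cder X z (cexp (h z) * L z) := dX d dh z.
  exists x, (derive1 x); split.
  - exact: ex.
  - exact: entire_cder.
  - by move=> z; exact: (@dq_root R z0 X z X0).
  - by rewrite /x dq_aa (cder_derive1 (dX1 z0)) G.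
  have csub z : cder (fun w => w - z0) z (1 - 0) := cderB (cder_id z) (cder_cst z0 z).
  have dx' z : cder (derive1 x) z (derive1 (derive1 x) z) := entire_cder (entire_derive ex) z.
  have E z : cexp (h z) * L z = (1 - 0) * x z + (z - z0) * derive1 x z.
    rewrite -(cder_derive1 (dX1 z)); apply: cder_derive1.
    apply: cder_ext (cderM (csub z) (entire_cder ex z)) => w.
    by rewrite -(@dq_root R z0 X w X0).
  have D1 : cder (fun z => cexp (h z) * L z) z0
    (cexp (h z0) * L z0 * L z0 + cexp (h z0) * M z0).
    by apply: cderM (dL z0); apply: cder_comp (dh z0) _; exact: cder_cexp.
  have D2 := cderD (cderZ (1 - 0) (entire_cder ex z0)) (cderM (csub z0) (dx' z0)).
  have := cder_derive1 (cder_ext (fun z => esym (E z)) D2).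
  rewrite (cder_derive1 D1) G; move: (derive1 x z0) (derive1 (derive1 x) z0) => u v H.
  rewrite (_ : - d * (M z0 + L z0 ^+ 2) = - d * L z0 * L z0 + - d * M z0); last by ring.
  by rewrite H; ring.
have [x1 [x1' [ex1 dx1 E1 v1 w1]]] := T _ _ _ e1 dh1 dL1 G1.
have [x2 [x2' [ex2 dx2 E2 v2 w2]]] := T _ _ _ e2 dh2 dL2 G2.
have eP (x L h : Cplx R -> Cplx R) : entire x -> entire L -> entire h ->
    entire (fun z => (x z * L z) ^+ n * cexp (h z)).
  move=> ex eL eh; apply: entireM; last exact: entire_cexp.
  by apply: entireX; exact: entireM.
have rel' : forall z, (x1 z * L2 z) ^+ n * cexp (h1 z) = (x2 z * L1 z) ^+ n * cexp (h2 z).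
  have K z : (z - z0) ^+ n * ((x1 z * L2 z) ^+ n * cexp (h1 z))
      = (z - z0) ^+ n * ((x2 z * L1 z) ^+ n * cexp (h2 z)).
    by have := rel z; rewrite E1 E2 !exprMn !mulrA.
  exact: (cancel_pow (eP _ _ _ ex1 eL2 e1) (eP _ _ _ ex2 eL1 e2) K).
have D x x' L M h K : (forall z, cder x z (x' z)) -> (forall z, cder L z (M z)) ->
    (forall z, cder h z (K z)) -> cder (fun z => (x z * L z) ^+ n * cexp (h z)) z0
    (n%:R * (x z0 * L z0) ^+ n.-1 * (x' z0 * L z0 + x z0 * M z0) * cexp (h z0)
      + (x z0 * L z0) ^+ n * (cexp (h z0) * K z0)).
  move=> dx dL dh; apply: cderM; last by apply: cder_comp (dh z0) _; exact: cder_cexp.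
  by apply: cderX; exact: cderM.
have := cder_derive1 (cder_ext rel' (D _ _ _ _ _ _ dx1 dL2 dh1)).
rewrite (cder_derive1 (D _ _ _ _ _ _ dx2 dL1 dh2)) v1 v2 G1 G2.
have -> : - d * L2 z0 * L1 z0 = - d * L1 z0 * L2 z0 by ring.
set P := - d * L1 z0 * L2 z0.
have P0 : P != 0 by rewrite /P !mulf_neq0 // oppr_eq0.
rewrite -(prednK n0) exprS; set Q := P ^+ n.-1.
have Q0 : Q != 0 by exact: expf_neq0.
rewrite (prednK n0) => H; clearbody Q.
(* The derivatives of both sides are compared after doubling, since [w1] and [w2] give twice the
   slopes; - d Q d is the common nonzero factor. *)
have F : - d * Q * d * (n.+2%:R * ((L1 z0 - L2 z0) * (L1 z0 * L2 z0))) =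
   - d * Q * d * (n%:R * (M1 z0 * L2 z0 - L1 z0 * M2 z0)).
  have -> : n.+2%:R = n%:R + 1 + 1 :> Cplx R by rewrite -!natr1.
  move: H w1 w2; rewrite /P.
  move: (L1 z0) (L2 z0) (M1 z0) (M2 z0) (x1' z0) (x2' z0) (n%:R : Cplx R) (Q).
  move=> a b m1 m2 u1 u2 N q H w1 w2.
  apply/eqP; rewrite -subr_eq0; apply/eqP.
  rewrite (_ : _ - _ = 2%:R * ((N * q * (u2 * a + - d * b * m1) * - d + - d * a * b * q * (- d * b))
      - (N * q * (u1 * b + - d * a * m2) * - d + - d * a * b * q * (- d * a)))
    + N * q * d * (a * (2%:R * u2 - - d * (m2 + b ^+ 2))
      - b * (2%:R * u1 - - d * (m1 + a ^+ 2)))); last by ring.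
  by rewrite H w1 w2 !subrr; ring.
have U : - d * Q * d != 0 by rewrite !mulf_neq0 // oppr_eq0.
exact: (mulfI U).
Qed.

(** * A non-zero exceptional value *)

Section NonzeroExceptionalValue.
Variable R : realType.
Local Notation C := (Cplx R).

(** Multiplying [T] by L1 L2 covers the zeros at which h1' or h2' vanishes and the coefficients
    cannot be compared. The identity T = 0 says that L1 e^(-a h1) and L2 e^(-a h2) have Wronskian 0,
    with a = (n + 2) / n, which avoids dividing by functions with zeros. *)
Lemma derivatives_agree (h1 h2 L1 L2 M1 M2 B1 B2 : C -> C) (d : C) (n : nat) (z1 z2 y1 y2 : C) :
  entire h1 -> entire h2 -> entire L1 -> entire L2 -> entire M1 -> entire M2 ->
  entire B1 -> entire B2 ->
  (forall z, cder h1 z (L1 z)) -> (forall z, cder h2 z (L2 z)) ->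
  (forall z, cder L1 z (M1 z)) -> (forall z, cder L2 z (M2 z)) ->
  small h1 h2 L1 -> small h1 h2 L2 -> small h1 h2 M1 -> small h1 h2 M2 ->
  small h1 h2 B1 -> small h1 h2 B2 ->
  L1 z1 != 0 -> L2 z2 != 0 -> B1 y1 != 0 -> B2 y2 != 0 -> d != 0 -> (0 < n)%N ->
  (forall z, (cexp (h1 z) + d) ^+ n * cexp (h1 z) * B1 z
    = (cexp (h2 z) + d) ^+ n * cexp (h2 z) * B2 z) ->
  forall z, L1 z = L2 z.
Proof.
move=> e1 e2 eL1 eL2 eM1 eM2 eB1 eB2 dh1 dh2 dL1 dL2 sL1 sL2 sM1 sM2 sB1 sB2.
move=> Lz1 Lz2 By1 By2 d0 n0 rel.
have rel2 := second_relation e1 e2 eL1 eL2 eB1 eB2 dh1 dh2 sL1 sL2 sB1 sB2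
  Lz1 Lz2 By1 By2 d0 n0 rel.
pose T z := n.+2%:R * ((L1 z - L2 z) * (L1 z * L2 z)) - n%:R * (M1 z * L2 z - L1 z * M2 z).
have eT : entire T.
  apply: entireB; apply: entireZ.
    by apply: entireM; [exact: entireB|exact: entireM].
  by apply: entireB; exact: entireM.
have sT : small h1 h2 T.
  apply: smallB; apply: smallZ.
    by apply: smallM; [exact: smallB|exact: smallM].
  by apply: smallB; exact: smallM.
have V : forall z, L1 z * (L2 z * T z) = 0.
  apply: (small_relation_vanish e1 e2 dh1 dh2 Lz1 Lz2 d0 (entireM eL1 (entireM eL2 eT))
    (smallM sL1 (smallM sL2 sT))) => w Xw.
    have [->|l1] := eqVneq (L1 w) 0; first by rewrite mul0r.
    have [->|l2] := eqVneq (L2 w) 0; first by rewrite mul0r mulr0.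
    have := second_coef e1 e2 eL1 eL2 dh1 dh2 dL1 dL2 d0 n0 rel2 Xw l1 l2.
    by rewrite /T => ->; rewrite subrr !mulr0.
  have [->|l1] := eqVneq (L1 w) 0; first by rewrite mul0r.
  have [->|l2] := eqVneq (L2 w) 0; first by rewrite mul0r mulr0.
  have := second_coef e2 e1 eL2 eL1 dh2 dh1 dL2 dL1 d0 n0 (fun z => esym (rel2 z)) Xw l2 l1.
  move=> E; rewrite /T (_ : n.+2%:R * _ - _ = - (n.+2%:R * ((L2 w - L1 w) * (L2 w * L1 w))
     - n%:R * (M2 w * L1 w - L2 w * M1 w))); last by ring.
  by rewrite E subrr oppr0 !mulr0.
have T0 : forall z, T z = 0 := idom_neq0 eL2 eT Lz2 (idom_neq0 eL1 (entireM eL2 eT) Lz1 V).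
pose al : C := n.+2%:R / n%:R.
have nn : (n%:R : C) != 0 by rewrite pnatr_eq0 -lt0n.
have al0 : al != 0 by rewrite mulf_neq0 ?invr_eq0 // pnatr_eq0.
pose H1 z := - al * h1 z; pose H2 z := - al * h2 z.
have dE (h L : C -> C) : (forall z, cder h z (L z)) -> forall z,
    cder (fun z => cexp (- al * h z)) z (cexp (- al * h z) * (- al * L z)).
  by move=> dh z; apply: cder_comp (cderZ (- al) (dh z)) _; exact: cder_cexp.
have eE (h : C -> C) : entire h -> entire (fun z => cexp (- al * h z)).
  by move=> eh; apply: entire_cexp; exact: entireZ.
pose V1 z := L1 z * cexp (H1 z); pose V2 z := L2 z * cexp (H2 z).
have dV1 z : cder V1 z (M1 z * cexp (H1 z) + L1 z * (cexp (H1 z) * (- al * L1 z))).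
  by apply: cderM; [exact: dL1|exact: dE].
have dV2 z : cder V2 z (M2 z * cexp (H2 z) + L2 z * (cexp (H2 z) * (- al * L2 z))).
  by apply: cderM; [exact: dL2|exact: dE].
have V20 : V2 z2 != 0 by rewrite mulf_neq0 // cexp_neq0.
have eV1 : entire V1 by apply: entireM; [exact: eL1|exact: eE].
have eV2 : entire V2 by apply: entireM; [exact: eL2|exact: eE].
have [c hc] : exists c, forall z, V1 z = c * V2 z.
  apply: (wronskian eV1 eV2 dV1 dV2 V20) => z.
  have : T z / n%:R = 0 by rewrite T0 mul0r.
  have -> : T z / n%:R = al * ((L1 z - L2 z) * (L1 z * L2 z)) - (M1 z * L2 z - L1 z * M2 z).
    rewrite /T /al; move: (n%:R : C) (n.+2%:R : C) nn => N N2 nn; by field.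
  rewrite /V1 /V2; move: (cexp (H1 z)) (cexp (H2 z)) => g1 g2.
  move: (L1 z) (L2 z) (M1 z) (M2 z) => l1 l2 m1 m2 Tz.
  apply/eqP; rewrite -subr_eq0 (_ : _ - _ = - (g1 * g2 * (al * ((l1 - l2) * (l1 * l2))
     - (m1 * l2 - l1 * m2)))); last by ring.
  by rewrite Tz mulr0 oppr0.
have c0 : c != 0.
  apply/eqP => c0; have := hc z1; rewrite c0 mul0r => /eqP.
  have P : L1 z1 * cexp (H1 z1) != 0 by apply: mulf_neq0; [exact: Lz1|exact: cexp_neq0].
  by rewrite (negbTE P).
pose D z := cexp (H1 z) - c * cexp (H2 z).
have eD : entire D by apply: entireB; [exact: eE|apply: entireZ; exact: eE].
have D1 z : derive1 D z = 0.
  have k : cder D z (cexp (H1 z) * (- al * L1 z) - c * (cexp (H2 z) * (- al * L2 z))).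
    by apply: cderB; [exact: dE|apply: cderZ; exact: dE].
  rewrite (cder_derive1 k); have := hc z; rewrite /V1 /V2.
  move: (cexp (H1 z)) (cexp (H2 z)) (L1 z) (L2 z) => g1 g2 l1 l2 E.
  rewrite (_ : _ - _ = - al * (l1 * g1 - c * (l2 * g2))); last by ring.
  by rewrite E subrr mulr0.
have Dc := entire_const eD D1.
(* If D(0) were nonzero, e^H1 would omit this value, since e^H1 - D(0) = c e^H2. The vanishing
   criterion with both exponents equal to [H1] and S = 1 then has an empty condition on zeros and
   gives 1 = 0. *)
have D00 : D 0 = 0.
  apply/eqP/negPn/negP => D00.
  have eH : entire H1 by exact: entireZ.
  have dH : derive1 H1 z1 != 0.
    rewrite (cder_derive1 (cderZ (- al) (dh1 z1))) mulf_neq0 // oppr_eq0.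
    exact: al0.
  have nz z : cexp (H1 z) + - D 0 = 0 -> (1 : C) = 0.
    rewrite -(Dc z) /D (_ : _ - _ = c * cexp (H2 z)); last by ring.
    move=> /eqP; have P : c * cexp (H2 z) != 0 by apply: mulf_neq0; [exact: c0|exact: cexp_neq0].
    by rewrite (negbTE P).
  have nD : - D 0 != 0 by rewrite oppr_eq0.
  have := @small_vanish R H1 H1 (fun=> 1) (- D 0) z1 z1 eH eH (@entire_cst R 1) nD dH dH
    (small_cst H1 H1 1) nz nz 0.
  by move/eqP; rewrite oner_eq0.
move=> z; have E : cexp (H1 z) = c * cexp (H2 z).
  by have := Dc z; rewrite D00 /D => /eqP; rewrite subr_eq0 => /eqP.
have := hc z; rewrite /V1 /V2 E mulrCA => K.
have {}K := mulfI c0 K.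
exact: (mulIf (cexp_neq0 _) K).
Qed.

(** For L = h' this is e^(-h) times the k-th derivative of e^h, the complete Bell polynomial in h',
    h'', and so on. *)
Fixpoint bell k (L : C -> C) : C -> C :=
  if k is k'.+1 then fun z => derive1 (bell k' L) z + L z * bell k' L z else fun=> 1.

Lemma entire_bell k L : entire L -> entire (bell k L).
Proof.
move=> eL; elim: k => [|k IH]; first exact: entire_cst.
by apply: entireD; [exact: entire_derive|exact: entireM].
Qed.

Lemma small_bell h1 h2 k L : entire L -> small h1 h2 L -> small h1 h2 (bell k L).
Proof.
move=> eL sL; elim: k => [|k IH]; first exact: small_cst.
apply: smallD; last exact: smallM.
by apply: small_derive; [exact: entire_bell|exact: IH].
Qed.

Lemma bell_shift k L c : entire L ->
  bell k (fun z => L (z + c)) = fun z => bell k L (z + c).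
Proof.
move=> eL; elim: k => [|k IH] //=; rewrite IH.
by rewrite (@derive1_shift R (bell k L) c (@entire_bell k L eL)).
Qed.

Lemma derive1n_exp k h L (a : C) : entire L -> (forall z, cder h z (L z)) ->
  derive1n k.+1 (fun z => cexp (h z) + a) = fun z => bell k.+1 L z * cexp (h z).
Proof.
move=> eL dh; elim: k => [|k IH].
  apply/funext => z; rewrite -[LHS]/(derive1 (fun z => cexp (h z) + a) z) (cder_derive1 (dX a dh z)).
  rewrite -[bell 1 L z]/(derive1 (bell 0 L) z + L z * 1) (cder_derive1 (@cder_cst R 1 z)) add0r mulr1.
  exact: mulrC.
rewrite /derive1n iterS -[iter _ _ _]/(derive1n k.+1 _) IH; apply/funext => z.
apply: cder_derive1.
have eB := @entire_bell k.+1 L eL.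
apply: cder_eq (cderM (entire_cder eB z) (cder_comp (dh z) (cder_cexp (h z)))) _.
rewrite -[bell k.+2 L z]/(derive1 (bell k.+1 L) z + L z * bell k.+1 L z).
move: (derive1 (bell k.+1 L) z) (bell k.+1 L z) => u v; ring.
Qed.

Lemma nonzero_exceptional (f : C -> C) n k (c d : C) : transcendental_entire f ->
  (0 < n)%N -> (0 < k)%N -> d != 0 -> (forall z, f z <> d) ->
  (forall z, f (z + c) ^+ n * derive1n k f (z + c) = f z ^+ n * derive1n k f z) ->
  forall z, f (z + c) = f z.
Proof.
case: k => // k [ef npoly] n0 _ d0 fd per.
have [h eh Eh] : exists2 h, entire h & forall z, f z - d = cexp (h z).
  apply: entire_log; first by apply: entireB; [exact: ef|exact: entire_cst].
  by move=> z; rewrite subr_eq0; apply/eqP; exact: fd.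
have Ef : f = fun z => cexp (h z) + d by apply/funext => z; rewrite -Eh subrK.
pose L := derive1 h; have eL : entire L := entire_derive eh.
have dh z : cder h z (L z) := entire_cder eh z.
pose B := bell k.+1 L; have eB : entire B := @entire_bell k.+1 L eL.
have Dk : derive1n k.+1 f = fun z => B z * cexp (h z) by rewrite {1}Ef (derive1n_exp k d eL dh).
have [y By] : exists y, B y != 0.
  apply: contrapT => /forallNP nex; apply: npoly.
  apply: (@derive1n_poly R k.+1 f ef) => z; rewrite Dk.
  by have := nex z => /negP/negPn/eqP ->; rewrite mul0r.
have [z1 Lz1] : exists z1, L z1 != 0.
  apply: contrapT => /forallNP nex; apply: npoly; exists (cexp (h 0) + d)%:P => z.
  rewrite hornerC Ef (entire_const eh) // => w.
  by have := nex w => /negP/negPn/eqP.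
pose h2 z := h (z + c); pose L2 z := L (z + c); pose M z := derive1 L z.
have eM : entire M := entire_derive eL.
have eh2 : entire h2 by exact: entire_shift.
have eL2 : entire L2 by exact: entire_shift.
have sh z : z - c + c = z by rewrite subrK.
have sL : small h h2 L := small_derive eh (small_h1 h h2).
have sL2 : small h h2 L2.
  have -> : L2 = derive1 h2 by rewrite /h2 (@derive1_shift R h c eh).
  exact: (small_derive eh2 (small_h2 h h2)).
have sM : small h h2 M := small_derive eL sL.
have sM2 : small h h2 (fun z => M (z + c)).
  have -> : (fun z => M (z + c)) = derive1 L2 by rewrite /L2 (@derive1_shift R L c eL).
  exact: (small_derive eL2 sL2).
have B2E : (fun z => B (z + c)) = bell k.+1 L2 by rewrite /L2 bell_shift.
have EL : forall z, L z = L2 z.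
  apply: (@derivatives_agree h h2 L L2 M (fun z => M (z + c)) B (fun z => B (z + c)) d n
     z1 (z1 - c) y (y - c) eh eh2 eL eL2 eM (entire_shift eM) eB (entire_shift eB)).
  - exact: dh.
  - by move=> z; apply: cder_shift; exact: dh.
  - by move=> z; exact: entire_cder.
  - by move=> z; apply: cder_shift; exact: entire_cder.
  - exact: sL.
  - exact: sL2.
  - exact: sM.
  - exact: sM2.
  - exact: (small_bell k.+1 eL sL).
  - by rewrite B2E; exact: (small_bell k.+1 eL2 sL2).
  - exact: Lz1.
  - by rewrite /L2 sh.
  - exact: By.
  - by rewrite sh.
  - exact: d0.
  - exact: n0.
  - move=> z; have := per z; rewrite Dk Ef /h2 => E.
    move: E; move: (cexp (h z)) (cexp (h (z + c))) (B z) (B (z + c)) => g1 g2 b1 b2 E.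
    by rewrite -mulrA [g1 * b1]mulrC -E -mulrA [b2 * g2]mulrC.
have Bper z : B (z + c) = B z.
  rewrite (congr1 (fun F => F z) B2E : B (z + c) = bell k.+1 L2 z).
  have EL2 : L2 = L by apply/funext => w; exact: esym (EL w).
  rewrite EL2; exact: erefl.
have [kp hkp] : exists kp, forall z, h (z + c) = h z + kp.
  exists (h2 0 - h 0) => z.
  have eD : entire (fun z => h2 z - h z) := entireB eh2 eh.
  have D0 w : derive1 (fun z => h2 z - h z) w = 0.
    rewrite (cder_derive1 (cderB (cder_shift (dh (w + c))) (dh w))) -/(L2 w) EL.
    exact: subrr.
  by rewrite -(entire_const eD D0 z) /h2 [RHS]addrC subrK.
pose om := cexp kp; have om0 : om != 0 := cexp_neq0 kp.
have Gs z : cexp (h (z + c)) = om * cexp (h z) by rewrite hkp cexpD mulrC.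
have om1 : om = 1.
  apply/eqP/negPn/negP => om1.
  (* Cancelling B e^h in the relation leaves p(e^h) = 0, whereas p(0) = (1 - om) d^n is nonzero when
     [om] is not 1. *)
  pose p : {poly C} := ('X + d%:P) ^+ n - om%:P * (om%:P * 'X + d%:P) ^+ n.
  have pE x : p.[x] = (x + d) ^+ n - om * (om * x + d) ^+ n.
    by rewrite /p !(hornerE, horner_exp).
  have p0 : p != 0.
    apply/eqP => E; have := pE 0; rewrite E horner0 mulr0 !add0r => /esym/eqP.
    rewrite -{1}[d ^+ n]mul1r -mulrBl mulf_eq0 subr_eq0 eq_sym (negbTE om1) /=.
    by rewrite expf_eq0 (negbTE d0) andbF.
  have eG : entire (fun z => cexp (h z)) by exact: entire_cexp.
  have G' : derive1 (fun z => cexp (h z)) z1 != 0.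
    rewrite (cder_derive1 (cder_comp (dh z1) (cder_cexp (h z1)))).
    by apply: mulf_neq0; [exact: cexp_neq0|exact: Lz1].
  have eP : entire (fun z => p.[cexp (h z)]).
    by apply: entireI => z; eexists; exact: cder_comp (entire_cder eG z) (@cder_horner R p _).
  apply: (no_poly_relation eG G' p0).
  apply: (idom_neq0 eB eP By) => z; rewrite pE.
  have := per z; rewrite Dk Ef Bper Gs; have := cexp_neq0 (h z).
  move: (cexp (h z)) (B z) => g b g0 E.
  apply: (mulIf g0); rewrite mul0r.
  have -> : b * ((g + d) ^+ n - om * (om * g + d) ^+ n) * g
    = (g + d) ^+ n * (b * g) - (om * g + d) ^+ n * (b * (om * g)) by ring.
  by rewrite E subrr.
by move=> z; rewrite Ef Gs om1 mul1r.
Qed.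

End NonzeroExceptionalValue.

(** * Polynomial sequences *)

Section PolynomialSequences.
Variable R : realType.
Local Notation C := (Cplx R).

(* Sequences with a vanishing iterated difference, i.e. the values of
   polynomials at the natural numbers. *)
Fixpoint pseq (V : zmodType) d (u : nat -> V) : Prop :=
  if d is d'.+1 then pseq d' (fun m => u m.+1 - u m) else forall m, u m = 0.

Lemma pseq_ext (V : zmodType) d (u v : nat -> V) : (forall m, u m = v m) -> pseq d u -> pseq d v.
Proof.
elim: d u v => [|d IH] u v E /=; first by move=> h m; rewrite -E.
by apply: IH => m; rewrite !E.
Qed.

Lemma pseqS (V : zmodType) d (u : nat -> V) : pseq d u -> pseq d.+1 u.
Proof.
elim: d u => [|d IH] u h; last exact: (IH _ h).
by move=> m; rewrite !h subrr.
Qed.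

Lemma pseqD (V : zmodType) d e (u v : nat -> V) : pseq d u -> pseq e v ->
  pseq (d + e) (fun m => u m + v m).
Proof.
elim: d e u v => [|d IH] e u v hu hv.
  by apply: pseq_ext hv => m; rewrite hu add0r.
elim: e v hv => [|e IHe] v hv.
  by rewrite addn0; apply: pseq_ext hu => m; rewrite hv addr0.
have H := IH e.+1 _ _ hu (pseqS hv : pseq e.+1 (fun m => v m.+1 - v m)).
by rewrite addSn; apply: pseq_ext H => m; rewrite opprD addrACA.
Qed.

(** With D for the difference, D(u v) = Du v + u Dv + Du Dv, and each term has a factor annihilated
    by fewer differences; hence the double induction. *)
Lemma pseqM (A : comNzRingType) d e (u v : nat -> A) : pseq d u -> pseq e v ->
  exists k, pseq k (fun m => u m * v m).
Proof.
elim: d e u v => [|d IH] e u v hu hv.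
  by exists 0%N => m; rewrite hu mul0r.
elim: e v hv => [|e IHe] v hv.
  by exists 0%N => m; rewrite hv mulr0.
have [k hk] := IH e.+1 _ v hu hv.
have [l hl] := IHe _ hv.
have [k' hk'] := IH e.+1 _ _ hu (pseqS hv : pseq e.+1 (fun m => v m.+1 - v m)).
exists ((k + l) + k').+1; apply: pseq_ext (pseqD (pseqD hk hl) hk') => m.
ring.
Qed.

Lemma pseq_sum (V : zmodType) d (u : nat -> V) : pseq d u ->
  pseq d.+1 (fun m => \sum_(i < m) u i).
Proof. by apply: pseq_ext => m; rewrite big_ord_recr /= addrAC subrr add0r. Qed.

Lemma pseq_horner (A : comNzRingType) (p : {poly A}) (z c : A) :
  exists d, pseq d (fun m => p.[z + c *+ m]).
Proof.
elim/poly_ind: p => [|p a [d IH]].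
  by exists 0%N => m; rewrite horner0.
have h : pseq 2 (fun m => z + c *+ m).
  by move=> m /=; rewrite !mulrS; ring.
have [k hk] := pseqM IH h.
have ha : pseq 1 (fun _ : nat => a) by move=> m; rewrite /= subrr.
exists (k + 1)%N; apply: pseq_ext (pseqD hk ha) => m.
by rewrite hornerD hornerM hornerX hornerC.
Qed.

(** From some index [M] on all differences are at least 1, which gives slope 1 whatever [e] is. *)
Lemma linear_growth (x : nat -> R) (e D : R) : 0 < e ->
  (forall m, e * m%:R - D <= x m.+1 - x m) -> exists D', forall m, 1 * m%:R - D' <= x m.
Proof.
move=> e0 h; pose D1 := Num.max D 0.
have D10 : 0 <= D1 by rewrite le_max lexx orbT.
have {}h m : e * m%:R - D1 <= x m.+1 - x m.
  by apply: le_trans (h m); rewrite lerD2l lerN2 le_max lexx.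
pose M := (Num.truncn ((D1 + 1) / e)).+1.
have hM : (D1 + 1) / e <= M%:R by rewrite ltW // truncnS_gt.
exists ((D1 + 1) * M%:R - x 0%N) => m; rewrite mul1r.
(* A step before [M] loses at most [D1], that is [D1 + 1] against slope 1. *)
suff H : x 0%N + m%:R - (D1 + 1) * (minn m M)%:R <= x m.
  have : (minn m M)%:R <= M%:R :> R by rewrite ler_nat geq_minr.
  move=> k; have : (D1 + 1) * (minn m M)%:R <= (D1 + 1) * M%:R by apply: ler_wpM2l => //; lra.
  move: H; move: ((D1 + 1) * _) ((D1 + 1) * _) => a b; lra.
elim: m => [|m IH]; first by rewrite min0n mulr0; lra.
have hm := h m; have m0 : 0 <= m%:R :> R by rewrite ler0n.
have [mM|mM] := ltnP m M.
  rewrite (minn_idPl mM); rewrite (minn_idPl (ltnW mM)) in IH.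
  move: IH hm m0; rewrite -natr1; move: (m%:R : R) => a; nra.
rewrite (minn_idPr (leqW mM)); rewrite (minn_idPr mM) in IH.
have : (D1 + 1) <= e * m%:R.
  rewrite mulrC -ler_pdivrMr //; apply: le_trans hM _.
  by rewrite ler_nat.
move: IH hm; rewrite -natr1; move: (m%:R : R) ((D1 + 1) * _) => a b; lra.
Qed.

(** If the differences are constant the sequence is linear; if they tend to an infinity at least
    linearly, so does the sequence. *)
Lemma pseq_trichotomy d (x : nat -> R) : pseq d x ->
  [\/ forall m, x m = x 0%N,
      exists2 e : R, 0 < e & exists D, forall m, e * m%:R - D <= x m |
      exists2 e : R, 0 < e & exists D, forall m, e * m%:R - D <= - x m].
Proof.
elim: d x => [|d IH] x h; first by apply: Or31 => m; rewrite !h.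
have [E|[e e0 [D hD]]|[e e0 [D hD]]] := IH _ h.
- have xE m : x m = x 0%N + (x 1%N - x 0%N) * m%:R.
    elim: m => [|m IHm]; first by rewrite mulr0 addr0.
    by rewrite -[LHS](subrK (x m)) E {1}IHm -natr1; ring.
  have [a0|a0|a0] := ltgtP (x 1%N - x 0%N) 0.
  + apply: Or33; exists (- (x 1%N - x 0%N)); first by rewrite oppr_gt0.
    by exists (x 0%N) => m; rewrite (xE m); apply: le_of_eq; ring.
  + apply: Or32; exists (x 1%N - x 0%N); first by [].
    by exists (- x 0%N) => m; rewrite (xE m); apply: le_of_eq; ring.
  + by apply: Or31 => m; rewrite xE a0 mul0r addr0.
- by apply: Or32; exists 1 => //; exact: linear_growth e0 hD.
- apply: Or33; exists 1 => //; apply: (linear_growth (x := fun m => - x m) e0) => m.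
  by apply: le_trans (hD m) _; rewrite opprB opprK addrC.
Qed.

Lemma bounded_pseqR d (x : nat -> R) (B : R) : pseq d x -> (forall m, `|x m| <= B) ->
  forall m, x m = x 0%N.
Proof.
move=> h hB; have F e D : 0 < e -> ~ (forall m, e * m%:R - D <= B).
  move=> e0 H; have := H (Num.truncn ((B + D) / e)).+1.
  have := truncnS_gt ((B + D) / e); rewrite ltr_pdivrMr // mulrC; lra.
have [//|[e e0 [D hD]]|[e e0 [D hD]]] := pseq_trichotomy h; exfalso; apply: (F e D e0) => m.
  by apply: le_trans (hD m) _; apply: le_trans (ler_norm _) (hB m).
by apply: le_trans (hD m) _; apply: le_trans (ler_norm _) _; rewrite normrN.
Qed.

Lemma pseq_Re d (u : nat -> C) : pseq d u -> pseq d (fun m => ReC (u m)).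
Proof.
elim: d u => [|d IH] u h; first by move=> m; rewrite h.
by apply: pseq_ext (IH _ h) => m; rewrite ReB.
Qed.
Lemma pseq_Im d (u : nat -> C) : pseq d u -> pseq d (fun m => ImC (u m)).
Proof.
elim: d u => [|d IH] u h; first by move=> m; rewrite h.
by apply: pseq_ext (IH _ h) => m; rewrite ImB.
Qed.

Lemma bounded_pseq d (u : nat -> C) (B : R) : pseq d u -> (forall m, nm (u m) <= B) ->
  forall m, u m = u 0%N.
Proof.
move=> h hB m; apply: eqC.
  by apply: (bounded_pseqR (pseq_Re h)) => k; exact: le_trans (Re_le_nm _) (hB k).
by apply: (bounded_pseqR (pseq_Im h)) => k; exact: le_trans (Im_le_nm _) (hB k).
Qed.

Lemma pseq_subexp d (u : nat -> C) (q : R) : pseq d u -> 1 < q ->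
  exists2 K : R, 0 <= K & forall m, nm (u m) <= K * q ^+ m.
Proof.
move=> + q1; elim: d u => [|d IH] u h.
  by exists 0 => // m; rewrite h nm0 mul0r.
have [K K0 hK] := IH _ h.
exists (Num.max (nm (u 0%N)) (K / (q - 1))); first by rewrite le_max nm_ge0.
set K' := Num.max _ _; have : K' <= K' by [].
rewrite {1}/K' ge_max => /andP[k1 +]; move: K' k1 => K' k1; rewrite ler_pdivrMr ?subr_gt0 // => k2.
elim=> [|m IHm]; first by rewrite expr0 mulr1.
rewrite -(subrK (u m) (u m.+1)); apply: le_trans (nmD _ _) _.
apply: le_trans (lerD (hK m) IHm) _.
have qm : 0 <= q ^+ m by rewrite exprn_ge0 //; lra.
rewrite exprS; move: (q ^+ m) qm k2 => a; nra.
Qed.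

(* The modulus of [u] is [expR] of a real polynomial sequence; a nonconstant
   such exponential either tends to 0 or outgrows every polynomial. *)
Lemma pseq_exp d e (u v : nat -> C) : pseq d u -> pseq e v -> u 0%N != 0 ->
  (forall m, u m.+1 * cexp (v m) = u m) -> cexp (v 0%N) = 1.
Proof.
move=> hu hv u0 E.
pose x m := \sum_(i < m) ReC (v i).
have hx : pseq e.+1 x := pseq_sum (pseq_Re hv).
have ux m : nm (u m) * expR (x m) = nm (u 0%N).
  elim: m => [|m IH]; first by rewrite /x big_ord0 expR0 mulr1.
  rewrite -IH -(E m) nmM nm_cexp /x big_ord_recr /= expRD; ring.
have u0p : 0 < nm (u 0%N) by rewrite nm_gt0.
(* A bounded polynomial sequence is constant, so u(1) = u(0) and the factor e^v(0) is 1. *)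
suff [B hB] : exists B, forall m, nm (u m) <= B.
  have := E 0%N; rewrite (bounded_pseq hu hB 1) => H.
  by apply: (mulfI u0); rewrite H mulr1.
have uE m : nm (u m) = nm (u 0%N) * expR (- x m).
  by rewrite -(ux m) expRN mulfK // gt_eqF // expR_gt0.
have [xc|[a a0 [D hD]]|[a a0 [D hD]]] := pseq_trichotomy hx.
- exists (nm (u 0%N)) => m; rewrite uE xc /x big_ord0 oppr0 expR0 mulr1.
  exact: lexx.
- exists (nm (u 0%N) * expR D) => m; rewrite uE ler_pM2l // ler_expR.
  have := hD m; have : 0 <= a * m%:R by rewrite mulr_ge0 // ltW.
  move: (a * _) => y; lra.
(* Here |u(m)| is at least a constant times e^(a m), against the bound K e^(a m / 2) for a
   polynomial sequence. *)
- exfalso; have q1 : 1 < expR (a / 2) by rewrite expR_gt1 divr_gt0.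
  have [K K0 hK] := pseq_subexp hu q1.
  have q0 := expR_ge0 (a / 2).
  have qi : (expR (a / 2))^-1 < 1 by rewrite invf_lt1 // expR_gt0.
  have qi0 : 0 <= (expR (a / 2))^-1 by rewrite invr_ge0.
  have s0 : 0 < nm (u 0%N) * expR (- D) / 2 by rewrite divr_gt0 // mulr_gt0 // expR_gt0.
  have [N hN] := expr_small K qi0 qi s0.
  have := hN N (leqnn N); have := hK N; rewrite uE.
  have : expR (a * N%:R - D) <= expR (- x N) by rewrite ler_expR; exact: hD.
  have -> : expR (a * N%:R - D) = expR (a / 2) ^+ N * expR (a / 2) ^+ N * expR (- D).
    rewrite expRD -exprD addnn -muln2 mulnC exprM -[expR (a / 2) ^+ 2]expRM_natl.
    rewrite [expR (a * _)](_ : _ = expR a ^+ N); last by rewrite -expRM_natr.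
    by rewrite (_ : 2%:R * (a / 2) = a) //; field.
  rewrite exprVn.
  have qN : 0 < expR (a / 2) ^+ N by rewrite exprn_gt0 // expR_gt0.
  move: (expR (a / 2) ^+ N) qN (expR (- x N)) (expR (- D)) (nm (u 0%N)) u0p s0 => q q0' X Y U U0 s0.
  move=> h1 h2; rewrite mulrC ler_pdivrMr // => h3.
  have h4 : U * (q * q * Y) <= K * q by apply: le_trans h2; rewrite ler_pM2l.
  have h5 : U * Y * q <= K by rewrite -(ler_pM2r q0') (_ : _ * q * q = U * (q * q * Y)) //; ring.
  have : 0 < U * Y / 2 * q by rewrite mulr_gt0.
  move: h5 h3; rewrite (_ : U * Y / 2 * q = U * Y * q / 2); last by ring.
  move: (U * Y * q) => b; lra.
Qed.

End PolynomialSequences.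

(** * Poisson's formula and hyper-order *)

Section Poisson.
Variable R : realType.
Local Notation C := (Cplx R).
Implicit Types (r : R) (z w a : C) (f g h : C -> C).

(* [z / (z - a) + cj a * z / (r^2 - cj a * z)] is holomorphic near the circle
   |z| = r and coincides there with the Poisson kernel, so that the integral
   formula for [h] below has a nonnegative real weight. *)
Lemma poisson_kernel r a z : nm a < r -> nm z = r ->
  z / (z - a) + cj a * z / (rc (r ^+ 2) - cj a * z)
  = rc ((r ^+ 2 - nm a ^+ 2) / nm (z - a) ^+ 2).
Proof.
move=> ar zr; have w0 := circ_neq ar zr.
have z0 : z != 0 by rewrite -nm_gt0 zr; exact: le_lt_trans (nm_ge0 a) ar.
have cw0 : cj z - cj a != 0 by rewrite -cjB -nm_gt0 nm_cj nm_gt0.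
rewrite -zr rcM rcB rcV -!mul_cj cjB.

move: (cj z) (cj a) cw0 => u v cw0.
have -> : z * u - v * z = z * (u - v) by ring.
field.
by rewrite cw0 w0 z0.
Qed.

(** The first part of the kernel reproduces h(a) by Cauchy's formula; the second contributes mean 0,
    being holomorphic and zero at 0. The weight is at most (r + |a|) / (r - |a|), hence at most 3,
    and negative values of Re h are discarded. *)
Lemma poisson h a r : entire h -> 2 * nm a + 1 <= r ->
  ReC (h a) <= 3 * avg (fun t => Num.max 0 (ReC (h (circ r t)))).
Proof.
move=> eh ar2; have a0 := nm_ge0 a; have ar : nm a < r by lra.
have r0 : 0 < r by lra.
have r1 : r < r + 1 by rewrite ltrDl.
pose D z : C := rc (r ^+ 2) - cj a * z.
have D0 z : nm z < r + 1 -> D z != 0.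
  move=> zr; rewrite -nm_gt0 (lt_le_trans _ (nm_rtri _ _)) // nm_rc nmM nm_cj.
  rewrite ger0_norm ?sqr_ge0 // subr_gt0.
  have := nm_ge0 z; nra.
have eD : entire D.
  by apply: entireB; [exact: entire_cst|apply: entireZ; exact: entire_id].
have hD : hol (r + 1) (fun z => h z * (cj a * z / D z)).
  apply: holM; first exact: entire_hol.
  apply: holM; first by apply: entire_hol; apply: entireZ; exact: entire_id.
  by apply: holV; [exact: D0|exact: entire_hol].
have oh : onC r h := hol_onC (entire_hol eh) r1.
have oK := onC_kernel ar.
have E : h a = cmean r (fun z => h z * (z / (z - a) + cj a * z / D z)).
  rewrite (@cmean_ext _ _ _ (fun z => h z * (z / (z - a)) + h z * (cj a * z / D z)));
    [|exact: ltW|by move=> z _; rewrite mulrDr].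
  rewrite cmeanD; [|exact: ltW|exact: onCM|exact: hol_onC hD r1].
  rewrite -(mean_value hD r0 r1) mulr0 mul0r mulr0 addr0 {1}(cauchy (entire_hol eh) ar r1).
  by apply: cmean_ext => [|z _]; [exact: ltW|rewrite mulrCA mulrA].
rewrite E [leLHS]/(avg _).
have cu : continuous (fun t => Num.max 0 (ReC (h (circ r t)))).
  move=> t; apply: (@continuous_max R R (fun=> 0) (fun t => ReC (h (circ r t)))).
    exact: cvg_cst.
  exact: (onC_contRe (ltW r0) oh).
rewrite -avgZ //; apply: avg_le.
- apply: (onC_contRe (f := fun z => h z * (z / (z - a) + cj a * z / D z)) (ltW r0)).
  apply: onCM oh _; apply: onCD oK _.
  apply: onCM; first by apply: onCM; [exact: onC_cst|exact: onC_id].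
  apply: onCV; first by move=> z zr; apply: D0; rewrite zr.
  exact: (hol_onC (entire_hol eD) r1).
- by move=> t; apply: cvgM; [exact: cvg_cst|exact: cu].
move=> t; have zr := nm_circ t (ltW r0); move: (circ r t) zr => z zr.
rewrite -/(ReC _) (poisson_kernel ar zr) ReM Re_rc Im_rc mulr0 subr0.
have d1 : r - nm a <= nm (z - a) := circ_dist a zr.
have d0 : 0 < nm (z - a) by lra.
have P0 : 0 <= (r ^+ 2 - nm a ^+ 2) / nm (z - a) ^+ 2.
  rewrite divr_ge0 ?sqr_ge0 // subr_ge0; nra.
have P3 : (r ^+ 2 - nm a ^+ 2) / nm (z - a) ^+ 2 <= 3.
  rewrite ler_pdivrMr ?exprn_gt0 //; move: (nm (z - a)) d1 d0 => d d1 d0.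
  nra.
have [u0|u0] := leP 0 (ReC (h z)); first by rewrite mulrC ler_wpM2r.
rewrite mulr0; apply: mulr_le0_ge0 P0; exact: ltW.
Qed.

Lemma nevanlinna_cexp r h :
  nevanlinna_T r (fun z => cexp (h z)) = avg (fun t => Num.max 0 (ReC (h (circ r t)))).
Proof.
rewrite /nevanlinna_T /proximity /avg; congr (_ * _); apply: eq_Rintegral => t _.
by rewrite -circE -/(nm _) nm_cexp /log_plus expRK.
Qed.

Lemma hyper_order_bound f : (hyper_order f < +oo)%E ->
  exists (N : nat) (r0 : R), 0 <= r0 /\ forall r, r0 < r -> nevanlinna_T r f <= expR (r ^+ N).
Proof.
rewrite /hyper_order limf_esupE => H.
have [y [A [M [_ hM]] <-] yoo] : exists2 y,
    [set ereal_sup [set (ln (ln (nevanlinna_T r f)) / ln r)%:E | r in A]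
      | A in (+oo : set_system R)] y & (y < +oo)%E.
  apply: contrapT => /forall2NP h; move: H; rewrite ltNge => /negP; apply.
  apply: le_ereal_inf_tmp => y hy; have [//|/negP] := h y.
  by rewrite -leNgt.
have [b hb] : exists b : R, forall r, M < r -> ln (ln (nevanlinna_T r f)) / ln r <= b.
  have ub r : M < r -> ((ln (ln (nevanlinna_T r f)) / ln r)%:E
      <= ereal_sup [set (ln (ln (nevanlinna_T r f)) / ln r)%:E | r in A])%E.
    by move=> Mr; apply: ereal_sup_ubound; exists r => //; exact: hM.
  move: yoo ub; case: (ereal_sup _) => [b _ ub|//|_ ub].
    by exists b => r /ub; rewrite lee_fin.
  by exists 0 => r /ub; rewrite leeNy_eq.
pose N := (Num.truncn b).+1.
have bN : b <= N%:R by rewrite ltW // truncnS_gt.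
exists N, (Num.max M 1); split=> [|r]; first by rewrite le_max ler01 orbT.
rewrite gt_max => /andP[Mr r1].
have lnr : 0 < ln r by rewrite ln_gt0.
have r0 : 0 < r by lra.
(* For T <= 1 the iterated logarithm carries no information, but then e^(r^N) >= 1 suffices. *)
have [T1|T1] := leP (nevanlinna_T r f) 1.
  apply: le_trans T1 _; rewrite -[leLHS]expR0 ler_expR exprn_ge0 //; exact: ltW.
have T0 : 0 < nevanlinna_T r f by lra.
have lnT : 0 < ln (nevanlinna_T r f) by rewrite ln_gt0.
have := hb r Mr; rewrite ler_pdivrMr // => h.
rewrite -[leLHS]lnK ?posrE // ler_expR -[leLHS]lnK ?posrE // -[r ^+ N]lnK ?posrE ?exprn_gt0 //.
rewrite ler_expR lnXn // -[ln r *+ N]mulr_natl; apply: le_trans h _.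
by rewrite ler_pM2r.
Qed.

End Poisson.

(** * The exceptional value zero *)

Section ZeroExceptionalValue.
Variable R : realType.
Local Notation C := (Cplx R).
Implicit Types (r : R) (z w a c : C) (f g h : C -> C).

(** In the Borel-Caratheodory inequality for the radius 2 |z| + 1 the ratio |z| / (|z| + 1) is below
    1, so the constants do not depend on z. *)
Lemma entire_le_of_Re_le h (A : R) z : entire h -> 0 <= A ->
  (forall w, nm w < 2 * nm z + 1 -> ReC (h w) <= A) -> nm (h z) <= 2 * A + 3 * nm (h 0).
Proof.
move=> eh A0 hA; have z0 := nm_ge0 z.
have zs : nm z < 2 * nm z + 1 by lra.
have := borel_caratheodory (entire_hol eh) hA zs.
have := Re_le_nm (h 0); rewrite ler_norml => /andP[h0 _].
have := nmD (h z - h 0) (h 0); rewrite subrK.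
move: (nm_ge0 (h z - h 0)) (nm_ge0 (h 0)) h0.
move: (nm (h z - h 0)) (nm (h 0)) (ReC (h 0)) (nm (h z)) => d m q y d0 m0 h0 H1 H2.
suff : d <= 2 * (A + m) by lra.
rewrite -(@ler_pM2r _ (nm z + 1)); last by lra.
have : 2 * (A - q) * nm z <= 2 * (A + m) * nm z by apply: ler_wpM2r => //; lra.
move: H2; rewrite (_ : 2 * nm z + 1 - nm z = nm z + 1); last by ring.
nra.
Qed.

Definition exp_growth f := exists (K : R) (N : nat), 0 <= K /\
  forall z, nm (f z) <= expR (K * (1 + nm z) ^+ N).

Lemma exp_growth_shift f a : exp_growth f -> exp_growth (fun z => f (z + a)).
Proof.
move=> [K [N [K0 h]]]; exists (K * (1 + nm a) ^+ N), N.
have a0 := nm_ge0 a; split; first by rewrite mulr_ge0 // exprn_ge0 //; lra.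
move=> z; apply: le_trans (h _) _; rewrite ler_expR -mulrA -exprMn ler_wpM2l //.
have := nmD z a; have := nm_ge0 z; have := nm_ge0 (z + a) => ? ? ?.
apply: lerXn2r; rewrite ?nnegrE; nra.
Qed.

Lemma exp_growth_cexp h : entire h -> (hyper_order (fun z => cexp (h z)) < +oo)%E ->
  exp_growth h.
Proof.
move=> eh /hyper_order_bound[N [r0 [r00 hT]]].
(* The radius r = c (1 + |z|) exceeds [r0], and 2 |w| + 1 for all |w| < 2 |z| + 1. *)
pose c := 4 + r0; pose m := nm (h 0).
have m0 : 0 <= m := nm_ge0 _.
have c0 : 0 <= c by rewrite /c; lra.
have cN : 0 <= c ^+ N by rewrite exprn_ge0.
exists (3 * c ^+ N + 6 + 3 * m), N; split=> [|z]; first by lra.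
have z0 := nm_ge0 z.
pose r := c * (1 + nm z).
have rE : r = 4 + 4 * nm z + r0 * (1 + nm z) by rewrite /r /c; ring.
have rz : r0 <= r0 * (1 + nm z) by rewrite -[leLHS]mulr1 ler_wpM2l //; lra.
have rr : r0 < r by lra.
have H w : nm w < 2 * nm z + 1 -> ReC (h w) <= 3 * expR (r ^+ N).
  move=> wz; apply: le_trans (@poisson R h w r eh _) _; first by lra.
  by rewrite ler_pM2l // -nevanlinna_cexp; exact: hT.
have E0 := expR_ge0 (r ^+ N).
have E1 : 1 <= expR (r ^+ N) by rewrite -[leLHS]expR0 ler_expR exprn_ge0 //; lra.
have H0 : 0 <= 3 * expR (r ^+ N) by lra.
apply: le_trans (entire_le_of_Re_le eh H0 H) _; rewrite -/m.
have p1 : 1 <= (1 + nm z) ^+ N by apply: exprn_ege1; lra.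
apply: (@le_trans _ _ (expR (6 + 3 * m) * expR (r ^+ N))).
  have := expR_ge1Dx (6 + 3 * m); move: (expR (r ^+ N)) E0 E1 (expR (6 + 3 * m)) => e e0 e1 y; nra.
rewrite -expRD ler_expR /r exprMn.
move: ((1 + nm z) ^+ N) p1 => p p1; move: (c ^+ N) cN => q q0; nra.
Qed.

Lemma exp_growth_small h S : exp_growth h -> small h h S -> exp_growth S.
Proof.
move=> [K [N [K0 hK]]] [K' [N' [K'0 hS]]].
exists (K' + N'%:R * (K * 2 ^+ N + 1)), N.
have k2 : 0 <= K * 2 ^+ N by rewrite mulr_ge0 // exprn_ge0.
have n0 : 0 <= N'%:R :> R by rewrite ler0n.
split=> [|z]; first by nra.
have z0 := nm_ge0 z.
have p1 : 1 <= (1 + nm z) ^+ N by apply: exprn_ege1; lra.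
pose b := K * 2 ^+ N * (1 + nm z) ^+ N.
have b0 : 0 <= b by rewrite mulr_ge0 //; lra.
have B1 : 1 <= expR b by rewrite -[leLHS]expR0 ler_expR.
have hB w : nm (w - z) <= 1 -> nm (h w) <= expR b.
  move=> wz; apply: le_trans (hK w) _; rewrite ler_expR /b -mulrA -exprMn ler_wpM2l //.
  have := nmD (w - z) z; rewrite subrK; have := nm_ge0 w => w0 wz'.
  apply: lerXn2r; rewrite ?nnegrE; lra.
apply: le_trans (hS z 1 (expR b) ltr01 B1 (fun w wz => conj (hB w wz) (hB w wz))) _.
apply: (@le_trans _ _ (expR K' * (expR b * expR 1) ^+ N')).
  apply: ler_pM.
  - exact: K'0.
  - by rewrite exprn_ge0 // mulr_ge0 ?expR_ge0 // invr1; lra.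
  - by have := expR_ge1Dx K'; lra.
  apply: lerXn2r; rewrite ?nnegrE.
  - by rewrite mulr_ge0 ?expR_ge0 // invr1; lra.
  - by rewrite mulr_ge0 ?expR_ge0.
  rewrite ler_wpM2l ?expR_ge0 // invr1; exact: expR_ge1Dx.
rewrite -expRD -expRM_natl -expRD ler_expR /b.
move: ((1 + nm z) ^+ N) p1 => p p1.
have -> : (K' + N'%:R * (K * 2 ^+ N + 1)) * p = K' * p + N'%:R * (K * 2 ^+ N * p + p) by ring.
apply: lerD; first by rewrite -[leLHS]mulr1 ler_wpM2l.
by apply: ler_wpM2l => //; rewrite lerD2l.
Qed.

(** Bounding e^G = B(z) / B(z + c) needs a lower bound for the denominator; [quotient_bound]
    supplies it after a translation that makes the denominator nonzero at 0. This bounds Re G, hence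
    G, by a polynomial in |z|. *)
Lemma exponent_polynomial B G c y : entire B -> exp_growth B -> entire G -> B y != 0 ->
  (forall z, cexp (G z) * B (z + c) = B z) -> exists p : {poly C}, forall z, G z = p.[z].
Proof.
move=> eB gB eG By E.
have [K1 [N1 [K10 h1]]] := exp_growth_shift y gB.
have [K2 [N2 [K20 h2]]] := exp_growth_shift (y - c) gB.
pose K := K1 + K2; pose N := (N1 + N2)%N.
pose F z := G (z + (y - c)).
have eF : entire F := entire_shift eG.
have EF z : B (z + y) * cexp (F z) = B (z + (y - c)).
  by rewrite -(E (z + (y - c))) /F mulrC -[in RHS]addrA subrK.
have b0 : 0 < nm (B y) by rewrite nm_gt0.
pose l := ln (nm (B y)).
have el : expR l = nm (B y) by rewrite /l lnK.
pose L (x : R) := K * (1 + x) ^+ N.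
have hL z x : nm z <= x -> nm (B (z + y)) <= expR (L x) /\ nm (B (z + (y - c))) <= expR (L x).
  move=> zx; have z0 := nm_ge0 z; have x1 : 1 <= 1 + x by lra.
  have p n n' : (1 + nm z) ^+ n <= (1 + x) ^+ (n + n').
    apply: (@le_trans _ _ ((1 + x) ^+ n)); first by apply: lerXn2r; rewrite ?nnegrE; lra.
    by apply: ler_weXn2l; rewrite // leq_addr.
  have q : 0 <= (1 + x) ^+ N by rewrite exprn_ge0 //; lra.
  split; [apply: le_trans (h1 z) _|apply: le_trans (h2 z) _]; rewrite ler_expR /L /K mulrDl.
    by apply: ler_wpDr; [rewrite mulr_ge0|rewrite ler_wpM2l ?p].
  by apply: ler_wpDl; [rewrite mulr_ge0|rewrite ler_wpM2l // /N addnC p].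
have lL x : 0 <= x -> l <= L x.
  move=> x0; have := (hL 0 x _).1; rewrite nm0 add0r => /(_ x0).
  by rewrite -el ler_expR.
have ReF z w : nm w < 2 * nm z + 1 -> ReC (F w) <= 5 * (L (4 * nm z + 3) - l).
  move=> wz; have z0 := nm_ge0 z; have w0 := nm_ge0 w.
  have l0 := lL (4 * nm z + 3) ltac:(lra).
  (* For |w| < 2 |z| + 1 and r = 4 |z| + 2 the ratio r / (r - |w|) is at most 2; hence 5 = 1 + 2 *
     2. *)
  have := @quotient_bound R (4 * nm z + 2) (4 * nm z + 3) (4 * nm z + 4)
    (fun z => B (z + y)) (fun z => cexp (F z)) (expR (L (4 * nm z + 3)))
    (expR (L (4 * nm z + 3))) w.
  rewrite add0r expRK -/l -el => Q; apply: Re_cexp_le.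
  apply: le_trans (Q _ _ _ _ _ _ _ _ _ _ _) _; clear Q.
  - lra.
  - lra.
  - lra.
  - by apply: entire_hol; exact: entire_shift.
  - by apply: entire_hol; exact: entire_cexp.
  - exact: By.
  - exact: expR_gt0.
  - exact: expR_ge0.
  - by move=> u ux; apply: (hL u _ _).1; rewrite ux.
  - by move=> u ux; rewrite EF; apply: (hL u _ _).2; rewrite ux.
  - lra.
  move: (L (4 * nm z + 3)) l0 => M l0; rewrite -expRN -!expRD ler_expR.
  have : 2 * (M - l) * (4 * nm z + 2) / (4 * nm z + 2 - nm w) <= 4 * (M - l).
    rewrite ler_pdivrMr; last by lra.
    have : (M - l) * (4 * nm z + 2) <= (M - l) * (2 * (4 * nm z + 2 - nm w)).
      by apply: ler_wpM2l; lra.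
    nra.
  lra.
pose m := nm (F 0); have m0 : 0 <= m := nm_ge0 _.
have K0 : 0 <= K by rewrite addr_ge0.
have [p hp] : exists p : {poly C}, forall z, F z = p.[z].
  apply: (@liouville_poly R F N (10 * (K * 4 ^+ N + `|l|) + 3 * m) eF) => z.
  have z0 := nm_ge0 z.
  have A0 : 0 <= 5 * (L (4 * nm z + 3) - l).
    by have := lL (4 * nm z + 3); lra.
  apply: le_trans (entire_le_of_Re_le eF A0 (ReF z)) _; rewrite -/m.
  have -> : L (4 * nm z + 3) = K * 4 ^+ N * (1 + nm z) ^+ N.
    by rewrite /L -mulrA -exprMn; congr (_ * _ ^+ _); ring.
  have p1 : 1 <= (1 + nm z) ^+ N by apply: exprn_ege1; lra.
  have : - l <= `|l| by rewrite -normrN ler_norm.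
  have := normr_ge0 l.
  move: (K * 4 ^+ N) ((1 + nm z) ^+ N) p1 (`|l|) => k q q1 al l0 l1.
  have : (al + m) * 1 <= (al + m) * q by apply: ler_wpM2l; lra.
  nra.
exists (p \Po ('X - (y - c)%:P)) => z.
by rewrite horner_comp hornerXsubC -hp /F subrK.
Qed.

(** A class that contains [bell k L], is closed under derivation and allows induction on the way its
    members are built from the derivatives of [L]. *)
Inductive diff_poly (L : C -> C) : (C -> C) -> Prop :=
| diff_poly_cst a : diff_poly L (fun=> a)
| diff_poly_gen j : diff_poly L (derive1n j L)
| diff_polyD F G : diff_poly L F -> diff_poly L G -> diff_poly L (fun z => F z + G z)
| diff_polyM F G : diff_poly L F -> diff_poly L G -> diff_poly L (fun z => F z * G z).

Lemma diff_poly_entire L F : entire L -> diff_poly L F -> entire F.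
Proof.
move=> eL; elim=> [a|j|F1 F2 _ e1 _ e2|F1 F2 _ e1 _ e2].
- exact: entire_cst.
- exact: entire_derive1n.
- exact: entireD.
- exact: entireM.
Qed.

Lemma diff_poly_derive L F : entire L -> diff_poly L F -> diff_poly L (derive1 F).
Proof.
move=> eL; elim=> [a|j|F1 F2 d1 e1 d2 e2|F1 F2 d1 e1 d2 e2].
- have -> : derive1 (fun=> a : C) = (fun=> 0 : C).
    by apply/funext => z; rewrite (cder_derive1 (cder_cst a z)).
  exact: diff_poly_cst.
- exact: (diff_poly_gen L j.+1).
- have -> : derive1 (fun z => F1 z + F2 z) = fun z => derive1 F1 z + derive1 F2 z.
    apply/funext => z; apply: cder_derive1.
    exact: cderD (entire_cder (diff_poly_entire eL d1) z) (entire_cder (diff_poly_entire eL d2) z).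
  exact: (diff_polyD e1 e2).
- have -> : derive1 (fun z => F1 z * F2 z) = fun z => derive1 F1 z * F2 z + F1 z * derive1 F2 z.
    apply/funext => z; apply: cder_derive1.
    exact: cderM (entire_cder (diff_poly_entire eL d1) z) (entire_cder (diff_poly_entire eL d2) z).
  exact: (diff_polyD (diff_polyM e1 d2) (diff_polyM d1 e2)).
Qed.

Lemma diff_poly_bell L k : entire L -> diff_poly L (bell k L).
Proof.
move=> eL; elim: k => [|k IH]; first exact: diff_poly_cst.
apply: diff_polyD; first exact: diff_poly_derive.
by apply: diff_polyM IH; exact: (diff_poly_gen L 0).
Qed.

Lemma derive1n_increment F c (p : {poly C}) j : entire F ->
  (forall z, F (z + c) = F z + p.[z]) ->
  exists q : {poly C}, forall z, derive1n j F (z + c) = derive1n j F z + q.[z].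
Proof.
move=> eF hp; elim: j => [|j [q hq]]; first by exists p.
have eFj := @entire_derive1n R j F eF.
exists q^`() => z.
rewrite -[derive1n j.+1 F (z + c)]/(derive1 (derive1n j F) (z + c)).
rewrite -[derive1n j.+1 F z]/(derive1 (derive1n j F) z).
rewrite -(cder_derive1 (cder_shift (entire_cder eFj (z + c)))).
apply: cder_derive1; apply: (cder_ext (fun z => esym (hq z))).
by apply: cderD; [exact: entire_cder|exact: cder_horner].
Qed.

Lemma increment_pseq F c (p : {poly C}) z : (forall z, F (z + c) = F z + p.[z]) ->
  exists d, pseq d (fun m => F (z + c *+ m)).
Proof.
move=> hp; have [d hd] := pseq_horner p z c.
exists d.+1; apply: pseq_ext hd => m.
by rewrite mulrSr addrA hp addrAC subrr add0r.
Qed.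

(** If L(z + c) - L(z) is a polynomial, so are the increments of all derivatives of [L], whose
    values along z + m c are then polynomial in m; sums and products preserve this. *)
Lemma diff_poly_pseq L F c (p : {poly C}) z : entire L ->
  (forall z, L (z + c) = L z + p.[z]) -> diff_poly L F ->
  exists d, pseq d (fun m => F (z + c *+ m)).
Proof.
move=> eL hp; elim=> [a|j|F1 F2 _ [d1 e1] _ [d2 e2]|F1 F2 _ [d1 e1] _ [d2 e2]].
- by exists 1%N => m; exact: subrr.
- by have [q hq] := derive1n_increment j eL hp; exact: increment_pseq hq.
- by exists (d1 + d2)%N; exact: pseqD.
- exact: pseqM e1 e2.
Qed.

Lemma zero_exceptional h c n k : transcendental_entire (fun z => cexp (h z)) -> entire h ->
  (0 < k)%N -> (hyper_order (fun z => cexp (h z)) < +oo)%E ->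
  (forall z, cexp (h (z + c)) ^+ n * derive1n k (fun z => cexp (h z)) (z + c)
    = cexp (h z) ^+ n * derive1n k (fun z => cexp (h z)) z) ->
  forall z, cexp (h (z + c *+ n.+1)) = cexp (h z).
Proof.
case: k => // k [ef npoly] eh _ ho per.
pose L := derive1 h; have eL : entire L := entire_derive eh.
have dh z : cder h z (L z) := entire_cder eh z.
pose B := bell k.+1 L; have eB : entire B := @entire_bell R k.+1 L eL.
have Dk : derive1n k.+1 (fun z => cexp (h z)) = fun z => B z * cexp (h z).
  rewrite -(derive1n_exp k 0 eL dh); congr (derive1n _ _).
  by apply/funext => z; exact: esym (addr0 _).
have [y By] : exists y, B y != 0.
  apply: contrapT => /forallNP nex; apply: npoly.
  apply: (@derive1n_poly R k.+1 _ ef) => z; rewrite Dk.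
  by have := nex z => /negP/negPn/eqP ->; rewrite mul0r.
have gh : exp_growth h := exp_growth_cexp eh ho.
have gB : exp_growth B.
  by apply: exp_growth_small gh _; apply: small_bell eL _; exact: (small_derive eh (small_h1 h h)).
pose G z := n.+1%:R * (h (z + c) - h z).
have eG : entire G := @entireZ R n.+1%:R _ (entireB (@entire_shift R h c eh) eh).
have GB z : cexp (G z) * B (z + c) = B z.
  have := per z; rewrite Dk /G cexp_nat cexpB.
  have := cexp_neq0 (h z); have := cexp_neq0 (h (z + c)).
  move: (cexp (h z)) (cexp (h (z + c))) (B z) (B (z + c)) => g1 g2 b1 b2 g20 g10 E.
  apply: (mulIf (expf_neq0 n.+1 g10)); rewrite expr_div_n.
  have -> : g2 ^+ n.+1 / g1 ^+ n.+1 * b2 * g1 ^+ n.+1 = g2 ^+ n.+1 * b2.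
    by rewrite mulrAC divfK // expf_neq0.
  by rewrite !exprSr [b1 * _]mulrC -!mulrA [g2 * _]mulrC [g1 * _]mulrC.
have [p hp] := exponent_polynomial eB gB eG By GB.
have n0 : (n.+1%:R : C) != 0 by rewrite pnatr_eq0.
have hc z : h (z + c) = h z + n.+1%:R^-1 * G z.
  by rewrite /G (mulKf n0) [RHS]addrC subrK.
have [q hq] : exists q : {poly C}, forall z, L (z + c) = L z + q.[z].
  have hc' z : h (z + c) = h z + (n.+1%:R^-1 *: p).[z] by rewrite hornerZ -hp.
  have [q hq] := @derive1n_increment h c _ 1%N eh hc'.
  by exists q => z; exact: (hq z).
(* Where [B] does not vanish, the polynomial sequences B(w + m c) and G(w + m c) are linked by an
   exponential, which forces e^G = 1; the identity then extends to all points. *)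
have p1 z : cexp (p.[z]) = 1.
  apply: (@entire_eq R (fun z => cexp (p.[z])) (fun=> 1) B y _ _ eB By) => [||w Bw].
  - by apply: entire_cexp; exact: entire_horner.
  - exact: entire_cst.
  have [d hd] := diff_poly_pseq w eL hq (diff_poly_bell k.+1 eL).
  have [e he] := pseq_horner p w c.
  have H := @pseq_exp R d e (fun m => B (w + c *+ m)) (fun m => p.[w + c *+ m]) hd he.
  rewrite -[w]addr0 -(mulr0n c); apply: H; first by rewrite mulr0n addr0.
  by move=> m; rewrite -hp mulrSr addrA mulrC GB.
have G0 z : G z = G 0.
  apply: (entire_const eG) => w.
  have D := cder_comp (entire_cder eG w) (cder_cexp (G w)).
  have c1 v : cexp (G v) = 1 by rewrite hp p1.
  have := cder_derive1 (cder_ext c1 D).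
  by rewrite (cder_derive1 (@cder_cst R 1 w)) c1 mul1r => <-.
have [kp hkp] : exists kp, forall z, h (z + c) = h z + kp.
  by exists (n.+1%:R^-1 * G 0) => z; rewrite hc G0.
have hm z m : h (z + c *+ m) = h z + kp *+ m.
  elim: m => [|m IH]; first by rewrite !mulr0n !addr0.
  by rewrite !mulrSr !addrA hkp IH.
(* Only the multiple (n + 1) [kp] is known to have exponential 1, hence the multiple of the
   period. *)
have kpE : kp *+ n.+1 = G 0.
  by rewrite /G hkp [h 0 + kp]addrC addrK mulr_natl.
move=> z; rewrite hm kpE cexpD hp p1; exact: mulr1.
Qed.

End ZeroExceptionalValue.

Theorem theorem3p1 (R : realType) (f : Cplx R -> Cplx R) (n k : nat)
    (c : Cplx R)
    (hf : transcendental_entire f) (hn : (0 < n)%N) (hk : (0 < k)%N)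
    (hper : periodic_of_period (fun z : Cplx R => f z ^+ n * derive1n k f z) c)
    (hcase : (Picard_exceptional f 0 /\ (hyper_order f < +oo)%E)
             \/ (exists d : Cplx R, d <> 0 /\ Picard_exceptional f d)) :
  periodic_of_period f c \/ periodic_of_period f (c *+ n.+1).
Proof.
have [c0 per] := hper.
case: hcase => [[f0 ho]|[d [/eqP d0 fd]]]; last first.
  by left; split; [exact: c0|exact: (nonzero_exceptional hf hn hk d0 fd per)].
right; split; first by rewrite mulrn_eq0 negb_or c0.
have fn z : f z != 0 by apply/eqP; exact: f0.
have [h eh E] := entire_log (proj1 hf) fn.
have {}E : f = fun z => cexp (h z) by apply/funext => z; exact: E.
move: hf per ho; rewrite E => hf per ho; exact: (zero_exceptional hf eh hk ho per).
Qed.
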